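(* Let $k\ge 1$ be an integer and $\varepsilon\in(0,1/2)$. Write $\Lambda:=2k+C_0\log(k/\varepsilon)$, where $C_0$ is an absolute constant. If $\mathcal F$ admits query-weight exact-sum, there is an algorithm that returns $S\in\mathcal F$ with $$\mathbb E[\mathrm{Top}_k(S)]\ \ge\ \mathrm{OPT}-O((k+1)\varepsilon)\,W\ \ge\ \bigl(1-O((k+1)\varepsilon)\bigr)\mathrm{OPT},$$ where $W$ is the surplus scale, in time $$n^{O(1/\varepsilon^2)}\,(k\Lambda/\varepsilon)^{O(k\Lambda^2/\varepsilon^6)}$$ times the cost of one query-weight exact-sum call of the same magnitude (i.e. with query weights of that magnitude).
   Context: $X_1,\dots,X_n$ are independent nonnegative discrete random variables, each given by an explicit finite list of atoms and masses; $\mathcal F\subseteq 2^{[n]}$. $\mathrm{Top}_k(S)$ is the sum of the $k$ largest values among $(X_i)_{i\in S}$ (padded with zeros if $|S|<k$), and $\mathrm{OPT}=\max_{S\in\mathcal F}\mathbb E[\mathrm{Top}_k(S)]$. Surplus scale: $W=kT$, where $T\ge 0$ satisfies $\max_{S\in\mathcal F}\sum_{i\in S}\mathbb E[\max\{X_i-T,0\}]=kT$; it satisfies $W\le\mathrm{OPT}\le 2W$. Query-weight exact-sum: let $\langle\mathcal F\rangle$ be the bit length of the encoding of $\mathcal F$. Given integer query weights $w_i$ of magnitude $M=\max_i|w_i|$ and a target $t$, decide whether some $S\in\mathcal F$ satisfies $\sum_{i\in S}w_i=t$ and return one such $S$ if so (vector targets are encoded by mixed radix). $\mathcal F$ admits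 query-weight exact-sum if this can be done in time $\mathrm{poly}(\langle\mathcal F\rangle)\,M^{O(1)}$. The absolute constant $C_0$ is chosen so that, for every sum $N$ of independent Bernoulli variables with mean at least $\Lambda$, $k-\mathbb E[\min(k,N)]\le\varepsilon^2$.
   Formalization: The time bound carries an extra factor polynomial in the length of the input (the encoding of F and the lists of rational atoms and masses), with absolute exponent; without it the bound fails already for n=2, since the lists must be read. *)

(* Defs.v *)
From HB Require Import structures.
From mathcomp Require Import all_boot all_order all_algebra.
From mathcomp Require Import all_classical all_reals all_analysis.
Set Implicit Arguments.
Unset Strict Implicit.
Unset Printing Implicit Defensive.
Import Order.TTheory GRing.Theory Num.Theory.
Local Open Scope ring_scope.

(* Machine model: closed point-free programs over binary trees with integer
   leaves.  Tree nodes are shared pointers, so pairing, projecting and copying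
   have unit cost; integer arithmetic is charged the bit length of its operands
   (logarithmic cost), so that running time is polynomially related to the
   running time of a Turing machine. *)

Inductive value : Type :=
| VInt of int
| VPair of value & value.

Definition bitlen (z : int) : nat := up_log 2 `|z|%N.+1.

Fixpoint value_size (v : value) : nat :=
  match v with
  | VInt z => (bitlen z).+1
  | VPair v1 v2 => (value_size v1 + value_size v2).+1
  end.

Inductive arith_op : Type := OpAdd | OpSub | OpMul | OpDiv | OpLe.

(* OpDiv is Euclidean division, with x / 0 = 0. *)
Definition arith (o : arith_op) (x y : int) : int :=
  match o with
  | OpAdd => x + y
  | OpSub => x - y
  | OpMul => x * y
  | OpDiv => (x %/ y)%Z
  | OpLe => Posz (x <= y)%R
  end.

Inductive prog : Type :=
| PId
| PFst
| PSnd
| PIsPair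
| PConst of int
| PArith of arith_op
| PSeq of prog & prog
| PFork of prog & prog
| PIf of prog & prog & prog
| PWhile of prog & prog.

(* [exec p v t w]: on input v, the program p halts with result w in time t.
   The integer 0 is false and every other integer is true; a program applied
   to a value of the wrong shape has no result. *)
Inductive exec : prog -> value -> nat -> value -> Prop :=
| EId v : exec PId v 1 v
| EFst v1 v2 : exec PFst (VPair v1 v2) 1 v1
| ESnd v1 v2 : exec PSnd (VPair v1 v2) 1 v2
| EIsPairInt z : exec PIsPair (VInt z) 1 (VInt 0)
| EIsPairPair v1 v2 : exec PIsPair (VPair v1 v2) 1 (VInt 1)
| EConst z v : exec (PConst z) v (bitlen z).+1 (VInt z)
| EArith o x y :
    exec (PArith o) (VPair (VInt x) (VInt y)) (bitlen x + bitlen y).+1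
      (VInt (arith o x y))
| ESeq p q v t1 u t2 w :
    exec p v t1 u -> exec q u t2 w -> exec (PSeq p q) v (t1 + t2).+1 w
| EFork p q v t1 w1 t2 w2 :
    exec p v t1 w1 -> exec q v t2 w2 ->
    exec (PFork p q) v (t1 + t2).+1 (VPair w1 w2)
| EIfTrue b p q v t0 z t w :
    exec b v t0 (VInt z) -> z != 0 -> exec p v t w ->
    exec (PIf b p q) v (t0 + t).+1 w
| EIfFalse b p q v t0 t w :
    exec b v t0 (VInt 0) -> exec q v t w ->
    exec (PIf b p q) v (t0 + t).+1 w
| EWhileStop b p v t0 :
    exec b v t0 (VInt 0) -> exec (PWhile b p) v t0.+1 v
| EWhileStep b p v t0 z t1 u t2 w :
    exec b v t0 (VInt z) -> z != 0 -> exec p v t1 u ->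
    exec (PWhile b p) u t2 w ->
    exec (PWhile b p) v (t0 + t1 + t2).+1 w.

Definition enc_seq : seq value -> value := foldr VPair (VInt 0).

Definition enc_bits (c : seq bool) : value :=
  enc_seq [seq VInt (Posz b) | b : bool <- c].

Definition enc_rat (q : rat) : value := VPair (VInt (numq q)) (VInt (denq q)).

Definition enc_dist (D : seq (rat * rat)) : value :=
  enc_seq [seq VPair (enc_rat am.1) (enc_rat am.2) | am <- D].

Definition enc_set (n : nat) (S : {set 'I_n}) : value :=
  enc_seq [seq VInt (Posz (i \in S)) | i <- enum 'I_n].

Definition enc_answer (n : nat) (o : option {set 'I_n}) : value :=
  match o with
  | None => VInt 0
  | Some A => VPair (VInt 1) (enc_set A)
  end.

(* A class of encoded set systems.  A single set system is fixed data, so time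
   bounds polynomial in the length of its encoding only make sense over such a
   class: the bit string c, when valid, encodes [set_family c]. *)
Record set_system_class : Type := SetSystemClass {
  valid_code : seq bool -> Prop;
  ground_size : seq bool -> nat;
  set_family : forall c : seq bool, {set {set 'I_(ground_size c)}}
}.

Definition enc_query (n : nat) (c : seq bool) (w : 'I_n -> int) (t : int) :
    value :=
  VPair (enc_bits c)
    (VPair (enc_seq [seq VInt (w i) | i <- enum 'I_n]) (VInt t)).

Definition exact_sum_answer (n : nat) (F : {set {set 'I_n}})
    (w : 'I_n -> int) (t : int) (o : option {set 'I_n}) : Prop :=
  match o with
  | Some A => A \in F /\ \sum_(i in A) w i = t
  | None => forall A, A \in F -> \sum_(i in A) w i <> t
  end.

(* Q solves query-weight exact-sum on the class K, and [cost c M] bounds its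
   running time on queries of magnitude at most M to the set system encoded by
   c.  Targets with |t| > n M are trivially unattainable; excluding them lets
   the bound depend on M only, as reading t takes time log |t|. *)
Definition solves_exact_sum (K : set_system_class) (Q : prog)
    (cost : seq bool -> nat -> nat) : Prop :=
  forall (c : seq bool) (M : nat) (w : 'I_(ground_size K c) -> int) (t : int),
    valid_code K c ->
    (forall i, `|w i|%N <= M)%N ->
    (`|t|%N <= ground_size K c * M)%N ->
    exists (o : option {set 'I_(ground_size K c)}) (time : nat),
      [/\ exec Q (enc_query c w t) time (enc_answer o),
          exact_sum_answer (set_family K c) w t o &
          (time <= cost c M)%N].

(* "K admits query-weight exact-sum", with its witnesses: an algorithm Q of
   cost poly(<F>) M^O(1).  M.+1 is used in place of M to allow M = 0. *)
Definition admits_exact_sum (K : set_system_class) (Q : prog)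
    (cost : seq bool -> nat -> nat) : Prop :=
  solves_exact_sum K Q cost /\
  exists a : nat, forall (c : seq bool) (M : nat), valid_code K c ->
    (cost c M <= a * (size c).+1 ^ a * M.+1 ^ a)%N.

(* A discrete distribution is a list of pairs (atom, mass). *)
Definition nonneg_dist (D : seq (rat * rat)) : Prop :=
  (forall am, am \in D -> 0 <= am.1 /\ 0 <= am.2) /\
  \sum_(am <- D) am.2 = 1.

Definition real_dist (R : realType) (D : seq (rat * rat)) : seq (R * R) :=
  [seq (ratr am.1, ratr am.2) | am <- D].

(* Expectation of f (X_0, ..., X_(n-1)) for independent X_i of distribution
   D i: the joint distribution is the product, and an outcome selects one entry
   of each list. *)
Definition expect (R : realType) (n : nat) (D : 'I_n -> seq (R * R))
    (f : ('I_n -> R) -> R) : R :=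
  \sum_(a : {dffun forall i : 'I_n, 'I_(size (D i))})
    (\prod_(i < n) (nth (0, 0) (D i) (a i)).2) *
    f (fun i => (nth (0, 0) (D i) (a i)).1).

(* Values of x are meant to be nonnegative; [take] keeps everything when S has
   fewer than k elements, which is the same as padding with zeros. *)
Definition top_sum (R : realType) (n k : nat) (S : {set 'I_n})
    (x : 'I_n -> R) : R :=
  \sum_(v <- take k (sort (fun y z : R => z <= y) [seq x i | i <- enum S])) v.

Definition exp_top (R : realType) (n k : nat) (D : 'I_n -> seq (R * R))
    (S : {set 'I_n}) : R :=
  expect D (top_sum k S).

(* Here and in [is_surplus_threshold] the maximum is over a nonempty F of
   nonnegative quantities, so the default value 0 is harmless. *)
Definition opt (R : realType) (n k : nat) (D : 'I_n -> seq (R * R))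
    (F : {set {set 'I_n}}) : R :=
  \big[Num.max/0]_(S in F) exp_top k D S.

Definition is_surplus_threshold (R : realType) (n k : nat)
    (D : 'I_n -> seq (R * R)) (F : {set {set 'I_n}}) (T : R) : Prop :=
  0 <= T /\
  \big[Num.max/0]_(S in F)
    \sum_(i in S) expect D (fun x => Num.max (x i - T) 0) = k%:R * T.

Definition Lambda (R : realType) (C0 : R) (k : nat) (eps : R) : R :=
  2 * k%:R + C0 * ln (k%:R / eps).

Definition bernoulli_dist (R : realType) (p : R) : seq (R * R) :=
  [:: (0, 1 - p); (1, p)].

Definition bernoulli_saturation (R : realType) (C0 : R) : Prop :=
  forall (k : nat) (eps : R), (0 < k)%N -> 0 < eps -> eps < 1 / 2 ->
  forall (m : nat) (p : 'I_m -> R), (forall i, 0 <= p i <= 1) ->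
    Lambda C0 k eps <= \sum_(i < m) p i ->
    k%:R - expect (fun i => bernoulli_dist (p i))
             (fun x => Num.min k%:R (\sum_(i < m) x i)) <= eps ^+ 2.

(* n^(c / eps^2) * (k L / eps)^(c k L^2 / eps^6) *)
Definition overhead (R : realType) (c : R) (n k : nat) (L eps : R) : R :=
  (n%:R `^ (c / eps ^+ 2)) *
  ((k%:R * L / eps) `^ (c * (k%:R * L ^+ 2 / eps ^+ 6))).

Definition enc_instance (n : nat) (c : seq bool)
    (X : 'I_n -> seq (rat * rat)) : value :=
  VPair (enc_bits c) (enc_seq [seq enc_dist (X i) | i <- enum 'I_n]).

(* Main.v *)
(* E[Top_k(S)] is the integral over t of E[min(k, N_S(t))], where N_S(t) counts
   the i in S with X_i >= t, so only the law of each N_S(t) matters. It suffices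
   to sample t at the m^2 multiples of a step theta between T / m and 3 T / m,
   where m is about 1 / eps; above m^2 theta two variables are rarely both large,
   so Top_k may be replaced there by the sum of the excesses. At a fixed level,
   write each P(X_i >= t), rounded down, as q_i / h + r_i with 0 <= r_i < 1 / h.
   Up to O(1 / h) times the mean, the law of N_S(t) depends only on the number
   of i in S with each q_i and on the sum of the r_i; and if the mean exceeds
   Lambda, E[min(k, N_S(t))] is within eps^2 of k. All these data are sums over
   S of bounded integers, hence fit in a single query weight by mixed radix, and
   any two sets of equal weight are nearly equally good. The program asks one
   query for every possible target, evaluates the answers exactly in integer
   arithmetic and keeps the best. As T is unknown, this is repeated for
   geometrically decreasing theta; exact evaluation makes bad guesses harmless. *)

Require Import Defs.
From HB Require Import structures.
From mathcomp Require Import all_boot all_order all_algebra.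
From mathcomp Require Import all_classical all_reals all_analysis.
From mathcomp Require Import ring lra zify.
Set Implicit Arguments.
Unset Strict Implicit.
Unset Printing Implicit Defensive.
Import Order.TTheory GRing.Theory Num.Theory.
Local Open Scope ring_scope.

(** * Programs *)

(** The query weights must be bounded in terms of n, k and eps alone, whatever the bit lengths of
    the atoms, and this decides the form of the codes. Probabilities are rounded to multiples of
    1/(n L h) with L = m^2; the excess above L theta is measured in units theta/n and capped, the
    cap being inactive at a suitable theta because the surplus at m theta is then at most k m theta.
    The counts per class q are digits in a base just above Lambda h although a set may have n
    elements: a count reaches the base only if the mean exceeds Lambda, and then the sum of the
    rounded probabilities alone reveals saturation. Denominators and exact evaluation affect only
    the polynomial factor. The comparison of laws rests on two features of min(k, .): first
    differences at most 1 pay for rounding, second differences at most 1 make merging two Bernoulli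
    variables cost only the product of their parameters. Halving theta cannot jump over the window T
    <= m theta <= 3 T, because values are scaled to integers so that one unit is at most T/m. *)

Lemma bitlenP (z : int) : (`|z| < 2 ^ bitlen z)%N.
Proof. by rewrite /bitlen; exact: up_logP. Qed.

Lemma bitlen_le_exp (z : int) e : (`|z| < 2 ^ e)%N -> (bitlen z <= e)%N.
Proof. by move=> h; rewrite /bitlen up_log_min. Qed.

Lemma bitlen_mono (x y : int) : (`|x| <= `|y|)%N -> (bitlen x <= bitlen y)%N.
Proof. by move=> h; apply: bitlen_le_exp; exact: leq_ltn_trans h (bitlenP y). Qed.

Lemma bitlen_cst (n : nat) : (bitlen (Posz n) <= n)%N.
Proof. by apply: bitlen_le_exp; rewrite absz_nat ltn_expl. Qed.

Lemma leq_absz_divz (x y : int) : (`|(x %/ y)%Z| <= `|x|)%N.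
Proof.
case: (eqVneq y 0) => [->|y0]; first by rewrite divz0.
have := divz_eq x y; have := modz_ge0 x y0; have := ltz_mod x y0.
move: (x %/ y)%Z (x %% y)%Z => q r; nia.
Qed.

Lemma bitlen_arith o (x y : int) :
  (bitlen (arith o x y) <= bitlen x + bitlen y + 1)%N.
Proof.
apply: bitlen_le_exp; rewrite !expnD.
have := bitlenP x; have := bitlenP y.
have := expn_gt0 2 (bitlen x); have := expn_gt0 2 (bitlen y).
have hd := leq_absz_divz x y.
move: (2 ^ bitlen x)%N (2 ^ bitlen y)%N => a b /= b0 a0 hy hx.
case: o => /=; [nia|nia| |nia|].
- by rewrite abszM; nia.
- by case: (x <= y); nia.
Qed.

(** Time is an upper bound here, unlike in [exec], so that bounds can be relaxed and composed
    without computing exact costs. *)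
Definition runs (p : prog) (v w : value) (t : nat) : Prop :=
  exists2 t', exec p v t' w & (t' <= t)%N.

(* A program is run on an environment, the list of the values of its variables
   with the innermost binder first. *)
Definition run (p : prog) (vs : seq value) (w : value) (t : nat) : Prop :=
  runs p (enc_seq vs) w t.

(** Arithmetic is charged by the length of its operands, so a bound [b] on the length of the result
    must travel with the time bound. *)
Definition runi (p : prog) (vs : seq value) (x : int) (t b : nat) : Prop :=
  run p vs (VInt x) t /\ (bitlen x <= b)%N.

Definition bop (o : arith_op) (p q : prog) := PSeq (PFork p q) (PArith o).
Definition var (i : nat) := iter i (PSeq PSnd) PFst.
Definition fst_of (p : prog) := PSeq p PFst.
Definition snd_of (p : prog) := PSeq p PSnd.
Definition letp (p q : prog) := PSeq (PFork p PId) q.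
Definition call (f : prog) (p : prog) := PSeq p f.

(* The loop state is [:: control; accumulator & environment]. *)
Definition loop (cond next body ctl acc : prog) : prog :=
  PSeq (PFork ctl (PFork acc PId))
    (PSeq (PWhile cond (PFork next (PFork body (PSeq PSnd PSnd)))) (var 1)).

Lemma runs_le p v w t t' : runs p v w t -> (t <= t')%N -> runs p v w t'.
Proof. by move=> [t0 h0 h1] h2; exists t0 => //; exact: leq_trans h1 h2. Qed.

Lemma run_le p vs w t t' : run p vs w t -> (t <= t')%N -> run p vs w t'.
Proof. exact: runs_le. Qed.

Lemma runi_le p vs x y t t' b b' : runi p vs x t b -> x = y ->
  (t <= t')%N -> (b <= b')%N -> runi p vs y t' b'.
Proof.
by move=> [h1 h2] <- h3 h4; split; [exact: run_le h1 h3|exact: leq_trans h2 h4].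
Qed.

Lemma runs_seq p q v u w t1 t2 :
  runs p v u t1 -> runs q u w t2 -> runs (PSeq p q) v w (t1 + t2).+1.
Proof.
move=> [a ha la] [b hb lb]; exists (a + b).+1; first exact: ESeq ha hb.
by rewrite ltnS leq_add.
Qed.

Lemma runs_fork p q v w1 w2 t1 t2 : runs p v w1 t1 -> runs q v w2 t2 ->
  runs (PFork p q) v (VPair w1 w2) (t1 + t2).+1.
Proof.
move=> [a ha la] [b hb lb]; exists (a + b).+1; first exact: EFork ha hb.
by rewrite ltnS leq_add.
Qed.

Lemma runs_fst v1 v2 : runs PFst (VPair v1 v2) v1 1.
Proof. by exists 1%N => //; exact: EFst. Qed.

Lemma runs_snd v1 v2 : runs PSnd (VPair v1 v2) v2 1.
Proof. by exists 1%N => //; exact: ESnd. Qed.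

Lemma run_id vs : run PId vs (enc_seq vs) 1.
Proof. by exists 1%N => //; exact: EId. Qed.

Lemma run_var i vs w : onth vs i = Some w -> run (var i) vs w i.*2.+1.
Proof.
elim: i vs => [|i ih] [|v vs] //= h.
  by case: h => <-; exact: runs_fst.
rewrite doubleS; apply: (@runs_le _ _ _ (1 + i.*2.+1).+1) => //.
by apply: runs_seq; [exact: runs_snd|exact: ih].
Qed.

Lemma run_fst p vs a b t : run p vs (VPair a b) t -> run (fst_of p) vs a t.+2.
Proof.
move=> h; apply: (@runs_le _ _ _ (t + 1).+1); last by rewrite addn1.
exact: runs_seq h (runs_fst _ _).
Qed.

Lemma run_snd p vs a b t : run p vs (VPair a b) t -> run (snd_of p) vs b t.+2.
Proof.
move=> h; apply: (@runs_le _ _ _ (t + 1).+1); last by rewrite addn1.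
exact: runs_seq h (runs_snd _ _).
Qed.

Lemma run_pair p q vs w1 w2 t1 t2 : run p vs w1 t1 -> run q vs w2 t2 ->
  run (PFork p q) vs (VPair w1 w2) (t1 + t2).+1.
Proof. exact: runs_fork. Qed.

Lemma run_let p q vs u w t1 t2 :
  run p vs u t1 -> run q (u :: vs) w t2 -> run (letp p q) vs w (t1 + t2 + 3).
Proof.
move=> h1 h2; apply: (@runs_le _ _ _ ((t1 + 1).+1 + t2).+1); last by lia.
by apply: runs_seq h2; apply: runs_fork h1 (run_id _).
Qed.

Lemma run_call f p vs u w t1 t2 :
  run p vs u t1 -> runs f u w t2 -> run (call f p) vs w (t1 + t2).+1.
Proof. exact: runs_seq. Qed.

Lemma run_ifT b p q vs z w t0 t : run b vs (VInt z) t0 -> z != 0 ->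
  run p vs w t -> run (PIf b p q) vs w (t0 + t).+1.
Proof.
move=> [a ha la] z0 [c hc lc]; exists (a + c).+1; first exact: EIfTrue ha z0 hc.
by rewrite ltnS leq_add.
Qed.

Lemma run_ifF b p q vs w t0 t : run b vs (VInt 0) t0 ->
  run q vs w t -> run (PIf b p q) vs w (t0 + t).+1.
Proof.
move=> [a ha la] [c hc lc]; exists (a + c).+1; first exact: EIfFalse ha hc.
by rewrite ltnS leq_add.
Qed.

Lemma run_if (b : bool) pb p q vs w1 w2 t0 t1 t2 :
  run pb vs (VInt (Posz b)) t0 -> run p vs w1 t1 -> run q vs w2 t2 ->
  run (PIf pb p q) vs (if b then w1 else w2) (t0 + t1 + t2).+1.
Proof.
case: b => h0 h1 h2.
  by apply: (run_le (run_ifT q h0 isT h1)); lia.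
by apply: (run_le (run_ifF p h0 h2)); lia.
Qed.

Lemma run_ispair p vs a b t : run p vs (VPair a b) t ->
  run (PSeq p PIsPair) vs (VInt 1) t.+2.
Proof.
move=> h; apply: (@runs_le _ _ _ (t + 1).+1); last by rewrite addn1.
by apply: runs_seq h _; exists 1%N => //; exact: EIsPairPair.
Qed.

Lemma run_isint p vs z t : run p vs (VInt z) t ->
  run (PSeq p PIsPair) vs (VInt 0) t.+2.
Proof.
move=> h; apply: (@runs_le _ _ _ (t + 1).+1); last by rewrite addn1.
by apply: runs_seq h _; exists 1%N => //; exact: EIsPairInt.
Qed.

Lemma runi_leaf p vs x t k : run p vs (VInt x) t -> (bitlen x <= k)%N ->
  runi p vs x t k.
Proof. by []. Qed.

Lemma runi_const z vs : runi (PConst z) vs z (bitlen z).+1 (bitlen z).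
Proof. by split=> //; exists (bitlen z).+1 => //; exact: EConst. Qed.

Lemma runi_arith o p q vs x y t1 t2 b1 b2 :
  runi p vs x t1 b1 -> runi q vs y t2 b2 ->
  runi (bop o p q) vs (arith o x y) (t1 + t2 + b1 + b2 + 3) (b1 + b2 + 1).
Proof.
move=> [h1 k1] [h2 k2]; split.
  apply: (@runs_le _ _ _ ((t1 + t2).+1 + (bitlen x + bitlen y).+1).+1).
    by apply: runs_seq; [exact: runs_fork h1 h2|exists (bitlen x + bitlen y).+1 => //; exact: EArith].
  by lia.
by apply: leq_trans (bitlen_arith o x y) _; lia.
Qed.

(* Loops whose control value encodes the list of the iterations to come; the
   invariant relates that list to the accumulator. *)
Lemma run_loop (X A : Type) (ctl : seq X -> value) (enc : A -> value)
    (I : seq X -> A -> Prop) cond next body pctl pacc vs xs a t1 t2 tc tn tb :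
  run pctl vs (ctl xs) t1 -> run pacc vs (enc a) t2 ->
  (forall x s a, I (x :: s) a ->
     [/\ exists2 z, z != 0 & run cond [:: ctl (x :: s), enc a & vs] (VInt z) tc,
         run next [:: ctl (x :: s), enc a & vs] (ctl s) tn &
         exists2 a', run body [:: ctl (x :: s), enc a & vs] (enc a') tb &
                     I s a']) ->
  (forall a, I [::] a -> run cond [:: ctl [::], enc a & vs] (VInt 0) tc) ->
  I xs a ->
  exists2 a', run (loop cond next body pctl pacc) vs (enc a')
                (size xs * (tc + tn + tb + 6) + tc + t1 + t2 + 9) & I [::] a'.
Proof.
move=> hctl hacc hstep hend hI.
have main : exists2 a', runs (PWhile cond (PFork next (PFork body (PSeq PSnd PSnd))))
    (enc_seq [:: ctl xs, enc a & vs]) (enc_seq [:: ctl [::], enc a' & vs])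
    (size xs * (tc + tn + tb + 6) + tc).+1 & I [::] a'.
  elim: xs a hI {hctl hacc} => [|x s ih] a hI.
    exists a => //; have [t0 h0 l0] := hend a hI.
    by exists t0.+1; [exact: EWhileStop|rewrite mul0n].
  have [[z z0 [u0 hu0 lu0]] [u1 hu1 lu1] [a' [u2 hu2 lu2] hI']] := hstep x s a hI.
  have [a'' [u3 hu3 lu3] hI''] := ih a' hI'.
  exists a'' => //.
  exists (u0 + (u1 + (u2 + (1 + 1).+1).+1).+1 + u3).+1.
    apply: EWhileStep hu0 z0 _ hu3.
    apply: EFork hu1 _; apply: EFork hu2 _.
    by apply: ESeq; exact: ESnd.
  by rewrite /= mulSn; lia.
have [a' h1 h2] := main; exists a' => //.
apply: (@runs_le _ _ _ ((t1 + (t2 + 1).+1).+1 +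
   ((size xs * (tc + tn + tb + 6) + tc).+1 + 3).+1).+1); last by lia.
apply: runs_seq; first by apply: runs_fork hctl (runs_fork hacc (run_id _)).
by apply: runs_seq h1 _; exact: (@run_var 1).
Qed.

Definition foldp (body l acc : prog) : prog :=
  loop (PSeq (var 0) PIsPair) (snd_of (var 0)) body l acc.

Lemma run_fold (X A : Type) (encX : X -> value) (enc : A -> value)
    (I : seq X -> A -> Prop) body pl pacc vs xs a t1 t2 tb :
  run pl vs (enc_seq [seq encX x | x <- xs]) t1 -> run pacc vs (enc a) t2 ->
  (forall x s a, I (x :: s) a ->
     exists2 a', run body [:: VPair (encX x) (enc_seq [seq encX y | y <- s]),
                              enc a & vs] (enc a') tb & I s a') ->
  I xs a ->
  exists2 a', run (foldp body pl pacc) vs (enc a')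
                (size xs * (tb + 12) + t1 + t2 + 12) & I [::] a'.
Proof.
move=> hl hacc hstep hI.
have := @run_loop X A (fun s => enc_seq [seq encX x | x <- s]) enc I
  (PSeq (var 0) PIsPair) (snd_of (var 0)) body pl pacc vs xs a t1 t2 3 3 tb
  hl hacc.
case=> [x s b hb|b hb||a' h1 h2] //.
- split; last by exact: hstep.
  + exists 1 => //; apply: run_ispair; exact: (@run_var 0).
  + by apply: run_snd; exact: (@run_var 0).
- by apply: run_isint; exact: (@run_var 0).
- by exists a' => //; apply: run_le h1 _; nia.
Qed.

Lemma run_foldl (X A : Type) (encX : X -> value) (enc : A -> value)
    (f : A -> X -> A) body pl pacc vs xs a t1 t2 tb :
  run pl vs (enc_seq [seq encX x | x <- xs]) t1 -> run pacc vs (enc a) t2 ->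
  (forall s1 x s2, xs = s1 ++ x :: s2 ->
     run body [:: VPair (encX x) (enc_seq [seq encX y | y <- s2]),
                  enc (foldl f a s1) & vs] (enc (foldl f a (rcons s1 x))) tb) ->
  run (foldp body pl pacc) vs (enc (foldl f a xs))
    (size xs * (tb + 12) + t1 + t2 + 12).
Proof.
move=> hl hacc hstep.
pose I s b := exists2 s1, xs = s1 ++ s & b = foldl f a s1.
have [x s b [s1 e ->]||b h [s1 e eb]] :=
  @run_fold X A encX enc I body pl pacc vs xs a t1 t2 tb hl hacc.
- exists (foldl f a (rcons s1 x)); first exact: hstep.
  by exists (rcons s1 x) => //; rewrite cat_rcons.
- by exists [::].
- by move: h; rewrite eb e cats0.
Qed.

Definition forp (body cnt acc : prog) : prog :=
  loop (var 0) (bop OpSub (var 0) (PConst (Posz 1))) body cnt acc.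

(** The counter is treated as the length of a list of units, so that [run_loop] applies. It runs
    down: the body sees [j.+1] while the invariant passes from [j.+1] to [j]. *)
Lemma run_for (A : Type) (enc : A -> value) (I : nat -> A -> Prop)
    body pn pacc vs n a t1 t2 tb k :
  run pn vs (VInt (Posz n)) t1 -> run pacc vs (enc a) t2 ->
  (bitlen (Posz n) <= k)%N ->
  (forall j a, (j < n)%N -> I j.+1 a ->
     exists2 a', run body [:: VInt (Posz j.+1), enc a & vs] (enc a') tb & I j a') ->
  I n a ->
  exists2 a', run (forp body pn pacc) vs (enc a')
                (n * (tb + k + 20) + t1 + t2 + 20) & I 0%N a'.
Proof.
move=> hn hacc hk hstep hI.
pose J (s : seq unit) b := (size s <= n)%N /\ I (size s) b.
have := @run_loop unit A (fun s => VInt (Posz (size s))) enc J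
  (var 0) (bop OpSub (var 0) (PConst (Posz 1))) body pn pacc vs (nseq n tt) a t1 t2 1
  (k + 9) tb.
rewrite size_nseq; case=> // [[] s b [hs hb]|b _||a' h1 [h2 h3]].
- split.
  + by exists (Posz (size s).+1) => //; exact: (@run_var 0).
  + have hz : (bitlen (Posz (size s).+1) <= k)%N.
      by apply: leq_trans hk; apply: bitlen_mono.
    have [h _] := runi_arith OpSub (runi_leaf
      (@run_var 0 [:: _, enc b & vs] _ (erefl (Some (VInt (Posz (size s).+1))))) hz) (runi_const (Posz 1) _).
    rewrite (_ : Posz (size s) = Posz (size s).+1 - 1); last by lia.
    by apply: run_le h _; have := bitlen_cst 1; rewrite /=; lia.
  + have [b' h hI'] := hstep (size s) b hs hb.
    by exists b' => //; split=> //; exact: ltnW.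
- exact: (@run_var 0).
- by split; rewrite size_nseq.
- by exists a' => //; apply: run_le h1 _; nia.
Qed.

Definition halvep (body cnt acc : prog) : prog :=
  loop (var 0) (bop OpDiv (var 0) (PConst (Posz 2))) body cnt acc.

Lemma run_halve (A : Type) (enc : A -> value) (I : nat -> A -> Prop)
    body pn pacc vs n a t1 t2 tb k :
  run pn vs (VInt (Posz n)) t1 -> run pacc vs (enc a) t2 ->
  (bitlen (Posz n) <= k)%N ->
  (forall j a, (0 < j <= n)%N -> I j a ->
     exists2 a', run body [:: VInt (Posz j), enc a & vs] (enc a') tb &
                 I j./2 a') ->
  I n a ->
  exists2 a', run (halvep body pn pacc) vs (enc a')
                (k * (tb + k + 20) + t1 + t2 + 20) & I 0%N a'.
Proof.
move=> hn hacc hk hstep hI.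
(* The iterations to come are the successive halves of the counter. The fuel [r] bounds their number
   by the bit length, and an entry below 2^r cannot exhaust it. *)
pose half_seq := fix half_seq (r : nat) (i : nat) : seq nat :=
  match r with
  | 0 => [::]
  | r'.+1 => if i is 0 then [::] else i :: half_seq r' i./2
  end.
pose ctl (s : seq nat) := VInt (Posz (head 0%N s)).
pose J (s : seq nat) b :=
  exists2 r, s = half_seq r (head 0%N s) & (head 0%N s < 2 ^ r)%N /\
    ((head 0%N s <= n)%N /\ I (head 0%N s) b).
have szP r i : (size (half_seq r i) <= r)%N.
  by elim: r i => [|r ih] [|i] //=; rewrite ltnS.
have hdP r i : (i < 2 ^ r)%N -> head 0%N (half_seq r i) = i.
  by case: r i => [|r] [|i].
have nlt : (n < 2 ^ k)%N.
  have := bitlenP (Posz n); rewrite absz_nat => h.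
  by apply: leq_trans h _; rewrite leq_exp2l.
have := @run_loop nat A ctl enc J
  (var 0) (bop OpDiv (var 0) (PConst (Posz 2))) body pn pacc vs (half_seq k n) a t1 t2 1
  (k + 10) tb.
case=> // [|x s b [r e [lt1 [le1 hb]]]|b [r e [lt1 [le1 hb]]]||a' h1 [r e [lt1 [le1 hb]]]].
- by rewrite /ctl hdP.
- case: r e lt1 => [|r] //= e lt1.
  case: x e le1 hb lt1 => [|x] //= e le1 hb lt1.
  case: e => es; have lt2 : (uphalf x < 2 ^ r)%N by rewrite expnS in lt1; lia.
  split.
  + by exists (Posz x.+1) => //; exact: (@run_var 0).
  + have hz : (bitlen (Posz x.+1) <= k)%N.
      by apply: leq_trans hk; apply: bitlen_mono.
    have [h _] := runi_arith OpDiv (runi_leaf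
      (@run_var 0 [:: _, enc b & vs] _ (erefl (Some (VInt (Posz x.+1))))) hz) (runi_const (Posz 2) _).
    rewrite /ctl es hdP // (_ : Posz (uphalf x) = (Posz x.+1 %/ 2)%Z); last by lia.
    by apply: run_le h _; have := bitlen_cst 2; rewrite /=; lia.
  + have [b' h hI'] := hstep x.+1 b le1 hb.
    exists b' => //; exists r; rewrite es hdP //; split=> //; split=> //; lia.
- exact: (@run_var 0).
- by exists k; rewrite hdP.
- exists a' => //; apply: run_le h1 _; have := szP k n; nia.
Qed.

(** * Sums of independent Bernoulli variables *)

Section Functional.
Variable R : realFieldType.
Implicit Types (u v q : {poly R}) (g : nat -> R).

(* The expectation of g under the distribution with generating polynomial u. *)
Definition pexp g u : R := \sum_(l < size u) u`_l * g l.

Lemma pexp_widen N g u : (size u <= N)%N -> pexp g u = \sum_(l < N) u`_l * g l.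
Proof.
move=> h; rewrite /pexp (big_ord_widen N (fun l => u`_l * g l) h) big_mkcond /=.
apply: eq_bigr => i _; case: ltnP => // hi.
by rewrite nth_default // mul0r.
Qed.

Lemma pexpD g u v : pexp g (u + v) = pexp g u + pexp g v.
Proof.
pose N := maxn (size u) (size v).
rewrite (@pexp_widen N g u) ?leq_maxl // (@pexp_widen N g v) ?leq_maxr //.
rewrite (@pexp_widen N) ?size_polyD // -big_split /=.
by apply: eq_bigr => i _; rewrite coefD mulrDl.
Qed.

Lemma pexpZ g c u : pexp g (c *: u) = c * pexp g u.
Proof.
rewrite (@pexp_widen (size u) g (c *: u)) ?size_scale_leq // mulr_sumr.
by apply: eq_bigr => i _; rewrite coefZ mulrA.
Qed.

Lemma pexpN g u : pexp g (- u) = - pexp g u.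
Proof. by rewrite -scaleN1r pexpZ mulN1r. Qed.

Lemma pexpB g u v : pexp g (u - v) = pexp g u - pexp g v.
Proof. by rewrite pexpD pexpN. Qed.

Lemma pexp0 g : pexp g 0 = 0.
Proof. by rewrite /pexp size_poly0 big_ord0. Qed.

Lemma pexp_sum g (I : Type) (s : seq I) (P : pred I) (F : I -> {poly R}) :
  pexp g (\sum_(i <- s | P i) F i) = \sum_(i <- s | P i) pexp g (F i).
Proof. by elim/big_rec2: _ => [|i y x _ <-]; rewrite ?pexp0 ?pexpD. Qed.

Lemma pexpXn g l : pexp g 'X^l = g l.
Proof.
rewrite (@pexp_widen l.+1) ?size_polyXn // (bigD1 ord_max) //= big1 ?addr0.
  by rewrite coefXn eqxx mul1r.
move=> i; rewrite -val_eqE /= coefXn => /negbTE ->; exact: mul0r.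
Qed.

Lemma pexp1 g : pexp g 1 = g 0%N.
Proof. by rewrite -(pexpXn g 0) expr0. Qed.

Lemma pexpMXn g u l : pexp g (u * 'X^l) = pexp (fun i => g (i + l)%N) u.
Proof.
rewrite -{1}(coefK u) poly_def mulr_suml pexp_sum [RHS]/pexp.
by apply: eq_bigr => i _; rewrite -scalerAl -exprD pexpZ pexpXn.
Qed.

Lemma pexpM g u v :
  pexp g (u * v) = \sum_(l < size v) v`_l * pexp (fun i => g (i + l)%N) u.
Proof.
rewrite -{1}(coefK v) poly_def mulr_sumr pexp_sum.
by apply: eq_bigr => i _; rewrite -scalerAr pexpZ pexpMXn.
Qed.

Lemma eq_pexp g g' u : g =1 g' -> pexp g u = pexp g' u.
Proof. by move=> e; apply: eq_bigr => i _; rewrite e. Qed.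

Lemma pexp_horner (t : R) u : pexp (fun l => t ^+ l) u = u.[t].
Proof. by rewrite /pexp horner_coef. Qed.

Definition prob_poly u : Prop := (forall l, 0 <= u`_l) /\ u.[1] = 1.

Lemma prob_poly_sum u : prob_poly u -> \sum_(l < size u) u`_l = 1.
Proof.
by case=> _ <-; rewrite horner_coef; apply: eq_bigr => i _; rewrite expr1n mulr1.
Qed.

Lemma prob_poly1 : prob_poly 1.
Proof. by split=> [l|]; rewrite ?hornerC // coef1 ler0n. Qed.

Lemma prob_polyM u v : prob_poly u -> prob_poly v -> prob_poly (u * v).
Proof.
move=> [u0 u1] [v0 v1]; split=> [l|]; last by rewrite hornerM u1 v1 mulr1.
by rewrite coefM sumr_ge0 // => i _; rewrite mulr_ge0.
Qed.

Lemma prob_poly_prod (I : Type) (s : seq I) (P : pred I) (F : I -> {poly R}) :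
  (forall i, P i -> prob_poly (F i)) -> prob_poly (\prod_(i <- s | P i) F i).
Proof.
by move=> h; elim/big_rec: _ => [|i x /h hi hx]; [exact: prob_poly1|exact: prob_polyM].
Qed.

Lemma le_pexp g g' u : (forall l, 0 <= u`_l) -> (forall l, g l <= g' l) ->
  pexp g u <= pexp g' u.
Proof. by move=> h hg; apply: ler_sum => i _; rewrite ler_wpM2l. Qed.

Lemma pexp_cst c u : prob_poly u -> pexp (fun=> c) u = c.
Proof. by move=> /prob_poly_sum h; rewrite /pexp -mulr_suml h mul1r. Qed.

Lemma pexpDf g g' u : pexp (fun l => g l + g' l) u = pexp g u + pexp g' u.
Proof. by rewrite -big_split; apply: eq_bigr => i _; rewrite mulrDr. Qed.

Lemma pexpZf c g u : pexp (fun l => c * g l) u = c * pexp g u.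
Proof. by rewrite mulr_sumr; apply: eq_bigr => i _; rewrite mulrCA. Qed.

(* The generating polynomial of a Bernoulli variable of parameter p. *)
Definition bern (p : R) : {poly R} := 1 + p *: ('X - 1).

Lemma bern0 : bern 0 = 1.
Proof. by rewrite /bern scale0r addr0. Qed.

Lemma prob_bern p : 0 <= p <= 1 -> prob_poly (bern p).
Proof.
move=> /andP[p0 p1]; split=> [l|]; last by rewrite /bern !hornerE; ring.
rewrite /bern coefD coefZ coefB coef1 coefX.
by case: l => [|[|l]] /=; rewrite ?mulr0n ?mulr1n; lra.
Qed.

(** Conditioning on the Bernoulli variable: it shifts the count by one with probability p. *)
Lemma pexp_bernM g p u :
  pexp g (bern p * u) = pexp (fun x => (1 - p) * g x + p * g x.+1) u.
Proof.
rewrite /bern mulrDl mul1r pexpD -scalerAl pexpZ mulrBl mul1r pexpB.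
rewrite ['X * u]mulrC -['X]expr1 pexpMXn pexpDf !pexpZf.
rewrite (eq_pexp (g := fun i => g (i + 1)%N) (g' := fun i => g i.+1)); first by ring.
by move=> i; rewrite addn1.
Qed.

(** The test function of interest is min(k, .). The bound on first differences controls a change of
    one parameter ([close_bern]), the bound on second differences the replacement of two variables
    by one of the same mean ([close_bernM]). *)
Definition tame g : Prop := forall l,
  `|g l.+1 - g l| <= 1 /\ `|g l.+2 - g l.+1 - (g l.+1 - g l)| <= 1.

Lemma tame_shift g l : tame g -> tame (fun i => g (i + l)%N).
Proof. by move=> h i; rewrite !addSn; exact: h. Qed.

Lemma tame_min (k : nat) : tame (fun l => Num.min k%:R l%:R).
Proof.
have minE (a b : nat) : Num.min a%:R b%:R = (minn a b)%:R :> R by rewrite natr_min.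
move=> l; rewrite !minE; have [h|h] : (l < k \/ k <= l)%N by lia.
  have [-> ->] : minn k l = l /\ minn k l.+1 = l.+1 by lia.
  have [->|->] : minn k l.+2 = l.+2 \/ minn k l.+2 = l.+1 by lia.
    by rewrite -!natr1 !ler_norml; split; lra.
  by rewrite -!natr1 !ler_norml; split; lra.
have [-> [-> ->]] : minn k l = k /\ minn k l.+1 = k /\ minn k l.+2 = k by lia.
by rewrite !subrr normr0; split.
Qed.

(** A distance between laws defined by test functions. The class of [tame] functions is closed under
    translation, which makes the distance subadditive along products of independent factors. *)
Definition close (e : R) u v : Prop :=
  forall g, tame g -> `|pexp g u - pexp g v| <= e.

Lemma close_refl u : close 0 u u.
Proof. by move=> g _; rewrite subrr normr0. Qed.

Lemma close_sym e u v : close e u v -> close e v u.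
Proof. by move=> h g hg; rewrite distrC; exact: h. Qed.

Lemma close_trans e1 e2 v u w :
  close e1 u v -> close e2 v w -> close (e1 + e2) u w.
Proof.
move=> h1 h2 g hg; rewrite (le_trans (ler_distD (pexp g v) _ _)) //.
by rewrite lerD ?h1 ?h2.
Qed.

Lemma close_le e e' u v : close e u v -> e <= e' -> close e' u v.
Proof. by move=> h he g hg; rewrite (le_trans (h g hg)). Qed.

(** Conditioning on the independent factor [v] only translates the test function, and the
    conditional errors are averaged with weights of total 1. *)
Lemma close_mulr e u u' v : prob_poly v -> close e u u' ->
  close e (u * v) (u' * v).
Proof.
move=> hv h g hg; rewrite !pexpM -sumrB.
rewrite (le_trans (ler_norm_sum _ _ _)) // -[leRHS]mul1r -(prob_poly_sum hv).
rewrite mulr_suml ler_sum // => l _; rewrite -mulrBr normrM ger0_norm ?(hv.1) //.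
by rewrite ler_wpM2l ?(hv.1) // h //; exact: tame_shift.
Qed.

Lemma closeM e1 e2 u u' v v' : prob_poly v -> prob_poly u' ->
  close e1 u u' -> close e2 v v' -> close (e1 + e2) (u * v) (u' * v').
Proof.
move=> hv hu h1 h2; apply: (close_trans (close_mulr hv h1)).
by rewrite ![u' * _]mulrC; exact: close_mulr.
Qed.

Lemma close_prod (I : Type) (s : seq I) (P : pred I) (u v : I -> {poly R})
    (e : I -> R) :
  (forall i, P i -> prob_poly (u i)) -> (forall i, P i -> prob_poly (v i)) ->
  (forall i, P i -> close (e i) (u i) (v i)) ->
  close (\sum_(i <- s | P i) e i) (\prod_(i <- s | P i) u i)
    (\prod_(i <- s | P i) v i).
Proof.
move=> hu hv h; elim: s => [|i s ih]; first by rewrite !big_nil; exact: close_refl.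
rewrite !big_cons; case: ifP => // hi.
by apply: closeM; [exact: prob_poly_prod|exact: hv|exact: h|].
Qed.

Lemma close_bern p r : close `|p - r| (bern p) (bern r).
Proof.
move=> g hg; rewrite -[bern p]mulr1 -[bern r]mulr1 !pexp_bernM !pexp1.
rewrite (_ : _ - _ = (p - r) * (g 1%N - g 0%N)); last by ring.
by rewrite normrM -[leRHS]mulr1 ler_wpM2l // (hg 0%N).1.
Qed.

(** Both laws have mean p + r, so first differences cancel and what remains is p r times a second
    difference. *)
Lemma close_bernM p r : 0 <= p -> 0 <= r ->
  close (p * r) (bern p * bern r) (bern (p + r)).
Proof.
move=> p0 r0 g hg; rewrite -[bern r]mulr1 -[bern (p + r)]mulr1 !pexp_bernM !pexp1.
rewrite (_ : _ - _ = (p * r) * (g 2 - g 1%N - (g 1%N - g 0%N))); last by ring.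
by rewrite normrM ger0_norm ?mulr_ge0 // -[leRHS]mulr1 ler_wpM2l ?mulr_ge0 // (hg 0%N).2.
Qed.

(** Merging the parameters one at a time, a new parameter r into a sum t costs r t, and t^2 + r t <=
    (r + t)^2. *)
Lemma close_bern_split (I : Type) (s : seq I) (P : pred I) (r : I -> R) :
  (forall i, P i -> 0 <= r i) -> \sum_(i <- s | P i) r i <= 1 ->
  close ((\sum_(i <- s | P i) r i) ^+ 2) (\prod_(i <- s | P i) bern (r i))
    (bern (\sum_(i <- s | P i) r i)).
Proof.
move=> r0; elim: s => [|i s ih].
  by rewrite !big_nil bern0 expr0n => _; exact: close_refl.
rewrite !big_cons; case: ifP => // hi h1.
have s0 : 0 <= \sum_(i <- s | P i) r i by rewrite sumr_ge0.
have hr := r0 i hi.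
have {}ih := ih ltac:(lra).
move: s0 h1 ih; set t := \sum_(i <- s | P i) r i => s0 h1 ih.
apply: close_le (close_trans _ (close_bernM hr s0)) _.
  rewrite ![bern (r i) * _]mulrC; apply: close_mulr ih.
  by apply: prob_bern; lra.
by nra.
Qed.

(* Both products are compared with the common refinement of parameters
   r i * s j / sigma, where sigma is the common sum. *)
Lemma close_same_sum (I J : finType) (A : {pred I}) (B : {pred J})
    (r : I -> R) (s : J -> R) (d : R) :
  (forall i, i \in A -> 0 <= r i <= d) -> (forall j, j \in B -> 0 <= s j <= d) ->
  d <= 1 -> \sum_(i in A) r i = \sum_(j in B) s j ->
  close (2 * (d * \sum_(i in A) r i))
    (\prod_(i in A) bern (r i)) (\prod_(j in B) bern (s j)).
Proof.
move=> hr hs d1 e.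
(* Refining each r' i into the pieces r' i s' j / sigma costs (r' i)^2 <= d r' i, hence d sigma in
   total. The statement is generic because it serves once for each family. *)
have key (I' J' : finType) (A' : {pred I'}) (B' : {pred J'})
    (r' : I' -> R) (s' : J' -> R) :
  (forall i, i \in A' -> 0 <= r' i <= d) -> (forall j, j \in B' -> 0 <= s' j <= d) ->
  \sum_(i in A') r' i = \sum_(j in B') s' j -> \sum_(i in A') r' i != 0 ->
  close (d * \sum_(i in A') r' i) (\prod_(i in A') \prod_(j in B')
     bern (r' i * s' j / \sum_(i in A') r' i)) (\prod_(i in A') bern (r' i)).
  move=> hr' hs' e' nz.
  have s0 : 0 <= \sum_(i in A') r' i.
    by rewrite sumr_ge0 // => i /hr' /andP[].
  have E i : \sum_(j in B') r' i * s' j / \sum_(i in A') r' i = r' i.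
    by rewrite -mulr_suml -mulr_sumr -e' mulfK.
  have N i : i \in A' -> forall j, j \in B' -> 0 <= r' i * s' j / \sum_(i in A') r' i.
    move=> /hr' /andP[h1 _] j /hs' /andP[h2 _].
    by rewrite mulr_ge0 ?invr_ge0 // mulr_ge0.
  apply: close_le.
    apply: (@close_prod _ _ _ _ _ (fun i => r' i ^+ 2)) => i hi.
    + apply: prob_poly_prod => j hj; apply: prob_bern; rewrite N //=.
      have := E i; rewrite (bigD1 j) //=.
      have : 0 <= \sum_(i0 in B' | i0 != j) r' i * s' i0 / \sum_(i in A') r' i.
        by rewrite sumr_ge0 // => j' /andP[hj' _]; rewrite N.
      have /andP[] := hr' i hi; lra.
    + by apply: prob_bern; have /andP[] := hr' i hi; lra.
    + have := @close_bern_split _ (index_enum J') (mem B')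
        (fun j => r' i * s' j / \sum_(i in A') r' i) (N i hi).
      by rewrite E; apply; have /andP[] := hr' i hi; lra.
  rewrite mulr_sumr ler_sum // => i hi.
  by have /andP[] := hr' i hi; rewrite expr2; nra.
(* With sigma = 0 the refinement makes no sense, but then all parameters vanish and both products
   are 1. *)
case: (eqVneq (\sum_(i in A) r i) 0) => [z|nz].
  have rz i : i \in A -> r i = 0.
    move=> hi; apply/eqP; rewrite eq_le (andP (hr i hi)).1 andbT -z (bigD1 i) //=.
    by rewrite lerDl sumr_ge0 // => j /andP[/hr/andP[]].
  have sz j : j \in B -> s j = 0.
    move=> hj; apply/eqP; rewrite eq_le (andP (hs j hj)).1 andbT -z e (bigD1 j) //=.
    by rewrite lerDl sumr_ge0 // => i /andP[/hs/andP[]].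
  rewrite z !mulr0 !big1; first exact: close_refl.
    by move=> j hj; rewrite sz // bern0.
  by move=> i hi; rewrite rz // bern0.
rewrite mulr2n mulrDl mul1r.
apply: (@close_trans _ _ (\prod_(i in A) \prod_(j in B)
     bern (r i * s j / \sum_(i in A) r i))).
  by apply: close_sym; exact: key.
(* Read by columns, the same refinement is the one attached to the second family. *)
rewrite exchange_big /= {1 2}e.
under eq_bigr => j _ do under eq_bigr => i _ do rewrite [r i * s j]mulrC.
by apply: key => //; rewrite -e.
Qed.

End Functional.

(** * Expected top-k sums *)

(** Distributivity of products over sums, with index types depending on i, reached through the
    bijection with [fprod]. *)
Lemma sum_dffun_prod (K : comNzRingType) (I : finType) (T_ : I -> finType)
    (F : forall i, T_ i -> K) :
  \sum_(a : {dffun forall i, T_ i}) \prod_i F i (a i) = \prod_i \sum_x F i x.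
Proof.
rewrite (reindex (@dffun_of_fprod _ T_)); last exact/onW_bij/dffun_of_fprod_bij.
rewrite /=.
transitivity (\sum_(t : fprod T_) \prod_(i in I) (finfun (F i)) (t i)).
  by apply: eq_bigr => t _; apply: eq_bigr => i _; rewrite !ffunE.
rewrite big_fprod -(bigA_distr_big_dep (fun i => [pred j in tagged_with T_ i])
  (fun i => untag 0 (finfun (F i)))); apply: eq_bigr => i _.
by rewrite -(big_tag (fun i => finfun (F i))); apply: eq_bigr => x _; rewrite ffunE.
Qed.

Section Expectation.
Variable R : realType.
Implicit Types (s : seq (R * R)).

Definition mean s (f : R -> R) : R := \sum_(am <- s) am.2 * f am.1.

Definition is_dist s : Prop :=
  (forall am, am \in s -> 0 <= am.1 /\ 0 <= am.2) /\ \sum_(am <- s) am.2 = 1.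

Lemma mean_ge0 s f : is_dist s -> (forall x, 0 <= x -> 0 <= f x) -> 0 <= mean s f.
Proof.
move=> [h _] hf; rewrite /mean big_seq sumr_ge0 // => am /h [h1 h2].
by rewrite mulr_ge0 ?hf.
Qed.

Lemma le_mean s f g : is_dist s -> (forall x, 0 <= x -> f x <= g x) ->
  mean s f <= mean s g.
Proof.
move=> [h _] hf; rewrite /mean !big_seq ler_sum // => am /h [h1 h2].
by rewrite ler_wpM2l ?hf.
Qed.

Lemma mean_cst s c : is_dist s -> mean s (fun=> c) = c.
Proof. by move=> [_ h]; rewrite /mean -mulr_suml h mul1r. Qed.

Definition tailp s (c : R) : R := mean s (fun x => (c <= x)%R%:R).
Definition excess s (c : R) : R := mean s (fun x => Num.max (x - c) 0).

Lemma tailp_01 s c : is_dist s -> 0 <= tailp s c <= 1.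
Proof.
move=> h; rewrite mean_ge0 //= -[leRHS](mean_cst 1 h).
by apply: le_mean => // x _; rewrite lern1 leq_b1.
Qed.

Variable n : nat.
Implicit Types (D : 'I_n -> seq (R * R)) (f : ('I_n -> R) -> R).

(** Expanding the product of the generating polynomials, the term of an outcome is its probability
    times the values of [psi], multiplied by X to the power of the count. All later uses of
    independence derive from this identity. *)
Lemma expect_pexp D (psi : 'I_n -> R -> R) (beta : 'I_n -> R -> bool) g :
  expect D (fun x => (\prod_i psi i (x i)) * g (\sum_i (beta i (x i) : nat))%N) =
  pexp g (\prod_i \sum_(am <- D i) (am.2 * psi i am.1) *: 'X^(beta i am.1)).
Proof.
rewrite /expect.
under [in RHS]eq_bigr => i _ do rewrite (big_nth (0, 0)) big_mkord.
rewrite -(@sum_dffun_prod _ _ (fun i => 'I_(size (D i)))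
  (fun i j => ((nth (0, 0) (D i) j).2 * psi i (nth (0, 0) (D i) j).1) *:
     'X^(beta i (nth (0, 0) (D i) j).1))) pexp_sum.
apply: eq_bigr => a _.
rewrite scaler_prod pexpZ big_split /= mulrA; congr (_ * _).
by rewrite -[in RHS]expr_sum pexpXn.
Qed.

Lemma expect_prod D (psi : 'I_n -> R -> R) :
  expect D (fun x => \prod_i psi i (x i)) = \prod_i mean (D i) (psi i).
Proof.
have := expect_pexp D psi (fun _ _ => false) (fun=> 1).
rewrite (_ : (fun x => _) = (fun x => \prod_i psi i (x i))); last first.
  by apply/funext => x; rewrite mulr1.
move=> ->; rewrite (_ : \prod_i _ = (\prod_i mean (D i) (psi i))%:P).
  by rewrite -alg_polyC pexpZ pexp1 mulr1.
rewrite rmorph_prod; apply: eq_bigr => i _.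
by rewrite rmorph_sum; apply: eq_bigr => am _ /=; rewrite expr0 alg_polyC.
Qed.

Lemma expectD D f g :
  expect D (fun x => f x + g x) = expect D f + expect D g.
Proof. by rewrite /expect -big_split; apply: eq_bigr => a _; rewrite mulrDr. Qed.

Lemma expectZ D c f : expect D (fun x => c * f x) = c * expect D f.
Proof. by rewrite /expect mulr_sumr; apply: eq_bigr => a _; rewrite mulrCA. Qed.

Lemma expectB D f g :
  expect D (fun x => f x - g x) = expect D f - expect D g.
Proof. by rewrite /expect -sumrB; apply: eq_bigr => a _; rewrite mulrBr. Qed.

Lemma expect0 D : expect D (fun=> 0) = 0.
Proof. by rewrite /expect big1 // => a _; rewrite mulr0. Qed.

Lemma expect_sum D (I : Type) (r : seq I) (P : pred I) (F : I -> ('I_n -> R) -> R) :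
  expect D (fun x => \sum_(i <- r | P i) F i x) = \sum_(i <- r | P i) expect D (F i).
Proof.
rewrite /expect exchange_big /=; apply: eq_bigr => a _.
by rewrite mulr_sumr.
Qed.

Lemma eq_expect D f g :
  (forall x, (forall i, x i \in [seq am.1 | am <- D i]) -> f x = g x) ->
  expect D f = expect D g.
Proof.
move=> h; apply: eq_bigr => a _; rewrite h // => i.
by apply: map_f; apply: mem_nth.
Qed.

Lemma le_expect D f g : (forall i, is_dist (D i)) ->
  (forall x, (forall i, 0 <= x i) -> f x <= g x) -> expect D f <= expect D g.
Proof.
move=> hD h; apply: ler_sum => a _; apply: ler_wpM2l.
  by apply: prodr_ge0 => i _; have [|_ ->] := (hD i).1 (nth (0, 0) (D i) (a i)); rewrite ?mem_nth.
by apply: h => i; have [|-> _] := (hD i).1 (nth (0, 0) (D i) (a i)); rewrite ?mem_nth.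
Qed.

Lemma expect_cst D c : (forall i, is_dist (D i)) -> expect D (fun=> c) = c.
Proof.
move=> hD; rewrite (_ : (fun=> c) = (fun x => c * \prod_i (fun=> 1) (x i))); last first.
  by apply/funext => x; rewrite big1 ?mulr1.
by rewrite expectZ (expect_prod D (fun _ _ => 1)) big1 ?mulr1 // => i _; rewrite mean_cst.
Qed.

Lemma expect1 D i (phi : R -> R) : (forall i, is_dist (D i)) ->
  expect D (fun x => phi (x i)) = mean (D i) phi.
Proof.
move=> hD; have := expect_prod D (fun j => if j == i then phi else fun=> 1).
rewrite (bigD1 i) //= eqxx big1 ?mulr1; last by move=> j /negbTE ->; exact: mean_cst.
move=> <-; apply: eq_expect => x _; rewrite (bigD1 i) //= eqxx big1 ?mulr1 //.
by move=> j /negbTE ->.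
Qed.

Lemma expect2 D i j (phi psi : R -> R) : (forall i, is_dist (D i)) -> i != j ->
  expect D (fun x => phi (x i) * psi (x j)) = mean (D i) phi * mean (D j) psi.
Proof.
move=> hD ij.
have := expect_prod D (fun l => if l == i then phi else if l == j then psi else fun=> 1).
have ji : (j == i) = false by rewrite eq_sym (negbTE ij).
rewrite (bigD1 i) //= eqxx (bigD1 j) /= ?ji // eqxx big1 ?mulr1; last first.
  by move=> l /andP[/negbTE -> /negbTE ->]; exact: mean_cst.
move=> <-; apply: eq_expect => x _.
rewrite (bigD1 i) //= eqxx (bigD1 j) /= ?ji // eqxx big1 ?mulr1 //.
by move=> l /andP[/negbTE -> /negbTE ->].
Qed.

Definition count_ge (S : {set 'I_n}) (c : R) (x : 'I_n -> R) : nat :=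
  (\sum_(i in S) (c <= x i)%R)%N.

Definition count_poly D (S : {set 'I_n}) (c : R) : {poly R} :=
  \prod_(i in S) bern (tailp (D i) c).

Lemma sum_scale1 (s : seq (R * R)) : is_dist s ->
  \sum_(am <- s) am.2 *: (1 : {poly R}) = 1.
Proof. by move=> [_ h]; rewrite -scaler_suml h scale1r. Qed.

Lemma sum_bern (s : seq (R * R)) c : is_dist s ->
  \sum_(am <- s) am.2 *: 'X^((c <= am.1)%R : nat) = bern (tailp s c).
Proof.
move=> h; rewrite /bern /tailp /mean scaler_suml -[X in X + _](sum_scale1 h) -big_split /=.
apply: eq_bigr => am _; case: (c <= am.1); rewrite ?mulr1 ?mulr0 /=.
  by rewrite expr1 scalerBr addrC subrK.
by rewrite expr0 scale0r addr0.
Qed.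

Lemma expect_count D S c g : (forall i, is_dist (D i)) ->
  expect D (fun x => g (count_ge S c x)) = pexp g (count_poly D S c).
Proof.
move=> hD; have := expect_pexp D (fun _ _ => 1) (fun i x => (i \in S) && (c <= x)) g.
rewrite (_ : (fun x => _) = (fun x => g (count_ge S c x))); last first.
  apply/funext => x; rewrite big1 // mul1r /count_ge; congr g.
  by rewrite [RHS]big_mkcond; apply: eq_bigr => i _; case: (i \in S).
move=> ->; congr pexp; rewrite /count_poly [RHS]big_mkcond /=; apply: eq_bigr => i _.
under eq_bigr => am _ do rewrite mulr1.
by case: (i \in S) => /=; rewrite ?sum_bern // sum_scale1.
Qed.

Lemma expect1_count D S c i phi g : (forall i, is_dist (D i)) ->
  expect D (fun x => phi (x i) * g (count_ge (S :\ i) c x)) =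
  mean (D i) phi * pexp g (count_poly D (S :\ i) c).
Proof.
move=> hD; have := expect_pexp D (fun j => if j == i then phi else fun=> 1)
  (fun j x => (j \in S :\ i) && (c <= x)) g.
rewrite (_ : (fun x => _) = (fun x => phi (x i) * g (count_ge (S :\ i) c x))); last first.
  apply/funext => x; rewrite (bigD1 i) //= eqxx big1 ?mulr1; last first.
    by move=> j /negbTE ->.
  rewrite /count_ge; congr (_ * g _).
  by rewrite [RHS]big_mkcond; apply: eq_bigr => j _; case: (j \in _).
move=> ->; rewrite (bigD1 i) //= -pexpZ; congr pexp.
rewrite -mul_polyC; congr (_ * _).
  rewrite rmorph_sum; apply: eq_bigr => am _ /=.
  by rewrite eqxx !inE eqxx /= expr0 alg_polyC.
rewrite /count_poly big_mkcond [RHS]big_mkcond /=; apply: eq_bigr => j _.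
rewrite !inE; case: (eqVneq j i) => //= _.
under eq_bigr => am _ do rewrite mulr1.
by case: (j \in S) => /=; rewrite ?sum_bern // sum_scale1.
Qed.

End Expectation.

(** * Top-k lists and the counts above a level *)

Section TopList.
Variable R : realType.

(** The list is decreasing and P is upward closed, so P holds exactly on a prefix. *)
Lemma count_take_sorted (k : nat) (s : seq R) (P : pred R) :
  sorted (fun y z : R => z <= y) s -> (forall x y, P x -> x <= y -> P y) ->
  count P (take k s) = minn k (count P s).
Proof.
have tr : transitive (fun y z : R => z <= y) by move=> a b c h1 h2; exact: le_trans h2 h1.
move=> + up; elim: s k => [|x s ih] [|k] //=; first by rewrite min0n.
move=> hp; case: (boolP (P x)) => hx; first by rewrite ih ?(path_sorted hp) //; lia.
have h0 : count P s = 0%N.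
  apply/eqP; rewrite -leqn0 leqNgt -has_count; apply/hasPn => y ys.
  by apply: contra hx => hy; apply: up hy _; exact: (allP (order_path_min tr hp)).
by rewrite ih ?(path_sorted hp) // h0 minn0 add0n !minn0.
Qed.

Variable n : nat.
Implicit Types (S : {set 'I_n}) (x : 'I_n -> R).

Definition top_list (k : nat) S x : seq R :=
  take k (sort (fun y z : R => z <= y) [seq x i | i <- enum S]).

Definition top_map k S (f : R -> R) x : R := \sum_(v <- top_list k S x) f v.

Lemma top_sumE k S x : top_sum k S x = top_map k S id x.
Proof. by []. Qed.

Lemma count_top k S x (P : pred R) : (forall a b, P a -> a <= b -> P b) ->
  count P (top_list k S x) = minn k (\sum_(i in S) P (x i)).
Proof.
move=> up; rewrite /top_list count_take_sorted //; last first.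
  by apply: sort_sorted => a b; exact: le_total.
rewrite count_sort count_map -sum1_count big_mkcond /= big_enum /=.
by congr minn; apply: eq_bigr => i _; case: (P _).
Qed.

(** The indicator of an upper half-line is upward closed, so [count_top] applies. This is how top-k
    sums are reduced to counts of variables above a level. *)
Lemma top_map_ind k S c x :
  top_map k S (fun v => (c <= v)%R%:R) x = (minn k (count_ge S c x))%:R.
Proof.
rewrite /top_map -natr_sum; congr (_%:R).
rewrite -(count_top k S x (P := fun v => c <= v)); last by move=> a b; exact: le_trans.
by rewrite -sum1_count [RHS]big_mkcond; apply: eq_bigr => v _; case: (c <= v).
Qed.

Lemma size_top k S x : (size (top_list k S x) <= k)%N.
Proof. by rewrite size_take; case: ltnP. Qed.

Lemma mem_top k S x v : v \in top_list k S x -> exists2 i, i \in S & v = x i.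
Proof.
move=> /mem_take; rewrite mem_sort => /mapP[i]; rewrite mem_enum => iS ->.
by exists i.
Qed.

Lemma top_map_le_sum k S f x : (forall i, i \in S -> 0 <= f (x i)) ->
  top_map k S f x <= \sum_(i in S) f (x i).
Proof.
move=> h; have hs : perm_eq (sort (fun y z : R => z <= y) [seq x i | i <- enum S])
    [seq x i | i <- enum S] by rewrite perm_sort.
rewrite -[leRHS]big_enum -[leRHS](big_map x xpredT f) -(perm_big _ hs) /top_map /top_list /=.
rewrite -{2}(cat_take_drop k (sort _ _)) big_cat /= lerDl big_seq sumr_ge0 // => v.
by move=> /mem_drop; rewrite mem_sort => /mapP[i]; rewrite mem_enum => iS ->; exact: h.
Qed.

Lemma top_map_ge1 k S f x i : (0 < k)%N -> i \in S -> {homo f : y z / y <= z} ->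
  (forall j, j \in S -> 0 <= f (x j)) -> f (x i) <= top_map k S f x.
Proof.
move=> k0 iS hf h0.
have : has (fun v => x i <= v) (top_list k S x).
  rewrite has_count count_top; last by move=> a b; exact: le_trans.
  by rewrite leq_min k0 (bigD1 i) //= lexx.
move=> /hasP[v vt hv]; apply: le_trans (hf _ _ hv) _.
rewrite /top_map (big_rem v) //= lerDl big_seq sumr_ge0 // => w /mem_rem /mem_top[j jS ->].
exact: h0.
Qed.

(** All entries above c fit into the first k places, so the dropped entries are at most c, where f
    vanishes. *)
Lemma top_map_all k S f x c : (\sum_(i in S) (c < x i)%R <= k)%N ->
  (forall i, i \in S -> 0 <= f (x i)) -> (forall v, v <= c -> f v = 0) ->
  top_map k S f x = \sum_(i in S) f (x i).
Proof.
move=> hk h0 hf; have hs : perm_eq (sort (fun y z : R => z <= y) [seq x i | i <- enum S])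
    [seq x i | i <- enum S] by rewrite perm_sort.
rewrite -[RHS]big_enum -[RHS](big_map x xpredT f) -(perm_big _ hs) /top_map /=.
have up : forall a b : R, c < a -> a <= b -> c < b by move=> a b; exact: lt_le_trans.
have := count_top k S x (P := fun v => c < v) up.
rewrite (minn_idPr hk) /top_list => hc.
rewrite -[in RHS](cat_take_drop k (sort _ _)) big_cat /= -[LHS]addr0; congr (_ + _).
rewrite big_seq big1 // => v hv; apply: hf; rewrite leNgt; apply/negP => hcv.
have : count (fun v => c < v) (sort (fun y z : R => z <= y) [seq x i | i <- enum S])
   = (\sum_(i in S) (c < x i)%R)%N.
  rewrite count_sort count_map -sum1_count big_mkcond /= big_enum /=.
  by apply: eq_bigr => i _; case: (c < _).
rewrite -[sort _ _](cat_take_drop k) count_cat hc => /eqP.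
rewrite -[X in _ == X]addn0 eqn_add2l => /eqP/eqP.
by rewrite -leqn0 leqNgt -has_count => /hasP[]; exists v.
Qed.

Lemma le_top_map k S f g x : (forall i, i \in S -> f (x i) <= g (x i)) ->
  top_map k S f x <= top_map k S g x.
Proof.
by move=> h; rewrite /top_map !big_seq ler_sum // => v /mem_top[i iS ->]; exact: h.
Qed.

Lemma eq_top_map k S f g x : (forall i, i \in S -> f (x i) = g (x i)) ->
  top_map k S f x = top_map k S g x.
Proof.
by move=> h; rewrite /top_map !big_seq; apply: eq_bigr => v /mem_top[i iS ->]; exact: h.
Qed.

Lemma top_mapD k S f g x :
  top_map k S (fun v => f v + g v) x = top_map k S f x + top_map k S g x.
Proof. exact: big_split. Qed.

Lemma top_mapZ k S c f x :
  top_map k S (fun v => c * f v) x = c * top_map k S f x.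
Proof. by rewrite /top_map mulr_sumr. Qed.

Lemma top_map_sum k S (I : Type) (r : seq I) (F : I -> R -> R) x :
  top_map k S (fun v => \sum_(i <- r) F i v) x = \sum_(i <- r) top_map k S (F i) x.
Proof. by rewrite /top_map exchange_big. Qed.

Lemma top_map_cst k S c x : 0 <= c -> top_map k S (fun=> c) x <= k%:R * c.
Proof.
move=> c0; rewrite /top_map big_const_seq count_predT iter_addr_0 -[leLHS]mulr_natl.
by rewrite ler_wpM2r // ler_nat size_top.
Qed.

End TopList.

(** * Saturation of sums of Bernoulli variables *)

Section Saturation.
Variable R : realType.

(** Chernoff bound at base 1/2: k - min(k, l) <= k 2^k 2^(-l), and the expectation of 2^(-N) is the
    product of the 1 - p i / 2, at most exp(- mean / 2). A mean of 2 k + 4 ln(k / eps) gives exp(-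
    k) (eps / k)^2, and exp(- k) compensates 2^k; this is where C0 = 4 comes from. *)
Lemma bern_saturated (I : finType) (A : {pred I}) (p : I -> R) (k : nat) (eps : R) :
  (0 < k)%N -> 0 < eps -> (forall i, i \in A -> 0 <= p i <= 1) ->
  Lambda 4 k eps <= \sum_(i in A) p i ->
  k%:R - pexp (fun l => Num.min k%:R l%:R) (\prod_(i in A) bern (p i)) <= eps ^+ 2.
Proof.
move=> k0 e0 hp hL; set u := \prod_(i in A) _.
have hu : prob_poly u by apply: prob_poly_prod => i /hp; exact: prob_bern.
have k0' : 0 < k%:R :> R by rewrite ltr0n.
have -> : k%:R - pexp (fun l => Num.min k%:R l%:R) u =
    pexp (fun l => k%:R - Num.min k%:R l%:R) u.
  rewrite -{1}(pexp_cst k%:R hu) -[in LHS]mulN1r -pexpZf -pexpDf.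
  by apply: eq_pexp => l; rewrite mulN1r.
apply: (@le_trans _ _ (pexp (fun l => (k%:R * 2 ^+ k) * (2^-1) ^+ l) u)).
  apply: le_pexp => [|l]; first by case: hu.
  have h2 l' : (0 : R) < 2 ^+ l' by rewrite exprn_gt0.
  case: (leqP k l) => h.
    rewrite min_l ?ler_nat // subrr mulr_ge0 ?mulr_ge0 ?exprn_ge0 //.
  rewrite min_r ?ler_nat ?(ltnW h) // exprVn -mulrA.
  apply: (@le_trans _ _ k%:R); first by rewrite gerBl.
  rewrite -[leLHS]mulr1 ler_wpM2l ?ler0n // ler_pdivlMr // mul1r.
  by rewrite ler_eXn2l ?ltr1n // ltnW.
rewrite pexpZf pexp_horner horner_prod.
have -> : \prod_(i in A) (bern (p i)).[2^-1] = \prod_(i in A) (1 - p i / 2).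
  by apply: eq_bigr => i _; rewrite /bern !hornerE; field.
have h1 : \prod_(i in A) (1 - p i / 2) <= expR (- (\sum_(i in A) p i) / 2).
  apply: (@le_trans _ _ (\prod_(i in A) expR (- p i / 2))).
    apply: ler_prod => i /hp /andP[h1 h2]; apply/andP; split; first by lra.
    by have := expR_ge1Dx (- p i / 2); rewrite mulNr.
  by rewrite -expR_sum -mulr_suml sumrN.
have h2 : expR (- (\sum_(i in A) p i) / 2) <= expR (- k%:R) * (eps / k%:R) ^+ 2.
  have -> : expR (- k%:R) * (eps / k%:R) ^+ 2 = expR (- k%:R - 2 * ln (k%:R / eps)).
    rewrite expRD; congr (_ * _); rewrite -[k%:R / eps]invf_div lnV ?posrE ?divr_gt0 //.
    rewrite mulrN opprK mulr_natl mulr2n expRD lnK ?posrE ?divr_gt0 //.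
  by rewrite ler_expR; move: hL; rewrite /Lambda; lra.
have h3 : (2 : R) ^+ k <= expR k%:R.
  rewrite -[X in expR X]mulr1 expRM_natl lerXn2r ?nnegrE ?expR_ge0 //.
  by have := expR_ge1Dx (1 : R); rewrite -[1 + 1]/(2 : R).
apply: (@le_trans _ _ (k%:R * expR k%:R * (expR (- k%:R) * (eps / k%:R) ^+ 2))).
  apply: ler_pM; rewrite ?mulr_ge0 ?exprn_ge0 //; last exact: le_trans h1 h2.
  - by apply: prodr_ge0 => i /hp /andP[]; lra.
  - by rewrite ler_wpM2l // ler0n.
rewrite (_ : _ * _ * _ = (expR k%:R * expR (- k%:R)) * (eps ^+ 2 / k%:R)); last first.
  by field; rewrite gt_eqF.
by rewrite -expRD subrr expR0 mul1r ler_pdivrMr // ler_peMr ?ler1n ?sqr_ge0 ?k0' //.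
Qed.

Lemma bernoulli_saturation_4 : bernoulli_saturation (4 : R).
Proof.
move=> k eps k0 e0 _ m p hp hL.
have hD i : is_dist (bernoulli_dist (p i)).
  have /andP[h1 h2] := hp i; split; last by rewrite !big_cons big_nil /=; ring.
  by move=> am; rewrite !inE => /orP[/eqP ->|/eqP ->] /=; split; lra.
have := @bern_saturated _ predT p k eps k0 e0 (fun i _ => hp i) hL.
rewrite (_ : \prod_(i in predT) bern (p i) =
  count_poly (fun i => bernoulli_dist (p i)) finset.setT 1); last first.
  rewrite /count_poly; apply: eq_big => i; first by rewrite !inE.
  move=> _; congr bern; rewrite /tailp /mean !big_cons big_nil /=.
  by rewrite lexx ler10 mulr0 mulr1 add0r addr0.
rewrite -expect_count //; congr (_ - _ <= _).
apply: eq_expect => x hx; congr (Num.min _ _); rewrite /count_ge natr_sum.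
apply: eq_big => i; first by rewrite !inE.
move=> _; have := hx i; rewrite !inE => /orP[/eqP ->|/eqP ->] /=.
  by rewrite ler10.
by rewrite lexx.
Qed.

End Saturation.

(** * Comparing two sets *)

Section LevelComparison.

(** Factors are grouped by class. Class 0 contributes the neutral element, hence the comparison over
    positive classes only. *)
Lemma eq_big_count (T : Type) (idx : T) (op : Monoid.com_law idx) (I : finType)
    (S1 S2 : {set I}) (q : I -> nat) (F : nat -> T) : F 0%N = idx ->
  (forall c, (0 < c)%N ->
     (\sum_(i in S1) (q i == c) = \sum_(i in S2) (q i == c))%N) ->
  \big[op/idx]_(i in S1) F (q i) = \big[op/idx]_(i in S2) F (q i).
Proof.
move=> F0 h.
pose N := (\max_i q i).+1.
have qN i : (q i < N)%N by rewrite ltnS leq_bigmax.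
have E (S : {set I}) : \big[op/idx]_(i in S) F (q i) =
    \big[op/idx]_(c < N) iter (\sum_(i in S) (q i == c)) (op (F c)) idx.
  rewrite (partition_big (fun i => Ordinal (qN i)) xpredT) //=.
  apply: eq_bigr => c _.
  rewrite (eq_bigr (fun=> F c)); last by move=> i /andP[_ /eqP <-].
  rewrite big_const; congr iter; rewrite -sum1_card big_mkcondr /=.
  by apply: eq_bigr => i _; rewrite -val_eqE /=; case: (_ == _).
rewrite !E; apply: eq_bigr => c _; case: (posnP c) => [->|c0]; last by rewrite h.
have it m : iter m (op idx) idx = idx by elim: m => //= m ->; rewrite Monoid.mul1m.
by rewrite F0 !it.
Qed.

Variables (R : realType) (I : finType).

(* p i is rounded to a i / G with G = D h, then split as q / h + r / G, where
   q and r are the quotient and the remainder of a i by D. *)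
Lemma close_round (S : {set I}) (p : I -> R) (a : I -> nat) (N L h : nat) (lam : R) :
  (#|I| <= N)%N -> (0 < N)%N -> (0 < L)%N -> (0 < h)%N -> lam * L%:R <= h%:R ->
  (forall i, 0 <= p i <= 1) ->
  (forall i, (a i)%:R <= p i * (N * L * h)%:R < (a i).+1%:R) ->
  (\sum_(i in S) a i)%:R <= lam * (N * L * h)%:R ->
  close (2 / L%:R) (\prod_(i in S) bern (p i))
    ((\prod_(i in S) bern ((a i %/ (N * L))%:R / h%:R)) *
     (\prod_(i in S) bern ((a i %% (N * L))%:R / (N * L * h)%:R))).
Proof.
move=> hN N0 L0 h0 hlam hp ha hs.
have N0' : (0 : R) < N%:R by rewrite ltr0n.
have L0' : (0 : R) < L%:R by rewrite ltr0n.
have h0' : (0 : R) < h%:R by rewrite ltr0n.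
have G0 : (0 : R) < (N * L * h)%:R by rewrite !natrM !mulr_gt0.
have hG i : (0 : R) <= (a i)%:R / (N * L * h)%:R <= p i.
  by rewrite divr_ge0 ?ler0n //= ler_pdivrMr //; have /andP[] := ha i.
have dec i : (a i)%:R / (N * L * h)%:R =
    (a i %/ (N * L))%:R / h%:R + (a i %% (N * L))%:R / (N * L * h)%:R :> R.
  rewrite {1}(divn_eq (a i) (N * L)) natrD mulrDl; congr (_ + _).
  by rewrite !natrM; field; rewrite !gt_eqF.
have q0 i : 0 <= (a i %/ (N * L))%:R / h%:R :> R by rewrite divr_ge0 ?ler0n.
have r0 i : 0 <= (a i %% (N * L))%:R / (N * L * h)%:R :> R by rewrite divr_ge0 ?ler0n.
rewrite -big_split mulr2n mulrDl /=.
(* Rounding moves at most N parameters by less than 1 / (N L h) each, so it costs at most 1 / L. *)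
apply: (@close_trans _ _ _ (\prod_(i in S) bern ((a i)%:R / (N * L * h)%:R))).
  apply: close_le.
    apply: (@close_prod _ _ _ _ _ _ (fun i => `|p i - (a i)%:R / (N * L * h)%:R|)) => i _.
    - exact: prob_bern.
    - by apply: prob_bern; have := hG i; have := hp i; lra.
    - exact: close_bern.
  apply: (@le_trans _ _ (\sum_(i in S) (N * L * h)%:R^-1)).
    apply: ler_sum => i _; rewrite ger0_norm; last by have := hG i; lra.
    have /andP[_] := ha i; rewrite -(ltr_pdivlMr _ _ G0) -natr1 mulrDl mul1r.
    lra.
  rewrite sumr_const -[leLHS]mulr_natl ler_pdivrMr //.
  apply: (@le_trans _ _ N%:R); first by rewrite ler_nat (leq_trans (max_card _)).
  rewrite !natrM (_ : 1 / L%:R * (N%:R * L%:R * h%:R) = N%:R * h%:R); last first.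
    by field; rewrite gt_eqF.
  by rewrite ler_peMr ?ler1n ?ler0n.
(* Splitting a parameter into q / h and r / G costs their product, at most (a i / G) / h. The sum is
   at most lam / h, which [hlam] bounds by 1 / L. *)
apply: close_sym; apply: close_le.
  apply: (@close_prod _ _ _ _ _ _ (fun i => ((a i %/ (N * L))%:R / h%:R) *
     ((a i %% (N * L))%:R / (N * L * h)%:R))) => i _.
  - have := hG i; have := hp i; have := q0 i; have := r0 i; have := dec i.
    by move=> *; apply: prob_polyM; apply: prob_bern; lra.
  - by apply: prob_bern; have := hG i; have := hp i; lra.
  - by rewrite dec; apply: close_bernM.
apply: (@le_trans _ _ (\sum_(i in S) (a i)%:R / (N * L * h)%:R * h%:R^-1)).
  apply: ler_sum => i _; apply: ler_pM => //.
    by rewrite [leRHS]dec lerDl.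
  rewrite ler_pdivrMr // !natrM (_ : _^-1 * _ = N%:R * L%:R); last first.
    by field; rewrite gt_eqF.
  by rewrite -natrM ler_nat ltnW // ltn_mod muln_gt0 N0.
rewrite -!mulr_suml -natr_sum ler_pdivrMr // ler_pdivrMr //.
apply: le_trans hs _; rewrite ler_wpM2r ?ler0n //.
by rewrite mulrAC ler_pdivlMr // mul1r.
Qed.

(** Below saturation the error is three times 2 / L: one rounding for each set, and one exchange of
    the small remainders by [close_same_sum]. Beyond it both expectations lie within eps ^ 2 of
    k. *)
Lemma level_close (S1 S2 : {set I}) (p : I -> R) (a : I -> nat) (N L h k : nat)
    (eps : R) :
  (#|I| <= N)%N -> (0 < N)%N -> (0 < L)%N -> (0 < h)%N -> (0 < k)%N -> 0 < eps ->
  Lambda 4 k eps * L%:R <= h%:R -> eps ^+ 2 <= 6 / L%:R ->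
  (forall i, 0 <= p i <= 1) ->
  (forall i, (a i)%:R <= p i * (N * L * h)%:R < (a i).+1%:R) ->
  (\sum_(i in S1) a i = \sum_(i in S2) a i)%N ->
  ((\sum_(i in S1) a i)%:R <= Lambda 4 k eps * (N * L * h)%:R ->
   forall c, (0 < c)%N -> (\sum_(i in S1) (a i %/ (N * L) == c)
       = \sum_(i in S2) (a i %/ (N * L) == c))%N) ->
  `|pexp (fun l => Num.min k%:R l%:R) (\prod_(i in S1) bern (p i)) -
    pexp (fun l => Num.min k%:R l%:R) (\prod_(i in S2) bern (p i))| <= 6 / L%:R.
Proof.
move=> hN N0 L0 h0 k0 e0 hlam heps hp ha hsum hcnt.
have N0' : (0 : R) < N%:R by rewrite ltr0n.
have L0' : (0 : R) < L%:R by rewrite ltr0n.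
have h0' : (0 : R) < h%:R by rewrite ltr0n.
have G0 : (0 : R) < (N * L * h)%:R by rewrite !natrM !mulr_gt0.
set lam := Lambda 4 k eps in hlam hcnt *.
(* The sums of the codes agree, so both sets fall into the same regime. *)
have [hu|hs] := leP (\sum_(i in S1) a i)%:R (lam * (N * L * h)%:R); last first.
  have sat (S : {set I}) : lam * (N * L * h)%:R < (\sum_(i in S) a i)%:R ->
      k%:R - eps ^+ 2 <= pexp (fun l => Num.min k%:R l%:R) (\prod_(i in S) bern (p i)) <= k%:R.
    move=> hS; apply/andP; split.
      rewrite lerBlDr -lerBlDl; apply: bern_saturated => //.
      rewrite -(ler_pM2r G0); apply: le_trans (ltW hS) _.
      by rewrite natr_sum mulr_suml ler_sum // => i _; have /andP[] := ha i.
    have hb : prob_poly (\prod_(i in S) bern (p i)).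
      by apply: prob_poly_prod => i _; exact: prob_bern.
    rewrite -[leRHS](pexp_cst _ hb); apply: le_pexp; first by case: hb.
    by move=> l; rewrite ge_min lexx.
  have := sat S1 hs; have := sat S2; rewrite -hsum => /(_ hs).
  move: heps; set e2 := eps ^+ 2; set u := pexp _ _; set v := pexp _ _.
  by move=> hh hu hv; rewrite ler_norml; lra.
have c1 := close_round hN N0 L0 h0 hlam hp ha hu.
have c2 := close_round hN N0 L0 h0 hlam hp ha (S := S2).
rewrite -hsum in c2; have {}c2 := close_sym (c2 hu).
have eqQ : \prod_(i in S1) bern ((a i %/ (N * L))%:R / h%:R) =
           \prod_(i in S2) bern ((a i %/ (N * L))%:R / h%:R) :> {poly R}.
  apply: (@eq_big_count _ _ _ _ _ _ _ (fun c => bern (c%:R / h%:R))).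
    by rewrite mul0r bern0.
  exact: hcnt.
have eqq : (\sum_(i in S1) (a i %/ (N * L)) = \sum_(i in S2) (a i %/ (N * L)))%N.
  by apply: (@eq_big_count _ _ _ _ _ _ _ id) => //; exact: hcnt.
(* Equal sums of codes and equal sums of quotients leave equal sums of remainders. *)
have eqr : (\sum_(i in S1) (a i %% (N * L)) = \sum_(i in S2) (a i %% (N * L)))%N.
  have dec (S : {set I}) : (\sum_(i in S) a i =
      (\sum_(i in S) (a i %/ (N * L))) * (N * L) + \sum_(i in S) (a i %% (N * L)))%N.
    by rewrite big_distrl -big_split; apply: eq_bigr => i _; exact: divn_eq.
  by apply/eqP; rewrite -(eqn_add2l ((\sum_(i in S1) (a i %/ (N * L))) * (N * L))) {2}eqq -!dec hsum.
have rb i : (0 : R) <= (a i %% (N * L))%:R / (N * L * h)%:R <= (h%:R^-1 : R).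
  rewrite divr_ge0 ?ler0n //=. rewrite (ler_pdivrMr _ _ G0) [X in _^-1 * X]natrM mulrC mulfK ?gt_eqF //.
  by rewrite ler_nat ltnW // ltn_mod muln_gt0 N0.
have h1 : h%:R^-1 <= 1 :> R by rewrite invf_le1 // ler1n.
have := @close_same_sum _ _ _ (mem S1) (mem S2) _ _ _ (fun i _ => rb i) (fun i _ => rb i) h1.
rewrite -!mulr_suml -!natr_sum eqr => /(_ erefl) c3.
have pq : prob_poly (\prod_(i in S2) bern ((a i %/ (N * L))%:R / h%:R : R)).
  apply: prob_poly_prod => i _; apply: prob_bern; rewrite divr_ge0 ?ler0n //=.
  rewrite ler_pdivrMr // mul1r ler_nat -ltnS ltn_divLR ?muln_gt0 ?N0 //.
  have /andP[h2 _] := ha i; have /andP[_ h3] := hp i.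
  have : (a i)%:R <= (N * L * h)%:R :> R.
    by apply: le_trans h2 _; rewrite ler_piMl ?ler0n.
  by rewrite ler_nat => h4; apply: leq_ltn_trans h4 _; rewrite mulnC ltn_pmul2r ?muln_gt0 ?N0.
have {}c3 := close_mulr pq c3.
rewrite eqQ in c1.
rewrite ![_ * \prod_(i in S2) bern ((_ %/ _)%:R / _)]mulrC in c3.
have c := close_trans (close_trans c1 c3) c2.
apply: le_trans (c _ (tame_min _ k)) _.
(* The remainder parameters are at most 1 / h and their sum is at most lam, so the exchange costs at
   most 2 lam / h <= 2 / L. *)
suff : h%:R^-1 * ((\sum_(i in S2) (a i %% (N * L)))%:R / (N * L * h)%:R) <= 1 / L%:R :> R.
  by lra.
rewrite mulrC ler_pdivrMr // ler_pdivrMr //.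
apply: (@le_trans _ _ (lam * (N * L * h)%:R)).
  apply: le_trans hu; rewrite ler_nat hsum leq_sum // => i _; exact: leq_mod.
by rewrite ler_wpM2r ?ler0n // mulrAC ler_pdivlMr // mul1r.
Qed.

End LevelComparison.

(** * Staircase approximation of the expected top-k sum *)

Section Approximation.
Variables (R : realType) (n : nat).
Implicit Types (S : {set 'I_n}) (x : 'I_n -> R) (D : 'I_n -> seq (R * R)).

(** A lower staircase for min(v, L theta): v rounded down to the grid of step theta and
    truncated. *)
Definition stairs (theta : R) (L : nat) (v : R) : R :=
  \sum_(0 <= j < L) theta * (j.+1%:R * theta <= v)%R%:R.

Lemma stairs_bounds theta L v : 0 < theta -> 0 <= v ->
  stairs theta L v + Num.max (v - L%:R * theta) 0 <= v /\
  v <= theta + (stairs theta L v + Num.max (v - L%:R * theta) 0).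
Proof.
move=> t0 v0; rewrite /stairs.
have : if L%:R * theta <= v then \sum_(0 <= j < L) theta * (j.+1%:R * theta <= v)%R%:R = L%:R * theta
  else \sum_(0 <= j < L) theta * (j.+1%:R * theta <= v)%R%:R <= v /\
       v <= theta + \sum_(0 <= j < L) theta * (j.+1%:R * theta <= v)%R%:R.
  elim: L => [|L]; first by rewrite big_nil !mul0r v0.
  rewrite big_nat_recr //=; set s := \sum_(0 <= j < L) _.
  rewrite -natr1 mulrDl mul1r.
  case: (leP (L%:R * theta) v) => h1 ih; case: (leP (L%:R * theta + theta) v) => h2;
    rewrite ?mulr1 ?mulr0; lra.
set s := \sum_(0 <= j < L) _.
case: (leP (L%:R * theta) v) => h1 ih.
  by rewrite max_l ?subr_ge0 //; lra.
by rewrite max_r ?subr_le0 ?(ltW h1) //; lra.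
Qed.

Lemma top_stairs k S theta L x :
  top_map k S (stairs theta L) x =
  \sum_(0 <= j < L) theta * Num.min k%:R (count_ge S (j.+1%:R * theta) x)%:R.
Proof.
rewrite top_map_sum; apply: eq_bigr => j _.
by rewrite top_mapZ top_map_ind natr_min.
Qed.

Definition level_mean k D S (c : R) : R :=
  pexp (fun l => Num.min k%:R l%:R) (count_poly D S c).

Lemma expect_stairs k D S theta L : (forall i, is_dist (D i)) ->
  expect D (top_map k S (stairs theta L)) =
  \sum_(0 <= j < L) theta * level_mean k D S (j.+1%:R * theta).
Proof.
move=> hD; rewrite (_ : top_map k S _ = (fun x =>
  \sum_(0 <= j < L) theta * Num.min k%:R (count_ge S (j.+1%:R * theta) x)%:R)); last first.
  by apply/funext => x; exact: top_stairs.
rewrite expect_sum; apply: eq_bigr => j _; rewrite expectZ.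
by rewrite (expect_count _ _ (fun l => Num.min k%:R l%:R)).
Qed.

Lemma expect_sum_excess D S c : (forall i, is_dist (D i)) ->
  expect D (fun x => \sum_(i in S) Num.max (x i - c) 0) =
  \sum_(i in S) excess (D i) c.
Proof.
move=> hD; rewrite expect_sum; apply: eq_bigr => i _.
exact: (expect1 i (fun v => Num.max (v - c) 0)).
Qed.

(** The staircase loses at most theta on each of at most k selected values, and the excess of the
    selected values is at most that of all values. *)
Lemma exp_top_upper k D S theta L : (forall i, is_dist (D i)) -> 0 < theta ->
  exp_top k D S <= k%:R * theta +
    \sum_(0 <= j < L) theta * level_mean k D S (j.+1%:R * theta) +
    \sum_(i in S) excess (D i) (L%:R * theta).
Proof.
move=> hD t0; rewrite -(expect_stairs _ _ _ _ hD) -(expect_sum_excess _ _ hD).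
rewrite -(expect_cst (k%:R * theta) hD) -!expectD; apply: le_expect => // x x0.
apply: (@le_trans _ _ (top_map k S (fun v => theta + (stairs theta L v +
  Num.max (v - L%:R * theta) 0)) x)).
  by rewrite top_sumE; apply: le_top_map => i _; exact: (stairs_bounds L t0 (x0 i)).2.
rewrite !top_mapD addrA lerD //; first by rewrite lerD2r top_map_cst // ltW.
by apply: top_map_le_sum => i _; rewrite le_max lexx orbT.
Qed.

(** Let i carry the largest value. Any other j with x j > a has x i - tau >= a - tau, so x j - a is
    at most the pair term of i and j; the excess at i itself is collected by [top_map]. *)
Lemma max_excess_ge k S x (tau a : R) : (0 < k)%N -> tau < a -> 
  \sum_(i in S) Num.max (x i - a) 0 -
  \sum_(i in S) \sum_(j in S | j != i)
    Num.max (x i - tau) 0 * Num.max (x j - tau) 0 / (a - tau) <=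
  top_map k S (fun v => Num.max (v - a) 0) x.
Proof.
move=> k0 ta.
have pos (v b : R) : 0 <= Num.max (v - b) 0 by rewrite le_max lexx orbT.
have mono : {homo (fun v : R => Num.max (v - a) 0) : y z / y <= z}.
  by move=> y z yz; rewrite ge_max !le_max lerD2r yz lexx orbT.
have pair0 i j : 0 <= Num.max (x i - tau) 0 * Num.max (x j - tau) 0 / (a - tau).
  by rewrite divr_ge0 ?mulr_ge0 ?pos // subr_ge0 ltW.
case: (set_0Vmem S) => [->|[i0 i0S]].
  by rewrite !big_set0 subr0 sumr_ge0.
have [i iS imax] : exists2 i, i \in S & forall j, j \in S -> x j <= x i.
  have [i iS h] := arg_maxP (fun i => x i) i0S.
  by exists i => // j jS; exact: h.
rewrite lerBlDr (bigD1 i) //=.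
apply: lerD; first exact: (top_map_ge1 (f := fun v => Num.max (v - a) 0)).
rewrite [leRHS](bigD1 i) //=; apply: (@le_trans _ _ (\sum_(j in S | j != i)
    Num.max (x i - tau) 0 * Num.max (x j - tau) 0 / (a - tau))); last first.
  by rewrite lerDl sumr_ge0 // => j _; rewrite sumr_ge0.
apply: ler_sum => j /andP[jS ji]; have hm := imax j jS.
case: (leP (x j) a) => ha; first by rewrite [leLHS]max_r ?subr_le0.
rewrite ler_pdivlMr ?subr_gt0 // !max_l ?subr_ge0; try lra.
by rewrite [leRHS]mulrC ler_pM ?subr_ge0 //; lra.
Qed.

(** By independence the pair terms of [max_excess_ge] have products of excesses as expectations;
    adding the diagonal completes a square. Two values beyond L theta are thus charged to the
    surplus at the lower level tau. *)
Lemma exp_top_lower k D S theta L (tau : R) : (forall i, is_dist (D i)) ->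
  (0 < k)%N -> 0 < theta -> tau < L%:R * theta ->
  \sum_(0 <= j < L) theta * level_mean k D S (j.+1%:R * theta) +
  \sum_(i in S) excess (D i) (L%:R * theta) -
  (\sum_(i in S) excess (D i) tau) ^+ 2 / (L%:R * theta - tau) <=
  exp_top k D S.
Proof.
move=> hD k0 t0 ht; set a := L%:R * theta.
have pos (v b : R) : 0 <= Num.max (v - b) 0 by rewrite le_max lexx orbT.
have e0 i b : 0 <= excess (D i) b by apply: mean_ge0.
pose pairs x := \sum_(i in S) \sum_(j in S | j != i)
    Num.max (x i - tau) 0 * Num.max (x j - tau) 0 / (a - tau).
apply: (@le_trans _ _ (expect D (fun x => top_map k S (stairs theta L) x +
   \sum_(i in S) Num.max (x i - a) 0 - pairs x))).
  rewrite expectB expectD expect_stairs // expect_sum_excess // lerD2l lerN2.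
  rewrite expect_sum expr2 mulr_suml mulr_suml; apply: ler_sum => i iS.
  rewrite expect_sum; apply: (@le_trans _ _ (\sum_(j in S | j != i)
      excess (D i) tau * excess (D j) tau / (a - tau))).
    apply: ler_sum => j /andP[jS ji]; rewrite le_eqVlt; apply/orP; left.
    rewrite (_ : (fun x => _) = (fun x : 'I_n -> R => (a - tau)^-1 *
      (Num.max (x i - tau) 0 * Num.max (x j - tau) 0))); last by apply/funext => x; rewrite mulrC.
    rewrite expectZ (expect2 (fun v => Num.max (v - tau) 0) (fun v => Num.max (v - tau) 0)) //.
      by rewrite mulrC.
    by rewrite eq_sym.
  rewrite mulr_sumr mulr_suml [leRHS](bigD1 i) //= lerDr.
  by rewrite divr_ge0 ?mulr_ge0 ?e0 // subr_ge0 ltW.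
apply: le_expect => // x x0; rewrite -addrA.
apply: (@le_trans _ _ (top_map k S (fun v => stairs theta L v + Num.max (v - a) 0) x)).
  by rewrite top_mapD lerD2l; exact: max_excess_ge.
rewrite top_sumE; apply: le_top_map => i _; exact: (stairs_bounds L t0 (x0 i)).1.
Qed.

(** With tau = m theta and L = m ^ 2 the quadratic term is at most (k m theta) ^ 2 over (m ^ 2 - m)
    theta, that is 2 k ^ 2 theta as soon as m >= 2. The other terms are k theta for the staircase,
    theta for the tails and eta theta per level. *)
Lemma exp_top_transfer k D (S1 S2 : {set 'I_n}) theta (m : nat) (eta : R) :
  (forall i, is_dist (D i)) -> (0 < k)%N -> (1 < m)%N -> 0 < theta ->
  (forall j, (j < m ^ 2)%N -> `|level_mean k D S1 (j.+1%:R * theta) -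
                level_mean k D S2 (j.+1%:R * theta)| <= eta) ->
  \sum_(i in S1) excess (D i) ((m ^ 2)%:R * theta) <=
    \sum_(i in S2) excess (D i) ((m ^ 2)%:R * theta) + theta ->
  \sum_(i in S2) excess (D i) (m%:R * theta) <= k%:R * (m%:R * theta) ->
  exp_top k D S1 <= exp_top k D S2 +
    theta * (2 * k%:R ^+ 2 + k%:R + 1 + (m ^ 2)%:R * eta).
Proof.
move=> hD k0 m1 t0 hl ht hs.
have m2 : (2 : R) <= m%:R by rewrite ler_nat.
have mm : m%:R * theta < (m ^ 2)%:R * theta.
  by rewrite ltr_pM2r // ltr_nat; nia.
have h1 := exp_top_upper k S1 (m ^ 2) hD t0.
have h2 := exp_top_lower S2 hD k0 t0 mm.
have h3 : \sum_(0 <= j < m ^ 2) theta * level_mean k D S1 (j.+1%:R * theta) <=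
  \sum_(0 <= j < m ^ 2) theta * level_mean k D S2 (j.+1%:R * theta) +
  theta * ((m ^ 2)%:R * eta).
  have -> : theta * ((m ^ 2)%:R * eta) = \sum_(0 <= j < m ^ 2) theta * eta.
    by rewrite sumr_const_nat subn0 -mulr_natl; ring.
  rewrite -big_split /= !big_mkord; apply: ler_sum => j _; rewrite -mulrDr ler_wpM2l ?(ltW t0) //.
  by have := hl j (ltn_ord j); rewrite ler_norml => /andP[_]; rewrite lerBlDl.
have e0 : 0 <= \sum_(i in S2) excess (D i) (m%:R * theta).
  by apply: sumr_ge0 => i _; apply: mean_ge0 => // v _; rewrite le_max lexx orbT.
have h4 : (\sum_(i in S2) excess (D i) (m%:R * theta)) ^+ 2 /
    ((m ^ 2)%:R * theta - m%:R * theta) <= 2 * k%:R ^+ 2 * theta.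
  rewrite ler_pdivrMr ?subr_gt0 //.
  apply: (@le_trans _ _ ((k%:R * (m%:R * theta)) ^+ 2)).
    by rewrite ler_pXn2r ?nnegrE // (le_trans e0).
  rewrite natrX; have -> : 2 * k%:R ^+ 2 * theta * (m%:R ^+ 2 * theta - m%:R * theta) =
     (k%:R * (m%:R * theta)) ^+ 2 + (k%:R * theta) ^+ 2 * (m%:R * (m%:R - 2)) by ring.
  by rewrite lerDl mulr_ge0 ?sqr_ge0 // mulr_ge0 ?ler0n // subr_ge0.
lra.
Qed.

Lemma exp_top_le_surplus k D S (T : R) : (forall i, is_dist (D i)) -> 0 <= T ->
  exp_top k D S <= k%:R * T + \sum_(i in S) excess (D i) T.
Proof.
move=> hD T0; rewrite -(expect_sum_excess _ _ hD) -(expect_cst (k%:R * T) hD) -expectD.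
apply: le_expect => // x x0; rewrite top_sumE.
apply: (@le_trans _ _ (top_map k S (fun v => T + Num.max (v - T) 0) x)).
  by apply: le_top_map => i _; rewrite -lerBlDl le_max lexx.
rewrite top_mapD lerD ?top_map_cst //.
by apply: top_map_le_sum => i _; rewrite le_max lexx orbT.
Qed.

(* A set of surplus k T already earns k T by selling k units at price T: unit i
   collects its surplus when fewer than k other variables reach T. *)
Lemma surplus_le_exp_top k D S (T : R) : (forall i, is_dist (D i)) -> 0 <= T ->
  \sum_(i in S) excess (D i) T = k%:R * T -> k%:R * T <= exp_top k D S.
Proof.
move=> hD T0 hs.
have pos (v b : R) : 0 <= Num.max (v - b) 0 by rewrite le_max lexx orbT.
pose below (l : nat) : R := (l < k)%N%:R.
have hp i : prob_poly (bern (tailp (D i) T)) by apply: prob_bern; exact: tailp_01.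
have hc A : prob_poly (count_poly D A T) by apply: prob_poly_prod.
apply: (@le_trans _ _ (expect D (fun x => T * Num.min k%:R (count_ge S T x)%:R +
   \sum_(i in S) Num.max (x i - T) 0 * below (count_ge (S :\ i) T x)))).
  rewrite expectD expectZ (expect_count _ _ (fun l => Num.min k%:R l%:R)) // expect_sum.
  apply: (@le_trans _ _ (T * pexp (fun l => Num.min k%:R l%:R) (count_poly D S T) +
      \sum_(i in S) excess (D i) T * pexp below (count_poly D S T))); last first.
    rewrite lerD2l; apply: ler_sum => i iS.
    rewrite (@expect1_count _ _ _ _ _ _ (fun v => Num.max (v - T) 0)) //.
    rewrite ler_wpM2l ?mean_ge0 //.
    (* Restoring variable i can only raise the count, so having fewer than k variables at T is at
       least as likely for [S :\ i] as for [S]. *)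
    have -> : count_poly D S T = bern (tailp (D i) T) * count_poly D (S :\ i) T.
      by rewrite /count_poly (big_setD1 i).
    rewrite pexp_bernM; apply: le_pexp; first by case: (hc (S :\ i)).
    move=> l; rewrite /below; have /andP[h0 h1] := tailp_01 T (hD i).
    have [h|h] := boolP (l < k)%N; have [h'|h'] := boolP (l.+1 < k)%N; rewrite /=; try lra.
    by move: h; rewrite (ltnW h').
  rewrite -mulr_suml hs -mulrA [k%:R * (T * _)]mulrCA -mulrDr -pexpZf -pexpDf mulrC.
  rewrite ler_wpM2l // -[leLHS](pexp_cst _ (hc S)); apply: le_pexp; first by case: (hc S).
  (* Pointwise, min(k, l) plus k times the indicator of l < k is at least k. *)
  move=> l; rewrite /below; case: (ltnP l k) => h; rewrite ?mulr1 ?mulr0.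
    by rewrite lerDr le_min !ler0n.
  by rewrite addr0 min_l // ler_nat.
apply: le_expect => // x x0; rewrite top_sumE.
apply: (@le_trans _ _ (top_map k S (fun v => T * (T <= v)%R%:R + Num.max (v - T) 0) x)); last first.
  apply: le_top_map => i _; case: (leP T (x i)) => h.
    by rewrite mulr1 max_l ?subr_ge0 // addrC subrK.
  by rewrite mulr0 add0r max_r // subr_le0 ltW.
rewrite top_mapD top_mapZ top_map_ind natr_min lerD2l.
have cnt i : i \in S -> T <= x i -> count_ge S T x = (count_ge (S :\ i) T x).+1.
  by move=> iS h; rewrite /count_ge (big_setD1 i) //= h.
case: (leqP (count_ge S T x) k) => hk.
  rewrite (top_map_all (f := fun v => Num.max (v - T) 0) (c := T)) //.
  - by apply: ler_sum => i _; rewrite ler_piMr // lern1 leq_b1.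
  - apply: leq_trans hk; apply: leq_sum => i _.
    by case: (ltP T (x i)) => // /ltW ->.
  - by move=> v hv; rewrite max_r // subr_le0.
(* If more than k variables reach T, each of them sees at least k others, and the remaining ones
   have no surplus: every term is 0. *)
apply: (@le_trans _ _ 0); last by apply: sumr_ge0.
rewrite big1 // => i iS; case: (leP T (x i)) => h.
  by rewrite /below; move: hk; rewrite (cnt i) // ltnS => hk; rewrite ltnNge hk mulr0.
by rewrite max_r ?mul0r // subr_le0 ltW.
Qed.

End Approximation.

(** * Integer scaling and exact evaluation *)

Section Scaling.

(** The factor 1 + [numq am.1] makes the product over all atoms exceed every atom value besides
    clearing denominators, so that Z also serves as a bound on the values. *)
Definition atom_weight (am : rat * rat) : int :=
  (1 + numq am.1) * denq am.1 * denq am.2.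

Definition common_den (s : seq (rat * rat)) : int :=
  foldl (fun z am => z * atom_weight am) 1 s.

Variable K : nat.

(** Values are scaled by K Z ^ 2 and masses by Z, both divisions being exact. The algorithm takes K
    = m (k + 1); since T >= 1 / ((k + 1) Z) when T > 0, one unit of the scaled values is then at
    most T / m. *)
Definition sval (Z : int) (am : rat * rat) : int :=
  (Posz K * (Z * Z) * numq am.1 %/ denq am.1)%Z.

Definition smass (Z : int) (am : rat * rat) : int :=
  (Z * numq am.2 %/ denq am.2)%Z.

Definition mass_from (Z c : int) (l : seq (rat * rat)) : int :=
  foldl (fun a am => a + smass Z am * Posz (c <= sval Z am)%R) 0 l.

Definition excess_from (Z c : int) (l : seq (rat * rat)) : int :=
  foldl (fun a am => a + smass Z am * (Posz (c <= sval Z am)%R * (sval Z am - c))) 0 l.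

Lemma foldl_sum (T : Type) (f : T -> int) l a :
  foldl (fun a x => a + f x) a l = a + \sum_(x <- l) f x.
Proof.
elim: l a => [|x l ih] a /=; first by rewrite big_nil addr0.
by rewrite ih big_cons addrA.
Qed.

Lemma mass_fromE Z c l :
  mass_from Z c l = \sum_(am <- l) smass Z am * Posz (c <= sval Z am)%R.
Proof. by rewrite /mass_from foldl_sum add0r. Qed.

Lemma excess_fromE Z c l : excess_from Z c l =
  \sum_(am <- l) smass Z am * (Posz (c <= sval Z am)%R * (sval Z am - c)).
Proof. by rewrite /excess_from foldl_sum add0r. Qed.

Definition nonneg_atom (am : rat * rat) : Prop := 0 <= am.1 /\ 0 <= am.2.

Lemma atom_weight_gt0 am : nonneg_atom am -> 0 < atom_weight am.
Proof.
case=> h1 h2; rewrite /atom_weight !mulr_gt0 ?denq_gt0 //.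
by rewrite ltr_wpDr // numq_ge0.
Qed.

Lemma common_denE s : common_den s = \prod_(am <- s) atom_weight am.
Proof.
have E z : foldl (fun z am => z * atom_weight am) z s =
    z * \prod_(am <- s) atom_weight am.
  elim: s z => [|am s' ih] z /=; first by rewrite big_nil mulr1.
  by rewrite ih big_cons mulrA.
by rewrite /common_den E mul1r.
Qed.

Lemma common_den_gt0 s : {in s, forall am, nonneg_atom am} -> 0 < common_den s.
Proof.
move=> h; rewrite common_denE big_seq.
by apply: prodr_gt0 => am /h; exact: atom_weight_gt0.
Qed.

Lemma common_den_factor s am : {in s, forall am, nonneg_atom am} -> am \in s ->
  exists2 q, 0 < q & common_den s = q * atom_weight am.
Proof.
move=> h ams; rewrite common_denE (big_rem am) //= mulrC.
exists (\prod_(y <- rem am s) atom_weight y) => //.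
rewrite big_seq; apply: prodr_gt0 => y /mem_rem /h; exact: atom_weight_gt0.
Qed.

Variable s : seq (rat * rat).
Hypothesis s_nonneg : {in s, forall am, nonneg_atom am}.
Let Z := common_den s.

Lemma sval_mul_den am : am \in s ->
  sval Z am * denq am.1 = Posz K * (Z * Z) * numq am.1.
Proof.
move=> ams; rewrite /sval divzK //; have [q _ e] := common_den_factor s_nonneg ams.
rewrite /Z e /atom_weight; apply/dvdzP.
exists (Posz K * q * (1 + numq am.1) * denq am.2 *
  (q * ((1 + numq am.1) * denq am.1 * denq am.2)) * numq am.1); ring.
Qed.

Lemma smass_mul_den am : am \in s -> smass Z am * denq am.2 = Z * numq am.2.
Proof.
move=> ams; rewrite /smass divzK //; have [q _ e] := common_den_factor s_nonneg ams.
rewrite /Z e /atom_weight; apply/dvdzP.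
by exists (q * ((1 + numq am.1) * denq am.1) * numq am.2); ring.
Qed.

Lemma sval_ge0 am : am \in s -> 0 <= sval Z am.
Proof.
move=> ams; have [h1 h2] := s_nonneg ams.
rewrite -(pmulr_lge0 _ (denq_gt0 am.1)) sval_mul_den //.
have := common_den_gt0 s_nonneg; rewrite -/Z => Z0.
by rewrite !mulr_ge0 ?numq_ge0 // ltW.
Qed.

Lemma smass_ge0 am : am \in s -> 0 <= smass Z am.
Proof.
move=> ams; have [h1 h2] := s_nonneg ams.
rewrite -(pmulr_lge0 _ (denq_gt0 am.2)) smass_mul_den //.
have := common_den_gt0 s_nonneg; rewrite -/Z => Z0.
by rewrite !mulr_ge0 ?numq_ge0 // ltW.
Qed.

Lemma sval_lt am : (0 < K)%N -> am \in s -> sval Z am < Posz K * (Z * Z * Z).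
Proof.
move=> K0 ams; have [h1 h2] := s_nonneg ams.
have Z0 : 0 < Z := common_den_gt0 s_nonneg.
have [q q0 e] := common_den_factor s_nonneg ams.
have d1 := denq_gt0 am.1; have d2 := denq_gt0 am.2.
have n0 : 0 <= numq am.1 by rewrite numq_ge0.
have nZ : numq am.1 < Z.
  rewrite /Z e /atom_weight; apply: (@lt_le_trans _ _ (1 + numq am.1)); first by lia.
  rewrite mulrCA -mulrA; apply: ler_peMr; first by lia.
  by rewrite -[1]mulr1 -[1 * 1]mulr1 mulrA; apply: ler_pM => //; apply: ler_pM => //; lia.
apply: (@le_lt_trans _ _ (Posz K * (Z * Z) * numq am.1)).
  rewrite -sval_mul_den // ler_peMr ?sval_ge0 //; lia.
have -> : Posz K * (Z * Z * Z) = Posz K * (Z * Z) * Z by ring.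
by rewrite ltr_pM2l ?mulr_gt0.
Qed.

Variable R : realType.
Let scale : R := K%:R * Z%:~R ^+ 2.

Lemma sval_real am : am \in s -> (sval Z am)%:~R = scale * ratr am.1.
Proof.
move=> ams; have d0 : (denq am.1)%:~R != 0 :> R by rewrite intr_eq0 denq_eq0.
apply: (mulIf d0); rewrite -intrM sval_mul_den // /ratr /scale.
by rewrite !intrM pmulrn expr2 -!mulrA mulVf // mulr1.
Qed.

Lemma smass_real am : am \in s -> (smass Z am)%:~R = Z%:~R * ratr am.2 :> R.
Proof.
move=> ams; have d0 : (denq am.2)%:~R != 0 :> R by rewrite intr_eq0 denq_eq0.
apply: (mulIf d0); rewrite -intrM smass_mul_den // /ratr.
by rewrite !intrM -!mulrA mulVf // mulr1.
Qed.

Hypothesis K0 : (0 < K)%N.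

Lemma scale_gt0 : 0 < scale.
Proof.
by rewrite /scale mulr_gt0 ?ltr0n // exprn_gt0 // ltr0z; exact: common_den_gt0.
Qed.

Lemma sval_le (c : int) am : am \in s ->
  (c <= sval Z am) = (c%:~R / scale <= ratr am.1 :> R).
Proof.
by move=> ams; rewrite ler_pdivrMr ?scale_gt0 // mulrC -sval_real // ler_int.
Qed.

Lemma mass_from_real c l : {subset l <= s} ->
  (mass_from Z c l)%:~R = Z%:~R * tailp (real_dist R l) (c%:~R / scale).
Proof.
move=> ls; rewrite mass_fromE /tailp /mean /real_dist big_map rmorph_sum mulr_sumr.
rewrite !big_seq; apply: eq_bigr => am /ls ams /=.
by rewrite rmorphM /= smass_real // -mulrA sval_le // pmulrn.
Qed.

Lemma excess_from_real c l : {subset l <= s} ->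
  (excess_from Z c l)%:~R = Z%:~R * scale * excess (real_dist R l) (c%:~R / scale).
Proof.
move=> ls; rewrite excess_fromE /excess /mean /real_dist big_map rmorph_sum mulr_sumr.
rewrite !big_seq; apply: eq_bigr => am /ls ams /=.
rewrite rmorphM /= smass_real // rmorphM rmorphB /= sval_real // sval_le //.
have := scale_gt0; move: (ratr am.1) (ratr am.2) scale => x y sc sc0.
case: (leP (c%:~R / sc) x) => h.
  by rewrite max_l ?subr_ge0 //=; field; rewrite gt_eqF.
by rewrite max_r ?subr_le0 1?ltW //=; ring.
Qed.

Lemma smass_sum l : {subset l <= s} -> \sum_(am <- l) am.2 = 1 ->
  \sum_(am <- l) smass Z am = Z.
Proof.
move=> ls h; apply/eqP; rewrite -(eqr_int rat); apply/eqP.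
rewrite rmorph_sum /= -[RHS]mulr1 -[X in _ = _ * X]h mulr_sumr !big_seq; apply: eq_bigr => am /ls ams.
have d0 : (denq am.2)%:~R != 0 :> rat by rewrite intr_eq0 denq_eq0.
apply: (mulIf d0); have := smass_mul_den ams.
move=> /(congr1 (fun z : int => z%:~R : rat)); rewrite !intrM => e.
by rewrite e -mulrA; congr (_ * _); rewrite -{2}(divq_num_den am.2) divfK.
Qed.

Lemma mass_from_bounds c l : {subset l <= s} -> \sum_(am <- l) am.2 = 1 ->
  0 <= mass_from Z c l <= Z.
Proof.
move=> ls h; rewrite mass_fromE; apply/andP; split.
  by rewrite big_seq; apply: sumr_ge0 => am /ls /smass_ge0 h0; rewrite mulr_ge0.
rewrite -[leRHS](smass_sum ls h) !big_seq; apply: ler_sum => am /ls /smass_ge0 h0; rewrite ler_piMr //.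
by rewrite lez_nat leq_b1.
Qed.

Lemma excess_from_ge0 c l : {subset l <= s} -> 0 <= excess_from Z c l.
Proof.
move=> ls; rewrite excess_fromE big_seq sumr_ge0 // => am /ls /smass_ge0 h0.
rewrite mulr_ge0 //; case: (leP c (sval Z am)) => h; last by rewrite mul0r.
by rewrite mul1r subr_ge0.
Qed.

End Scaling.

(** * Positional codes and their sums *)

Section MixedRadix.

Lemma exprz_nat (b e : nat) : Posz b ^+ e = Posz (b ^ e).
Proof. by rewrite -[Posz (b ^ e)]natz natrX natz. Qed.

Lemma digits_inj (b N : nat) (d d' : nat -> nat) :
  (forall c, d c < b)%N -> (forall c, d' c < b)%N ->
  (\sum_(c < N) d c * b ^ c = \sum_(c < N) d' c * b ^ c)%N ->
  forall c, (c < N)%N -> d c = d' c.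
Proof.
elim: N d d' => [|N ih] d d' hd hd' //.
rewrite !big_ord_recl /= !expn0 !muln1.
have E (e : nat -> nat) : (\sum_(i < N) e (bump 0 i) * b ^ bump 0 i =
    (\sum_(i < N) e i.+1 * b ^ i) * b)%N.
  by rewrite big_distrl; apply: eq_bigr => i _; rewrite /bump /= add1n expnS; ring.
have b0 : (0 < b)%N by apply: leq_ltn_trans (hd 0%N).
rewrite !E => e; have e0 : d 0%N = d' 0%N.
  move: (congr1 (fun x => x %% b)%N e).
  by rewrite ![(_ + _ * b)%N]addnC !modnMDl !modn_small.
move: e; rewrite e0 => /eqP; rewrite eqn_add2l eqn_pmul2r // => /eqP e.
by case=> // c hc; exact: (ih (fun c => d c.+1) (fun c => d' c.+1)).
Qed.

(* The digit q - 1 in base b of a sum of such codes counts the summands of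
   class q; class 0 is not recorded. *)
Definition class_code (b q : nat) : nat := (b ^ q %/ b)%N.

Lemma class_codeE b q : (1 < b)%N -> class_code b q = ((q != 0) * b ^ q.-1)%N.
Proof.
move=> b1; rewrite /class_code; case: q => [|q]; first by rewrite expn0 divn_small.
by rewrite expnS mulKn ?mul1n // ltnW.
Qed.

Lemma class_code_le b q h : (1 < b)%N -> (q <= h)%N -> (class_code b q <= b ^ h)%N.
Proof.
move=> b1 qh; rewrite /class_code (leq_trans (leq_div _ _)) //.
by rewrite leq_pexp2l // ltnW.
Qed.

(** Each positive class has at most as many elements as there are elements of nonzero class, hence
    fewer than b. The sum of the codes is therefore written in base b without carries, and its
    digits are the counts. *)
Lemma class_code_inj (I : finType) (S1 S2 : {set I}) (q : I -> nat) (b : nat) :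
  (1 < b)%N -> (\sum_(i in S1) (q i != 0) < b)%N -> (\sum_(i in S2) (q i != 0) < b)%N ->
  (\sum_(i in S1) class_code b (q i) = \sum_(i in S2) class_code b (q i))%N ->
  forall c, (0 < c)%N -> (\sum_(i in S1) (q i == c) = \sum_(i in S2) (q i == c))%N.
Proof.
move=> b1 h1 h2 e; pose N := (\max_i q i).+1.
have qN i : (q i < N)%N by rewrite ltnS leq_bigmax.
have E (S : {set I}) : (\sum_(i in S) class_code b (q i) =
    \sum_(c < N) (\sum_(i in S) (q i == c.+1)) * b ^ c)%N.
  under [RHS]eq_bigr => c _ do rewrite big_distrl.
  rewrite exchange_big; apply: eq_bigr => i _; rewrite class_codeE //=.
  case: (posnP (q i)) => [->|q0]; first by rewrite mul0n big1.
  have hq : ((q i).-1 < N)%N by rewrite prednK // ltnW // qN.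
  rewrite (bigD1 (Ordinal hq)) //= prednK // eqxx big1 ?addn0 // => c.
  by rewrite -val_eqE /= => hc; case: eqP => // hqc; case/eqP: hc; rewrite hqc.
have L (S : {set I}) c : (0 < c)%N ->
    (\sum_(i in S) (q i == c) <= \sum_(i in S) (q i != 0))%N.
  by move=> c0; apply: leq_sum => i _; case: eqP => // ->; rewrite -lt0n c0.
have B (S : {set I}) : (\sum_(i in S) (q i != 0) < b)%N ->
    forall c, (\sum_(i in S) (q i == c.+1) < b)%N.
  by move=> h c; apply: leq_ltn_trans h; exact: L.
move: e; rewrite !E => e c c0; case: (ltnP c N) => hc; last first.
  by rewrite !big1 // => i _; rewrite ltn_eqF // (leq_trans (qN i)).
rewrite -(prednK c0); apply: (digits_inj (B _ h1) (B _ h2) e).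
by rewrite prednK // ltnW.
Qed.

(* Horner evaluation of the digits x r, y r, ..., x 1, y 1 in radix B. *)
Fixpoint mix (B : int) (x y : nat -> int) (r : nat) (w : int) : int :=
  if r is r'.+1 then mix B x y r' ((w * B + x r) * B + y r) else w.

Lemma radix_inj (B u u' x x' : int) : 0 <= x < B -> 0 <= x' < B ->
  u * B + x = u' * B + x' -> u = u' /\ x = x'.
Proof.
move=> hx hx' e; have B0 : B != 0 by lia.
have uu : u = u'.
  have := congr1 (fun t => (t %/ B)%Z) e.
  by rewrite !divzMDl // !divz_small ?addr0 // ?gtz0_abs; lia.
by split=> //; move: e; rewrite uu => /addrI.
Qed.

(** [mix] is linear in its digits with the same radix for all i, so the sum of the codes is the code
    of the digit sums; these stay below B for every set and are therefore determined by it. *)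
Lemma mix_inj (I : finType) (S1 S2 : {set I}) (B : int) (x y : I -> nat -> int) r
    (u : I -> int) :
  (forall (S : {set I}) j, 0 <= \sum_(i in S) x i j < B) ->
  (forall (S : {set I}) j, 0 <= \sum_(i in S) y i j < B) ->
  \sum_(i in S1) mix B (x i) (y i) r (u i) = \sum_(i in S2) mix B (x i) (y i) r (u i) ->
  \sum_(i in S1) u i = \sum_(i in S2) u i /\
  forall j, (0 < j <= r)%N ->
    \sum_(i in S1) x i j = \sum_(i in S2) x i j /\
    \sum_(i in S1) y i j = \sum_(i in S2) y i j.
Proof.
move=> hx hy; elim: r u => [|r ih] u /= e; first by split=> // -[].
have [] := ih _ e; rewrite !big_split -!mulr_suml !big_split -!mulr_suml /=.
move=> /radix_inj -/(_ (hy _ _) (hy _ _)) [] /radix_inj -/(_ (hx _ _) (hx _ _)) [e1 e2] e3 h.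
split=> // j /andP[j0]; rewrite leq_eqVlt => /orP[/eqP -> //|jr].
by apply: h; rewrite j0.
Qed.

Lemma mix_bound (B : int) (x y : nat -> int) r w e :
  (forall j, 0 <= x j < B) -> (forall j, 0 <= y j < B) -> 0 <= w < B ^+ e ->
  0 <= mix B x y r w < B ^+ (e + r.*2).
Proof.
move=> hx hy; elim: r w e => [|r ih] w e /= hw; first by rewrite addn0.
rewrite doubleS -addSnnS -addSnnS; apply: ih; rewrite !exprS.
have := hx r.+1; have := hy r.+1; move: (x _) (y _) (B ^+ e) hw => X Y P.
by move=> /andP[? ?] /andP[? ?] /andP[? ?]; apply/andP; split; nia.
Qed.

End MixedRadix.

(** * Evaluation of Bernoulli sums with packed integers *)

Section ExactValue.

(** Kronecker substitution: the values g 0, ..., g (k - 1) are the base-Y digits of one integer, so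
    that a step on the whole function costs a few integer operations. *)
Definition pack (Y : int) (k : nat) (g : nat -> int) : int :=
  \sum_(x < k) g x * Y ^+ x.

Definition pack_step (Z Y P H : int) : int := (Z - P) * H + P * (H %/ Y)%Z.

(** An item outside the set gets mass 0 instead of being skipped: every item contributes one factor
    Z, and the results for all sets carry the same scale Z ^ n. *)
Definition item_step (K : nat) (Z Y c H : int) (lb : seq (rat * rat) * bool) : int :=
  pack_step Z Y (mass_from K Z c lb.1 * Posz lb.2) H.

Fixpoint pack_init (k : nat) (Y : int) (r : nat) (H : int) : int :=
  if r is r'.+1 then pack_init k Y r' (Posz k.+1 - Posz r + Y * H) else H.

(** A branch-free minimum: the least scaled atom above [cur], or [big] when none is left. *)
Definition next_value (K : nat) (Z big cur : int) (s : seq (rat * rat)) : int :=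
  foldl (fun acc am => acc + Posz (cur + 1 <= sval K Z am)%R *
     Posz (sval K Z am <= acc)%R * (sval K Z am - acc)) big s.

Definition shortfall (K : nat) (Z Y H0 c : int) (zs : seq (seq (rat * rat) * bool)) : int :=
  let H := foldl (item_step K Z Y c) H0 zs in H - (H %/ Y)%Z * Y.

(** One slab of the integral of E min(k, N(t)) over t: between consecutive atoms the count is
    constant, and [top] minus [shortfall] is Z ^ n E min(k, N) at the upper end. *)
Definition value_step (K : nat) (Z big Y H0 top : int) (s : seq (rat * rat))
    (zs : seq (seq (rat * rat) * bool)) (cv : int * int) : int * int :=
  let nx := next_value K Z big cv.1 s in
  (nx, cv.2 + (nx - cv.1) * (top - shortfall K Z Y H0 nx zs)).

(** The fold over [s] is a clock. A round passes at least one atom value as long as some are left,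
    and rounds past the last atom add 0 because no variable reaches [big]. *)
Definition set_value (K : nat) (Z big Y H0 top : int) (s : seq (rat * rat))
    (zs : seq (seq (rat * rat) * bool)) : int :=
  (foldl (fun cv _ => value_step K Z big Y H0 top s zs cv) (0, 0) s).2.

Lemma pack_recl Y k g : pack Y k.+1 g = g 0%N + Y * pack Y k (fun x => g x.+1).
Proof.
rewrite /pack big_ord_recl expr0 mulr1 mulr_sumr; congr (_ + _).
by apply: eq_bigr => i _; rewrite /= exprS; ring.
Qed.

Lemma pack_recr Y k g : pack Y k.+1 g = pack Y k g + g k * Y ^+ k.
Proof. by rewrite /pack big_ord_recr. Qed.

Lemma pack_div Y k g : 0 <= g 0%N < Y -> g k = 0 ->
  (pack Y k g %/ Y)%Z = pack Y k (fun x => g x.+1).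
Proof.
move=> hg gk; have Y0 : Y != 0 by lia.
case: k gk => [|k] gk; first by rewrite /pack !big_ord0 div0z.
rewrite pack_recl addrC mulrC divzMDl // divz_small; last by lia.
by rewrite addr0 pack_recr gk mul0r addr0.
Qed.

Lemma pack_mod Y k g : (0 < k)%N -> 0 <= g 0%N < Y -> g k = 0 ->
  pack Y k g - (pack Y k g %/ Y)%Z * Y = g 0%N.
Proof.
move=> k0 hg gk; rewrite pack_div //; case: k k0 gk => // k _ gk.
by rewrite pack_recl pack_recr gk; ring.
Qed.

(** Dividing by Y drops g 0 and shifts the other digits; the digit that would enter on top is g k =
    0. *)
Lemma pack_stepE Z Y P k g : 0 <= g 0%N < Y -> g k = 0 ->
  pack_step Z Y P (pack Y k g) = pack Y k (fun x => (Z - P) * g x + P * g x.+1).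
Proof.
move=> hg gk; rewrite /pack_step pack_div // /pack !mulr_sumr -big_split.
by apply: eq_bigr => i _ /=; ring.
Qed.

Lemma pack_initE k Y : pack_init k Y k 0 = pack Y k (fun x => Posz (k - x)).
Proof.
have E r : (r <= k)%N -> pack_init k Y r (pack Y (k - r) (fun x => Posz (k - r - x))) =
    pack Y k (fun x => Posz (k - x)).
  elim: r => [|r ih] hr; first by rewrite /= subn0.
  rewrite -[RHS](ih (ltnW hr)) /=; congr pack_init.
  rewrite -[(k - r)%N in RHS](subnSK hr) pack_recl subnSK // subn0.
  congr (_ + _ * _); first by lia.
  by apply: eq_bigr => i _; congr (Posz _ * _); lia.
by have := E k (leqnn k); rewrite subnn /pack big_ord0.
Qed.

Lemma pack_ge0 Y k g : 0 <= Y -> (forall x, 0 <= g x) -> 0 <= pack Y k g.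
Proof.
by move=> Y0 g0; apply: sumr_ge0 => i _; rewrite mulr_ge0 ?exprn_ge0.
Qed.

Lemma pack_lt Y k g : (forall x, 0 <= g x < Y) -> pack Y k g < Y ^+ k.
Proof.
move=> hg; elim: k => [|k ih]; first by rewrite /pack big_ord0 expr0.
rewrite pack_recr exprS; have := hg k; move: ih; set a := pack Y k g.
by have : 0 < Y ^+ k; [apply: exprn_gt0; have := hg 0%N; lia|nia].
Qed.

Section Fold.
Variables (R : realType) (K k : nat) (Z Y c : int) (k0 : (0 < k)%N).
Hypothesis Z0 : 0 < Z.

Definition zprob (lb : seq (rat * rat) * bool) : R :=
  (mass_from K Z c lb.1 * Posz lb.2)%:~R / Z%:~R.

(** After t items the digit at x is Z ^ t times the expectation of the positive part of k - x minus
    the count of these items. The digits stay at most k Z ^ N < Y, so none overflows. *)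
Lemma fold_item_step zs (N : nat) :
  (forall lb, lb \in zs -> 0 <= mass_from K Z c lb.1 <= Z) ->
  (size zs <= N)%N -> Posz k * Z ^+ N < Y ->
  exists g : nat -> int,
  [/\ foldl (item_step K Z Y c) (pack Y k (fun x => Posz (k - x))) zs = pack Y k g,
      g k = 0, forall x, 0 <= g x <= Posz k * Z ^+ (size zs) &
      (g 0%N)%:~R = Z%:~R ^+ (size zs) *
        pexp (fun x => (k - x)%:R) (\prod_(lb <- zs) bern (zprob lb)) ].
Proof.
move=> hzs hN hY.
(* The induction needs every digit, not only the one at 0, since a step mixes the digits at x and x
   + 1. *)
have : exists g : nat -> int,
  [/\ foldl (item_step K Z Y c) (pack Y k (fun x => Posz (k - x))) zs = pack Y k g,
      forall x, (k <= x)%N -> g x = 0, forall x, 0 <= g x <= Posz k * Z ^+ (size zs) &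
      forall x, (g x)%:~R = Z%:~R ^+ (size zs) *
        pexp (fun y => (k - (y + x))%:R) (\prod_(lb <- zs) bern (zprob lb)) ].
  elim/last_ind: zs hzs hN => [|zs lb ih] hzs hN.
    exists (fun x => Posz (k - x)); split=> //=.
    - by move=> x hx; apply/eqP; rewrite eqz_nat subn_eq0.
    - by move=> x; rewrite expr0 mulr1 !lez_nat leq_subr.
    - by move=> x; rewrite expr0 mul1r big_nil pexp1 add0n.
  rewrite size_rcons in hN.
  have [lb' h|g [e gk gb gr]] := ih _ (ltnW hN); first by apply: hzs; rewrite mem_rcons inE h orbT.
  pose P := mass_from K Z c lb.1 * Posz lb.2.
  have hP : 0 <= P <= Z.
    have := hzs lb; rewrite mem_rcons mem_head => /(_ isT); rewrite /P.
    by case: (lb.2); rewrite ?mulr1 ?mulr0 //; lia.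
  have hz : zprob lb = P%:~R / Z%:~R by [].
  have hs H : item_step K Z Y c H lb = pack_step Z Y P H by [].
  clearbody P.
  exists (fun x => (Z - P) * g x + P * g x.+1).
  have gY : 0 <= g 0%N < Y.
    have /andP[-> h] := gb 0%N; apply: le_lt_trans h _; apply: le_lt_trans hY.
    by rewrite ler_wpM2l // ler_weXn2l ?(ltnW hN); lia.
  split.
  - by rewrite -cats1 foldl_cat /= e hs pack_stepE // gk.
  - by move=> x hx; rewrite !gk ?(leqW hx) //; ring.
  - move=> x; rewrite size_rcons exprS; have := gb x; have := gb x.+1.
    move: (g x) (g x.+1) (Z ^+ _) => u v w; move: hP; nia.
  - move=> x; rewrite size_rcons.
    have Zr : (Z%:~R : R) != 0 by rewrite intr_eq0; lia.
    have -> : \prod_(i <- rcons zs lb) bern (zprob i) =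
        bern (zprob lb) * \prod_(i <- zs) bern (zprob i).
      by rewrite -cats1 big_cat big_seq1 mulrC.
    rewrite pexp_bernM rmorphD !rmorphM /= !gr rmorphB /=.
    under [X in _ = _ * X]eq_pexp => y do rewrite addSnnS.
    rewrite [X in _ = _ * X]pexpDf !pexpZf exprS hz.
    by field.
case=> g [e gk gb gr]; exists g; split=> //; first exact: gk.
by rewrite gr; congr (_ * _); apply: eq_pexp => y; rewrite addn0.
Qed.

End Fold.
End ExactValue.

Lemma count_lt (T : eqType) (a b : pred T) (s : seq T) (y : T) :
  (forall x, a x -> b x) -> y \in s -> b y -> ~~ a y ->
  (count a s < count b s)%N.
Proof.
move=> ab ys yb ya; have /permP ps := perm_to_rem ys.
by rewrite !ps /= yb (negbTE ya) ltnS sub_count.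
Qed.

(** * Exact value of a set *)

Section SetValue.
Variables (R : realType) (n k K : nat) (X : 'I_n -> seq (rat * rat)).
Hypotheses (k0 : (0 < k)%N) (K0 : (0 < K)%N) (hX : forall i, nonneg_dist (X i)).

Definition all_atoms : seq (rat * rat) := flatten [seq X i | i <- enum 'I_n].
Let s := all_atoms.
Let Z := common_den s.
Let scale : R := K%:R * Z%:~R ^+ 2.
Let D i := real_dist R (X i).

Lemma mem_all_atoms am : reflect (exists i, am \in X i) (am \in s).
Proof.
apply: (iffP flatten_mapP) => [[i _ h]|[i h]]; first by exists i.
by exists i; rewrite ?mem_enum.
Qed.

Lemma sub_all_atoms i : {subset X i <= s}.
Proof. by move=> am h; apply/mem_all_atoms; exists i. Qed.

Lemma all_atoms_nonneg : {in s, forall am, nonneg_atom am}.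
Proof. by move=> am /mem_all_atoms[i h]; exact: (hX i).1. Qed.

Lemma Z_gt0 : 0 < Z.
Proof. exact: common_den_gt0 all_atoms_nonneg. Qed.

Lemma D_dist i : is_dist (D i).
Proof.
have [h1 h2] := hX i; split.
  move=> am /mapP[bm /h1 [h3 h4] ->] /=.
  by rewrite !ler0q.
rewrite /D /real_dist big_map /=.
by rewrite -(rmorph_sum (@ratr R)) /= h2 rmorph1.
Qed.

Definition tagged_items (S : {set 'I_n}) : seq (seq (rat * rat) * bool) :=
  [seq (X i, i \in S) | i <- enum 'I_n].

Lemma size_tagged_items S : size (tagged_items S) = n.
Proof. by rewrite size_map size_enum_ord. Qed.

Lemma mass_item_bounds c i : 0 <= mass_from K Z c (X i) <= Z.
Proof.
apply: (mass_from_bounds K all_atoms_nonneg); first exact: sub_all_atoms.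
exact: (hX i).2.
Qed.

Lemma prod_tagged_items S c :
  \prod_(lb <- tagged_items S) bern (zprob R K Z c lb) = count_poly D S (c%:~R / scale).
Proof.
rewrite /tagged_items big_map big_enum /count_poly [RHS]big_mkcond /=.
apply: eq_bigr => i _; rewrite /zprob /=; case: (i \in S); last by rewrite mulr0 mul0r bern0.
rewrite mulr1 mass_from_real //; [|exact: all_atoms_nonneg|exact: sub_all_atoms].
by rewrite mulrC mulKf // intr_eq0 gt_eqF // Z_gt0.
Qed.

Let Y : int := Posz k * Z ^+ n + 1.
Let top : int := Posz k * Z ^+ n.
Let H0 : int := pack_init k Y k 0.
Let big : int := Posz K * (Z * Z * Z).

Lemma shortfallE S c :
  (top - shortfall K Z Y H0 c (tagged_items S))%:~R =
  Z%:~R ^+ n * level_mean k D S (c%:~R / scale) :> R.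
Proof.
have [|||g [e gk gb gr]] := @fold_item_step R K k Z Y c k0 Z_gt0 (tagged_items S) n.
- by move=> lb /mapP[i _ ->]; exact: mass_item_bounds.
- by rewrite size_tagged_items.
- by rewrite /Y ltzD1.
rewrite /shortfall /H0 pack_initE e pack_mod //; last first.
  by have := gb 0%N; rewrite size_tagged_items /Y ltzD1.
rewrite rmorphB /= gr size_tagged_items prod_tagged_items /level_mean.
have hc : prob_poly (count_poly D S (c%:~R / scale)).
  by apply: prob_poly_prod => i _; apply: prob_bern; apply: tailp_01; exact: D_dist.
rewrite (_ : top%:~R = k%:R * Z%:~R ^+ n :> R); last first.
  by rewrite /top rmorphM /= rmorphXn /= pmulrn.
rewrite [k%:R * _]mulrC -{1}(pexp_cst k%:R hc) -mulrBr; congr (_ * _).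
rewrite -[- pexp _ _]mulN1r -pexpZf -pexpDf; apply: eq_pexp => l.
case: (leqP k l) => h; first by rewrite min_l ?ler_nat // (eqP (_ : k - l == 0)%N) ?subn_eq0 //; ring.
by rewrite min_r ?ler_nat ?(ltnW h) // natrB ?(ltnW h) //; ring.
Qed.

Lemma next_valueP cur : cur <= big ->
  [/\ cur <= next_value K Z big cur s <= big,
      forall am, am \in s -> cur < sval K Z am -> next_value K Z big cur s <= sval K Z am &
      next_value K Z big cur s = big \/
      exists2 am, am \in s & next_value K Z big cur s = sval K Z am /\ cur < sval K Z am].
Proof.
move=> hc; suff gen t : {subset t <= s} ->
    [/\ cur <= next_value K Z big cur t <= big,
      forall am, am \in t -> cur < sval K Z am -> next_value K Z big cur t <= sval K Z am &
      next_value K Z big cur t = big \/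
      exists2 am, am \in s & next_value K Z big cur t = sval K Z am /\ cur < sval K Z am].
  exact: gen.
elim/last_ind: t => [|t am ih] sub.
  by rewrite /next_value; split=> //; [rewrite hc lexx|left].
have [am' h|h1 h2 h3] := ih; first by apply: sub; rewrite mem_rcons inE h orbT.
have ams : am \in s by apply: sub; rewrite mem_rcons mem_head.
rewrite /next_value foldl_rcons -/(next_value K Z big cur t).
move: h1 h2 h3; set a := next_value _ _ _ _ _ => h1 h2 h3.
have -> : a + Posz (cur + 1 <= sval K Z am)%R * Posz (sval K Z am <= a)%R *
   (sval K Z am - a) = if (cur < sval K Z am) && (sval K Z am <= a) then sval K Z am else a.
  by rewrite lezD1; case: (cur < _); case: (_ <= a); rewrite /=; lia.
case: ifP => h; split.
- lia.
- move=> bm; rewrite mem_rcons inE => /orP[/eqP -> //|hb] hlt.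
  have := h2 bm hb hlt; lia.
- by right; exists am => //; split=> //; case/andP: h.
- lia.
- move=> bm; rewrite mem_rcons inE => /orP[/eqP -> hlt|hb]; last exact: h2.
  by move: h; rewrite hlt /= leNgt => /negbT; rewrite negbK; exact: ltW.
- exact: h3.
Qed.

Lemma set_value_real S :
  (set_value K Z big Y H0 top s (tagged_items S))%:~R =
  Z%:~R ^+ n * scale * exp_top k D S.
Proof.
(* Loop invariant: the accumulated value is the scaled expected top-k sum of the variables truncated
   at the current level. *)
pose tr (c : int) : R := expect D (top_map k S (fun v => Num.min v (c%:~R / scale))).
pose step cv := value_step K Z big Y H0 top s (tagged_items S) cv.
have sc0 : 0 < scale := scale_gt0 all_atoms_nonneg R K0.
pose good (cv : int * int) := [/\ 0 <= cv.1, cv.1 <= big &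
   cv.2%:~R = Z%:~R ^+ n * scale * tr cv.1].
(* Potential: the atoms still above the level. It drops in every round until it is 0, so [size s]
   rounds leave none. *)
pose left c := count (fun am => c < sval K Z am) s.
have atomP x i : (forall i, x i \in [seq am.1 | am <- D i]) ->
    exists2 am, am \in s & x i = ratr am.1.
  move=> /(_ i) /mapP[bm /mapP[am h ->] ->]; exists am => //.
  by apply/mem_all_atoms; exists i.
have stepP cv : good cv -> good (step cv) /\ (left (step cv).1 <= (left cv.1).-1)%N.
  case: cv => cur val [/= c0 cb cv].
  have [/andP[h1 h1'] h2 h3] := next_valueP cb.
  rewrite /step /value_step /=; set nx := next_value K Z big cur s in h1 h1' h2 h3 *.
  split; first split => //=.
  - exact: le_trans c0 h1.
  - rewrite rmorphD rmorphM /= cv shortfallE rmorphB /=.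
    have -> : tr nx = tr cur + (nx%:~R - cur%:~R) / scale * level_mean k D S (nx%:~R / scale).
      rewrite /tr /level_mean -(expect_count _ _ (fun l => Num.min k%:R l%:R) D_dist).
      rewrite -expectZ -expectD; apply: eq_expect => x hx.
      rewrite -natr_min -top_map_ind -top_mapZ -top_mapD; apply: eq_top_map => i _.
      have [am ams ->] := atomP x i hx.
      have -> : ratr am.1 = (sval K Z am)%:~R / scale.
        by rewrite (sval_real K all_atoms_nonneg) // mulrC mulKf // gt_eqF.
      (* No atom lies strictly between [cur] and [nx]: raising the truncation gains either nothing
         or the full slab. *)
      rewrite -!minr_pMl ?invr_ge0 ?(ltW sc0) // ler_pM2r ?invr_gt0 // ler_int.
      case: (leP (sval K Z am) cur) => hv.
        have -> : (nx <= sval K Z am) = (nx == cur) && (cur == sval K Z am) by lia.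
        rewrite !min_l ?ler_int //; last exact: le_trans hv h1.
        by case: eqP => [->|_]; rewrite ?subrr ?mul0r ?mulr0 ?mul0r ?addr0.
      have hn := h2 am ams hv; rewrite hn mulr1.
      rewrite [Num.min _ nx%:~R]min_r ?ler_int // min_r ?ler_int ?(ltW hv) //.
      by ring.
    by field; rewrite gt_eqF.
  - case: h3 => [->|[am ams [e hlt]]].
      rewrite (_ : left big = 0%N) //; apply/eqP; rewrite -leqn0 leqNgt -has_count.
      apply/hasPn => am ams; rewrite -leNgt ltW //; exact: (sval_lt all_atoms_nonneg).
    have sublt : (left nx < left cur)%N; last by rewrite -ltnS prednK // (leq_ltn_trans _ sublt).
    apply: (count_lt (y := am)) => //; rewrite ?e ?ltxx //.
    by move=> bm; rewrite -e; exact: le_lt_trans h1.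
have iterP t cv : good cv ->
    good (foldl (fun cv _ => step cv) cv t) /\
    (left (foldl (fun cv _ => step cv) cv t).1 <= left cv.1 - size t)%N.
  elim: t cv => [|x t ih] cv h /=; first by rewrite subn0.
  have [h1 h2] := stepP cv h; have [h3 h4] := ih _ h1; split=> //.
  by apply: leq_trans h4 _; lia.
have good0 : good (0, 0).
  split=> //=; first by rewrite /big !mulr_ge0 // ltW // Z_gt0.
  rewrite /tr (eq_expect (g := fun=> 0)) ?expect0 ?mulr0 // => x hx.
  rewrite /top_map big1_seq // => v /mem_top[i _ ->].
  have [am ams ->] := atomP x i hx; rewrite mul0r min_r // ler0q.
  by have [] := all_atoms_nonneg ams.
have [[h1 h2 h3] h4] := iterP _ s _ good0.
rewrite /set_value -/step h3; congr (_ * _).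
apply: eq_expect => x hx; rewrite top_sumE; apply: eq_top_map => i _.
have [am ams ->] := atomP x i hx; rewrite min_l //.
rewrite ler_pdivlMr // mulrC -(sval_real K all_atoms_nonneg) // ler_int leNgt.
have : (left (foldl (fun cv _ => step cv) (0, 0)%R s).1 <= 0)%N.
  by apply: leq_trans h4 _; rewrite leqn0 subn_eq0 count_size.
by rewrite leqNgt -has_count => /hasPn /(_ am ams).
Qed.

End SetValue.

(** * Query weights *)

Section Weights.
Variables (n k m h b : nat).
Let L := (m ^ 2)%N.
Let K := (m * k.+1)%N.

(** One bound for the three kinds of coordinates, n L h for the levels, b ^ h for the classes and n
    k m for the tails ([code_le_max]). It does not involve the atoms. *)
Definition coord_max : nat := (n * (k * L * h * b ^ h))%N.
Definition radix : nat := (n * coord_max).+1.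

Definition level_code (Z sigma : int) (l : seq (rat * rat)) (j : nat) : int :=
  (mass_from K Z (Posz j * sigma) l * Posz (n * L * h) %/ Z)%Z.

Definition level_class (Z sigma : int) (l : seq (rat * rat)) (j : nat) : int :=
  Posz (class_code b (`|level_code Z sigma l j| %/ (n * L))).

(** The added term makes a branch-free minimum with [coord_max]. It keeps the weights small at
    unsuitable scales and is inactive at suitable ones ([tail_code_real]). *)
Definition tail_code (Z sigma : int) (l : seq (rat * rat)) : int :=
  let x := (Posz n * excess_from K Z (Posz L * sigma) l %/ (sigma * Z))%Z in
  x + Posz (Posz coord_max <= x)%R * (Posz coord_max - x).

Definition weight (Z sigma : int) (l : seq (rat * rat)) : int :=
  mix (Posz radix) (level_code Z sigma l) (level_class Z sigma l) L
    (tail_code Z sigma l).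

Variables (R : realType) (X : 'I_n -> seq (rat * rat)).
Hypotheses (n0 : (0 < n)%N) (k0 : (0 < k)%N) (m1 : (1 < m)%N) (h0 : (0 < h)%N)
  (b1 : (1 < b)%N) (hX : forall i, nonneg_dist (X i)).
Let Z := common_den (all_atoms X).
Let D i := real_dist R (X i).

Let L0 : (0 < L)%N.
Proof. by rewrite /L expn_gt0 ltnW. Qed.

Let K0 : (0 < K)%N.
Proof. by rewrite /K muln_gt0 ltnW. Qed.

Let bh0 : (0 < b ^ h)%N.
Proof. by rewrite expn_gt0 ltnW. Qed.

Let Z0 : 0 < Z.
Proof. exact: Z_gt0. Qed.

Lemma level_code_bounds sigma i j : 0 <= level_code Z sigma (X i) j <= Posz (n * L * h).
Proof.
have /andP[h1 h2] := mass_item_bounds K hX (Posz j * sigma) i.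
rewrite /level_code divz_ge0 // mulr_ge0 //=.
rewrite -ltzD1 ltz_divLR // mulrDl mul1r [Posz _ * Z]mulrC.
apply: (@le_lt_trans _ _ (Z * Posz (n * L * h))); first by rewrite ler_wpM2r.
by rewrite ltrDl.
Qed.

Lemma code_le_max : (n * L * h <= coord_max)%N /\ (b ^ h <= coord_max)%N /\
  (n * (k * m) <= coord_max)%N.
Proof.
have mL : (m <= L)%N by rewrite /L; nia.
rewrite /coord_max; move: L mL L0 => l ml l0; split; [|split].
- rewrite -mulnA leq_mul2l; apply/orP; right.
  by apply: leq_trans (leq_pmulr _ bh0); rewrite leq_mul2r leq_pmull ?orbT.
- by rewrite mulnA leq_pmull // muln_gt0 n0 muln_gt0 h0 muln_gt0 k0 l0.
- rewrite leq_mul2l -!mulnA leq_mul2l; apply/orP; right; apply/orP; right.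
  by apply: leq_trans ml _; rewrite leq_pmulr // muln_gt0 h0.
Qed.

Lemma level_quo_le sigma i j : (`|level_code Z sigma (X i) j| %/ (n * L) <= h)%N.
Proof.
have /andP[h1 h2] := level_code_bounds sigma i j.
have hle : (`|level_code Z sigma (X i) j| <= h * (n * L))%N by lia.
by apply: leq_trans (leq_div2r _ hle) _; rewrite mulnK // muln_gt0 n0.
Qed.

Lemma level_class_bounds sigma i j :
  0 <= level_class Z sigma (X i) j <= Posz coord_max.
Proof.
rewrite /level_class lez_nat /= (leq_trans _ code_le_max.2.1) // class_code_le //.
exact: level_quo_le.
Qed.

Lemma tail_code_bounds sigma i : 0 < sigma ->
  0 <= tail_code Z sigma (X i) <= Posz coord_max.
Proof.
move=> s0; rewrite /tail_code.
have : 0 <= (Posz n * excess_from K Z (Posz L * sigma) (X i) %/ (sigma * Z))%Z.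
  rewrite divz_ge0 ?mulr_gt0 // mulr_ge0 //.
  by apply: (excess_from_ge0 _ (all_atoms_nonneg hX)); exact: sub_all_atoms.
by move: (_ %/ _)%Z => x; case: (leP (Posz coord_max) x) => /=; lia.
Qed.

Lemma radix_gt (S : {set 'I_n}) (f : 'I_n -> int) :
  (forall i, 0 <= f i <= Posz coord_max) -> 0 <= \sum_(i in S) f i < Posz radix.
Proof.
move=> hf; rewrite sumr_ge0 /=; last by move=> i _; case/andP: (hf i).
apply: (@le_lt_trans _ _ (\sum_(i in S) Posz coord_max)).
  by apply: ler_sum => i _; case/andP: (hf i).
rewrite sumr_const -mulr_natr -[(_)%:R]/(#|S|%:R) natz -PoszM ltz_nat /radix ltnS mulnC.
by rewrite leq_mul2r -[X in (_ <= X)%N]card_ord max_card orbT.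
Qed.

Lemma le_coord_max_radix : (coord_max < radix)%N.
Proof. by rewrite /radix ltnS leq_pmull. Qed.

Lemma weight_bounds sigma i : 0 < sigma ->
  0 <= weight Z sigma (X i) < Posz radix ^+ L.*2.+1.
Proof.
move=> s0; rewrite -add1n; apply: mix_bound => [j|j|]; rewrite ?expr1.
- have /andP[h1 h2] := level_code_bounds sigma i j.
  by have := code_le_max; have := le_coord_max_radix; lia.
- have /andP[h1 h2] := level_class_bounds sigma i j.
  by have := le_coord_max_radix; lia.
- by have := tail_code_bounds i s0; have := le_coord_max_radix; lia.
Qed.

Let scale : R := K%:R * Z%:~R ^+ 2.

Let scale0 : 0 < scale.
Proof. exact: (scale_gt0 (all_atoms_nonneg hX)). Qed.

Lemma level_code_real sigma i j :
  ((`|level_code Z sigma (X i) j|)%N%:R : R) <=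
     tailp (D i) ((Posz j * sigma)%:~R / scale) * (n * L * h)%:R <
  ((`|level_code Z sigma (X i) j|)%N.+1%:R : R).
Proof.
have /andP[h1 _] := level_code_bounds sigma i j.
have Zr : 0 < Z%:~R :> R by rewrite ltr0z.
have -> : tailp (D i) ((Posz j * sigma)%:~R / scale) * (n * L * h)%:R =
  (mass_from K Z (Posz j * sigma) (X i) * Posz (n * L * h))%:~R / Z%:~R.
  rewrite [in RHS]rmorphM /= (mass_from_real (all_atoms_nonneg hX)) //; last exact: sub_all_atoms.
  by rewrite -/Z -/scale pmulrn; field; rewrite gt_eqF.
rewrite -natr1 pmulrn gez0_abs // ler_pdivlMr // ltr_pdivrMr //.
rewrite -[1]/(1%:~R) -intrD -!intrM ler_int ltr_int /level_code.
by rewrite lez_floor ?gt_eqF //= ltz_ceil.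
Qed.

(** An excess of at most k m theta amounts to at most n k m units theta / n, which does not exceed
    the cap. *)
Lemma tail_code_real sigma i : 0 < sigma ->
  excess (D i) ((Posz L * sigma)%:~R / scale) <= (k * m)%:R * (sigma%:~R / scale) ->
  ((tail_code Z sigma (X i))%:~R : R) <=
    excess (D i) ((Posz L * sigma)%:~R / scale) * (n%:R / (sigma%:~R / scale)) <
  ((tail_code Z sigma (X i))%:~R + 1 : R).
Proof.
move=> s0 hex.
have Zr : 0 < Z%:~R :> R by rewrite ltr0z.
have sr : 0 < sigma%:~R :> R by rewrite ltr0z.
have nr : 0 < n%:R :> R by rewrite ltr0n.
have sZ : 0 < sigma * Z by rewrite mulr_gt0.
set E := excess _ _ in hex *.
set num := Posz n * excess_from K Z (Posz L * sigma) (X i).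
have eE : E * (n%:R / (sigma%:~R / scale)) = num%:~R / (sigma * Z)%:~R.
  rewrite /num [in RHS]rmorphM [(sigma * Z)%:~R]rmorphM /= (excess_from_real (all_atoms_nonneg hX)) //; last exact: sub_all_atoms.
  by rewrite -/Z -/scale -/(D i) -/E pmulrn; field; rewrite !gt_eqF.
have hx : (num %/ (sigma * Z))%Z <= Posz coord_max.
  rewrite -ltzD1 ltz_divLR // -(ltr_int R) [ltRHS]intrM -ltr_pdivrMr ?ltr0z //.
  rewrite -eE; apply: (@le_lt_trans _ _ (n * (k * m))%:R).
    rewrite natrM [leLHS]mulrCA ler_wpM2l ?ler0n // ler_pdivrMr ?divr_gt0 //.
  rewrite (_ : Posz coord_max + 1 = Posz coord_max.+1); last by lia.
  by rewrite -pmulrn ltr_nat ltnS; exact: code_le_max.2.2.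
have -> : tail_code Z sigma (X i) = (num %/ (sigma * Z))%Z.
  rewrite /tail_code -/num; move: hx; set x := (_ %/ _)%Z.
  by case: (leP (Posz coord_max) x) => /=; lia.
rewrite eE ler_pdivlMr ?ltr0z // ltr_pdivrMr ?ltr0z //.
rewrite -[1]/(1%:~R) -intrD -!intrM ler_int ltr_int.
by rewrite lez_floor ?gt_eqF //= ltz_ceil.
Qed.

(** Surplus decreases with the level while k c increases, so the inequality at T persists above
    T. *)
Lemma surplus_le (F : {set {set 'I_n}}) (T c : R) (S : {set 'I_n}) :
  is_surplus_threshold k D F T -> T <= c -> S \in F ->
  \sum_(i in S) excess (D i) c <= k%:R * c.
Proof.
move=> [T0 hT] Tc SF; apply: (@le_trans _ _ (k%:R * T)); last first.
  by rewrite ler_wpM2l ?ler0n.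
rewrite -hT; apply: (@le_trans _ _ (\sum_(i in S) expect D (fun x => Num.max (x i - T) 0))).
  apply: ler_sum => i _.
  rewrite (expect1 i (fun v => Num.max (v - T) 0)); last by move=> j; exact: D_dist.
  apply: le_mean; first exact: D_dist.
  by move=> x _; rewrite ge_max !le_max lexx orbT andbT lerD2l lerN2 Tc.
exact: (le_bigmax_cond (I := {set 'I_n}) (P := mem F) _
  (fun S => \sum_(i in S) expect D (fun x => Num.max (x i - T) 0)) SF).
Qed.

(** Equal weights mean equal digit sums: those of the levels feed [level_close] and those of the
    tails compare the excesses, so [exp_top_transfer] applies with eta = 6 / L. *)
Lemma weight_transfer (F : {set {set 'I_n}}) (T eps : R) (S1 S2 : {set 'I_n})
    (sigma : int) :
  0 < eps -> Lambda 4 k eps * L%:R <= h%:R -> Lambda 4 k eps * h%:R < b%:R ->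
  eps ^+ 2 <= 6 / L%:R -> 0 < sigma -> is_surplus_threshold k D F T ->
  T <= m%:R * (sigma%:~R / scale) -> S1 \in F -> S2 \in F ->
  \sum_(i in S1) weight Z sigma (X i) = \sum_(i in S2) weight Z sigma (X i) ->
  exp_top k D S1 <= exp_top k D S2 +
    sigma%:~R / scale * (2 * k%:R ^+ 2 + k%:R + 7).
Proof.
move=> e0 hL hb he s0 hT hm S1F S2F.
have sr : 0 < sigma%:~R :> R by rewrite ltr0z.
have Lr : 0 < L%:R :> R by rewrite ltr0n L0.
have nr : 0 < n%:R :> R by rewrite ltr0n.
have hD i : is_dist (D i) by exact: D_dist.
set theta := sigma%:~R / scale in hm *.
have t0 : 0 < theta by rewrite divr_gt0.
have levelE j : (Posz j * sigma)%:~R / scale = j%:R * theta.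
  by rewrite /theta intrM pmulrn mulrA.
move=> /mix_inj [S j|S j|].
- apply: radix_gt => i; have /andP[h1 h2] := level_code_bounds sigma i j.
  by have := code_le_max; lia.
- by apply: radix_gt => i; exact: level_class_bounds.
move=> eT eL.
have surp S : S \in F -> \sum_(i in S) excess (D i) (m%:R * theta) <= k%:R * (m%:R * theta).
  by move=> SF; exact: (surplus_le hT).
have ex0 i c : 0 <= excess (D i) c by apply: mean_ge0 => // x _; rewrite le_max lexx orbT.
have tailP S i : S \in F -> i \in S -> ((tail_code Z sigma (X i))%:~R : R) <=
    excess (D i) (L%:R * theta) * (n%:R / theta) < ((tail_code Z sigma (X i))%:~R + 1 : R).
  move=> SF iS; rewrite -levelE; apply: tail_code_real => //; rewrite levelE.
  rewrite natrM -mulrA; apply: le_trans (surp S SF); rewrite (bigD1 i) //=.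
  apply: (@le_trans _ _ (excess (D i) (m%:R * theta))); last first.
    by rewrite lerDl sumr_ge0.
  apply: le_mean => // x _; rewrite ge_max !le_max lexx orbT andbT lerD2l lerN2.
  by rewrite ler_pM2r // ler_nat /L -{1}[m]expn1 leq_pexp2l ?orTb // ltnW.
(* Here 7 = 1 + 6, the 6 being L levels at 6 / L each. *)
rewrite (_ : 2 * k%:R ^+ 2 + k%:R + 7 = 2 * k%:R ^+ 2 + k%:R + 1 + (m ^ 2)%:R * (6 / L%:R)); last first.
  by rewrite -/L [_%:R * (6 / _)]mulrC divfK ?gt_eqF //; ring.
apply: exp_top_transfer => //.
- move=> j jL; rewrite -levelE /level_mean /count_poly.
  have [e1 e2] := eL j.+1 jL.
  pose a i := `|level_code Z sigma (X i) j.+1|%N.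
  have aE i : level_code Z sigma (X i) j.+1 = Posz (a i).
    by rewrite /a gez0_abs //; case/andP: (level_code_bounds sigma i j.+1).
  have sumE S : \sum_(i in S) level_code Z sigma (X i) j.+1 = Posz (\sum_(i in S) a i).
    by rewrite -natz natr_sum; apply: eq_bigr => i _; rewrite aE natz.
  have sumC S : \sum_(i in S) level_class Z sigma (X i) j.+1 =
      Posz (\sum_(i in S) class_code b (a i %/ (n * L))).
    by rewrite -natz natr_sum; apply: eq_bigr => i _; rewrite natz.
  move: e1 e2; rewrite !sumE !sumC => -[e1] [e2].
  apply: (@level_close _ _ S1 S2 _ a n L h k eps) => //.
  + by rewrite card_ord.
  + by move=> i; exact: tailp_01.
  + by move=> i; exact: level_code_real.
  (* An element of nonzero class has a code of at least n L; below saturation there are at most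
     Lambda h < b such elements, so the class digits do not carry. *)
  have cnt (S : {set 'I_n}) : (\sum_(i in S) a i)%:R <= Lambda 4 k eps * (n * L * h)%:R ->
      (\sum_(i in S) (a i %/ (n * L) != 0) < b)%N.
    move=> hS; rewrite -(ltr_nat R); apply: le_lt_trans hb.
    have nL : 0 < (n * L)%:R :> R by rewrite ltr0n muln_gt0 n0 L0.
    rewrite -(ler_pM2r nL) (_ : _ * h%:R * _ = Lambda 4 k eps * (n * L * h)%:R); last first.
      by rewrite !natrM; ring.
    apply: le_trans hS.
    rewrite -natrM ler_nat big_distrl; apply: leq_sum => i _.
    case: (posnP (a i %/ (n * L))) => h1; rewrite /= ?mul0n // mul1n.
    by rewrite -[X in (X <= _)%N]mul1n -leq_divRL // muln_gt0 n0 L0.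
  move=> hu; apply: (class_code_inj b1 _ _ e2); apply: cnt => //.
  by rewrite -e1.
(* In units theta / n each of the at most n tail codes loses less than 1, together at most theta. *)
- have nt : 0 < n%:R / theta by rewrite divr_gt0.
  rewrite -/L -(ler_pM2r nt) mulrDl !mulr_suml.
  have -> : theta * (n%:R / theta) = n%:R by rewrite mulrC divfK ?gt_eqF.
  apply: (@le_trans _ _ (\sum_(i in S1) ((tail_code Z sigma (X i))%:~R + 1))).
    by apply: ler_sum => i iS; case/andP: (tailP _ _ S1F iS) => _ /ltW.
  rewrite big_split /= sumr_const lerD //.
    rewrite -(rmorph_sum intr) /= eT rmorph_sum; apply: ler_sum => i iS.
    by case/andP: (tailP _ _ S2F iS).
  by rewrite ler_nat -[X in (_ <= X)%N]card_ord max_card.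
- exact: surp.
Qed.

End Weights.

(** * The search program *)

Definition enc_atom (am : rat * rat) : value := VPair (enc_rat am.1) (enc_rat am.2).

Lemma runi_run p vs x t b : runi p vs x t b -> run p vs (VInt x) t.
Proof. by case. Qed.

Lemma run_onth vs i w t : onth vs i = Some w -> (i.*2.+1 <= t)%N -> run (var i) vs w t.
Proof. by move=> h1 h2; exact: run_le (run_var h1) h2. Qed.

Lemma foldl_flatten (A T : Type) (f : A -> T -> A) a (ss : seq (seq T)) :
  foldl f a (flatten ss) = foldl (foldl f) a ss.
Proof. by elim: ss a => //= s ss ih a; rewrite foldl_cat ih. Qed.

(* The numerator and denominator of the value and of the mass of the head of
   the list of atoms held by variable 0. *)
Definition num_v := fst_of (fst_of (fst_of (var 0))).
Definition den_v := snd_of (fst_of (fst_of (var 0))).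
Definition num_p := fst_of (snd_of (fst_of (var 0))).
Definition den_p := snd_of (snd_of (fst_of (var 0))).

Section Atoms.
Variables (kap : nat) (am : rat * rat) (rest : value) (vs : seq value).
Let vs' := VPair (enc_atom am) rest :: vs.

Definition small_atom : Prop :=
  [/\ (bitlen (numq am.1) <= kap)%N, (bitlen (denq am.1) <= kap)%N,
      (bitlen (numq am.2) <= kap)%N & (bitlen (denq am.2) <= kap)%N].
Hypothesis hs : small_atom.

Lemma run_num_v : runi num_v vs' (numq am.1) 7 kap.
Proof. by case: hs => h _ _ _; split=> //; do 3![eapply run_fst]; exact: run_var. Qed.

Lemma run_den_v : runi den_v vs' (denq am.1) 7 kap.
Proof. by case: hs => _ h _ _; split=> //; eapply run_snd; do 2![eapply run_fst]; exact: run_var. Qed.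

Lemma run_num_p : runi num_p vs' (numq am.2) 7 kap.
Proof. by case: hs => _ _ h _; split=> //; eapply run_fst; eapply run_snd; eapply run_fst; exact: run_var. Qed.

Lemma run_den_p : runi den_p vs' (denq am.2) 7 kap.
Proof. by case: hs => _ _ _ h; split=> //; do 2![eapply run_snd]; eapply run_fst; exact: run_var. Qed.

End Atoms.

(* [iZ] is the index of the variable holding Z. *)
Definition svalp (K iZ : nat) : prog :=
  bop OpDiv (bop OpMul (bop OpMul (PConst (Posz K)) (bop OpMul (var iZ) (var iZ))) num_v) den_v.

Definition smassp (iZ : nat) : prog := bop OpDiv (bop OpMul (var iZ) num_p) den_p.

Lemma run_svalp K iZ kap am rest vs Z : small_atom kap am ->
  onth (VPair (enc_atom am) rest :: vs) iZ = Some (VInt Z) -> (iZ <= 40)%N ->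
  (bitlen Z <= kap)%N -> (bitlen (Posz K) <= kap)%N ->
  runi (svalp K iZ) (VPair (enc_atom am) rest :: vs) (sval K Z am)
    (250 + 30 * kap) (5 * kap + 5).
Proof.
move=> ha hZ i40 zk Kk; have hZ' := run_onth hZ (leqnn _).
have h := runi_arith OpDiv (runi_arith OpMul (runi_arith OpMul (runi_const (Posz K) _)
  (runi_arith OpMul (runi_leaf hZ' zk) (runi_leaf hZ' zk))) (run_num_v _ _ ha)) (run_den_v _ _ ha).
by apply: (runi_le h) => //; lia.
Qed.

Lemma run_smassp iZ kap am rest vs Z : small_atom kap am ->
  onth (VPair (enc_atom am) rest :: vs) iZ = Some (VInt Z) -> (iZ <= 40)%N ->
  (bitlen Z <= kap)%N ->
  runi (smassp iZ) (VPair (enc_atom am) rest :: vs) (smass Z am)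
    (120 + 20 * kap) (3 * kap + 2).
Proof.
move=> ha hZ i40 zk; have hZ' := run_onth hZ (leqnn _).
have h := runi_arith OpDiv (runi_arith OpMul (runi_leaf hZ' zk) (run_num_p _ _ ha)) (run_den_p _ _ ha).
by apply: (runi_le h) => //; lia.
Qed.

(* The environment is threshold :: vs; [iZ] is the index of Z in it. *)
Definition massp (K iZ : nat) (pl : prog) : prog :=
  foldp (bop OpAdd (var 1) (bop OpMul (smassp iZ.+2) (bop OpLe (var 2) (svalp K iZ.+2))))
    pl (PConst (Posz 0)).

Lemma run_massp K iZ kap (l : seq (rat * rat)) vs Z c pl t :
  {in l, forall am, small_atom kap am} ->
  onth (VInt c :: vs) iZ = Some (VInt Z) -> (iZ <= 30)%N ->
  (bitlen Z <= kap)%N -> (bitlen (Posz K) <= kap)%N -> (bitlen c <= kap)%N ->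
  (forall l1 l2, l = l1 ++ l2 -> (bitlen (mass_from K Z c l1) <= kap)%N) ->
  run pl (VInt c :: vs) (enc_dist l) t ->
  run (massp K iZ pl) (VInt c :: vs) (VInt (mass_from K Z c l))
    (size l * (500 + 100 * kap) + t + 20).
Proof.
move=> hl hZ i30 zk Kk ck hb hp.
apply: run_le; first apply: (run_foldl (encX := enc_atom) (enc := VInt)
   (f := (fun a am => a + smass Z am * Posz (c <= sval K Z am)%R)) (tb := 450 + 100 * kap) hp (runi_run (runi_const (Posz 0) _))).
  move=> l1 am l2 e; rewrite -/(mass_from K Z c l1) foldl_rcons -/(mass_from K Z c l1).
  have ha : small_atom kap am by apply: hl; rewrite e mem_cat mem_head orbT.
  set vs' := _ :: _ :: _.
  have hacc : runi (var 1) vs' (mass_from K Z c l1) 3 kap.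
    by split; [exact: run_var|apply: hb e].
  have hc : runi (var 2) vs' c 5 kap by split; [exact: run_var|].
  have hv := @run_svalp K iZ.+2 kap am _ [:: VInt (mass_from K Z c l1), VInt c & vs]
     Z ha hZ ltac:(lia) zk Kk.
  have hm := @run_smassp iZ.+2 kap am _ [:: VInt (mass_from K Z c l1), VInt c & vs]
     Z ha hZ ltac:(lia) zk.
  have [h _] := runi_arith OpAdd hacc (runi_arith OpMul (hm _) (runi_arith OpLe hc (hv _))).
  by apply: (run_le h); lia.
have := bitlen_cst 0; lia.
Qed.

Definition excessp (K iZ : nat) (pl : prog) : prog :=
  foldp (bop OpAdd (var 1) (bop OpMul (smassp iZ.+2)
     (bop OpMul (bop OpLe (var 2) (svalp K iZ.+2)) (bop OpSub (svalp K iZ.+2) (var 2)))))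
    pl (PConst (Posz 0)).

Lemma run_excessp K iZ kap (l : seq (rat * rat)) vs Z c pl t :
  {in l, forall am, small_atom kap am} ->
  onth (VInt c :: vs) iZ = Some (VInt Z) -> (iZ <= 30)%N ->
  (bitlen Z <= kap)%N -> (bitlen (Posz K) <= kap)%N -> (bitlen c <= kap)%N ->
  (forall l1 l2, l = l1 ++ l2 -> (bitlen (excess_from K Z c l1) <= kap)%N) ->
  run pl (VInt c :: vs) (enc_dist l) t ->
  run (excessp K iZ pl) (VInt c :: vs) (VInt (excess_from K Z c l))
    (size l * (1000 + 200 * kap) + t + 20).
Proof.
move=> hl hZ i30 zk Kk ck hb hp.
apply: run_le; first apply: (run_foldl (encX := enc_atom) (enc := VInt)
   (f := (fun a am => a + smass Z am * (Posz (c <= sval K Z am)%R * (sval K Z am - c)))) (tb := 950 + 200 * kap) hp (runi_run (runi_const (Posz 0) _))).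
  move=> l1 am l2 e; rewrite -/(excess_from K Z c l1) foldl_rcons -/(excess_from K Z c l1).
  have ha : small_atom kap am by apply: hl; rewrite e mem_cat mem_head orbT.
  set vs' := _ :: _ :: _.
  have hacc : runi (var 1) vs' (excess_from K Z c l1) 3 kap.
    by split; [exact: run_var|apply: hb e].
  have hc : runi (var 2) vs' c 5 kap by split; [exact: run_var|].
  have hv := @run_svalp K iZ.+2 kap am _ [:: VInt (excess_from K Z c l1), VInt c & vs]
     Z ha hZ ltac:(lia) zk Kk.
  have hm := @run_smassp iZ.+2 kap am _ [:: VInt (excess_from K Z c l1), VInt c & vs]
     Z ha hZ ltac:(lia) zk.
  have [h _] := runi_arith OpAdd hacc (runi_arith OpMul (hm _)
    (runi_arith OpMul (runi_arith OpLe hc (hv _)) (runi_arith OpSub (hv _) hc))).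
  by apply: (run_le h); lia.
have := bitlen_cst 0; lia.
Qed.

(* The environment of the body is
   [:: atoms of the item; accumulator; items; outer accumulator & vs]. *)
Definition fold_atoms (body pl pacc : prog) : prog :=
  foldp (foldp body (fst_of (var 0)) (var 1)) pl pacc.

(** Two nested loops realise one fold over the concatenated lists, so that specifications refer to
    [all_atoms] without the nesting. *)
Lemma run_fold_atoms (A : Type) (enc : A -> value) (f : A -> rat * rat -> A)
    body pl pacc vs (items : seq (seq (rat * rat))) a t1 t2 tb N :
  run pl vs (enc_seq [seq enc_dist l | l <- items]) t1 -> run pacc vs (enc a) t2 ->
  (forall l, l \in items -> (size l <= N)%N) ->
  (forall s1 am s2 rest ctl out, flatten items = s1 ++ am :: s2 ->
     run body [:: VPair (enc_atom am) rest, enc (foldl f a s1), ctl, out & vs]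
       (enc (f (foldl f a s1) am)) tb) ->
  run (fold_atoms body pl pacc) vs (enc (foldl f a (flatten items)))
    (size items * (N * (tb + 12) + 40) + t1 + t2 + 12).
Proof.
move=> hl hacc hN hb; rewrite foldl_flatten.
apply: run_le; first apply: (run_foldl (encX := enc_dist) (f := foldl f)
  (tb := N * (tb + 12) + 20) hl hacc); last by nia.
move=> i1 l i2 e; rewrite foldl_rcons -foldl_flatten.
apply: run_le; first apply: (run_foldl (encX := enc_atom) (f := f) (xs := l) (t1 := 3) (t2 := 3) (tb := tb)).
- by apply: run_fst; exact: (@run_var 0).
- exact: (@run_var 1).
- move=> l1 am l2 e'; rewrite foldl_rcons -foldl_cat; apply: (hb _ _ (l2 ++ flatten i2)).
  by rewrite e flatten_cat /= e' -!catA.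
have := hN l; rewrite e mem_cat mem_head orbT => /(_ isT) hl'.
by rewrite -!addnA leq_add ?leq_mul.
Qed.

Definition lengthp (pl : prog) : prog :=
  foldp (bop OpAdd (var 1) (PConst (Posz 1))) pl (PConst (Posz 0)).

Lemma run_lengthp (T : Type) (encT : T -> value) pl vs (xs : seq T) t kap :
  run pl vs (enc_seq [seq encT x | x <- xs]) t -> (bitlen (Posz (size xs)) <= kap)%N ->
  run (lengthp pl) vs (VInt (Posz (size xs))) (size xs * (kap + 30) + t + 20).
Proof.
move=> hl hk.
have e : foldl (fun a _ => a + 1) 0 xs = Posz (size xs).
  by rewrite foldl_sum add0r big_const_seq count_predT iter_addr_0 -[RHS]natz.
rewrite -{1}e; apply: run_le.
  apply: (run_foldl (encX := encT) (enc := VInt) (f := fun a _ => a + 1)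
   (tb := kap + 18) hl (runi_run (runi_const (Posz 0) _))).
  move=> l1 x l2 ex; rewrite foldl_rcons; set a := foldl _ _ _.
  have ha : (bitlen a <= kap)%N.
    apply: leq_trans hk; apply: bitlen_mono; rewrite /a foldl_sum add0r big_const_seq count_predT iter_addr_0.
    by rewrite ex size_cat /=; lia.
  have hv : runi (var 1) [:: VPair (encT x) (enc_seq [seq encT y | y <- l2]), VInt a & vs] a 3 kap.
    by split; [exact: run_var|].
  have [h _] := runi_arith OpAdd hv (runi_const (Posz 1) _).
  apply: (run_le h); have := bitlen_cst 1; lia.
have := bitlen_cst 0; lia.
Qed.

Definition powp (ib : nat) (pe : prog) : prog :=
  forp (bop OpMul (var 1) (var ib.+2)) pe (PConst (Posz 1)).

Lemma run_powp ib pe vs (x : int) (e : nat) t kap :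
  run pe vs (VInt (Posz e)) t -> onth vs ib = Some (VInt x) -> (ib <= 30)%N ->
  (bitlen (Posz e) <= kap)%N -> (bitlen x <= kap)%N ->
  (forall j, (j <= e)%N -> (bitlen (x ^+ j) <= kap)%N) ->
  run (powp ib pe) vs (VInt (x ^+ e)) (e * (3 * kap + 100) + t + 30).
Proof.
move=> he hx ib30 ek xk hb.
pose I j (a : int) := (j <= e)%N /\ a = x ^+ (e - j).
have [|//|j a je [_ ->]||a h [_ ea]] := @run_for int VInt I (bop OpMul (var 1) (var ib.+2)) pe
   (PConst (Posz 1)) vs e (Posz 1) t 3 (2 * kap + 75) kap he.
- apply: run_le (runi_run (runi_const (Posz 1) _)) _; have := bitlen_cst 1; lia.
- have hj := hb (e - j.+1)%N (leq_subr _ _).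
  have h1 : runi (var 1) [:: VInt (Posz j.+1), VInt (x ^+ (e - j.+1)) & vs]
     (x ^+ (e - j.+1)) 3 kap by split; [exact: run_var|].
  have h2 : runi (var ib.+2) [:: VInt (Posz j.+1), VInt (x ^+ (e - j.+1)) & vs]
     x (ib.+2).*2.+1 kap by split; [exact: run_var|].
  have [h _] := runi_arith OpMul h1 h2.
  exists (x ^+ (e - j.+1) * x); first by apply: (run_le h); lia.
  by split; [exact: ltnW|rewrite -exprSr subnSK].
- by split; rewrite ?leqnn // subnn.
- by move: h; rewrite ea subn0 => h; apply: (run_le h); lia.
Qed.

Lemma run_eqi p vs x y t b : runi p vs x t b -> x = y -> run p vs (VInt y) t.
Proof. by move=> [h _] <-. Qed.

(** Symbolic execution of expressions: times and bit bounds are unification variables filled in by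
    the shape of the program, and the bit bounds of variables come from the context. *)
Ltac run_path := lazymatch goal with
  | |- run (fst_of _) _ _ _ => eapply run_fst; run_path
  | |- run (snd_of _) _ _ _ => eapply run_snd; run_path
  | |- run (var _) _ _ _ => eapply run_var; reflexivity
  end.

Ltac run_int := lazymatch goal with
  | |- runi (bop _ _ _) _ _ _ _ => eapply runi_arith; [run_int | run_int]
  | |- runi (PConst _) _ _ _ _ => exact: runi_const
  | |- runi _ _ _ _ _ => eapply runi_leaf; [run_path | eassumption]
  end.

Ltac run_arith := eapply run_eqi; [run_int | reflexivity].

Section Programs.
Variables (k m h b : nat).
Let L := (m ^ 2)%N.
Let K := (m * k.+1)%N.

(* Environment: level j, code w, 5 local variables, sigma, best answer, globals. *)
Definition level_body : prog :=
  letp (bop OpMul (var 0) (var 7))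
  (letp (massp K 17 (fst_of (var 6)))
  (letp (bop OpDiv (bop OpMul (var 0) (bop OpMul (var 19) (PConst (Posz (L * h))))) (var 18))
  (letp (bop OpDiv (var 0) (bop OpMul (var 20) (PConst (Posz L))))
  (letp (PConst (Posz b))
  (letp (powp 0 (var 1))
    (bop OpAdd (bop OpMul (bop OpAdd (bop OpMul (var 7) (var 20)) (var 3)) (var 20))
      (bop OpDiv (var 0) (var 1)))))))).

(* Environment: items to come, codes of the previous ones, sigma, best, globals. *)
Definition weight_prog : prog :=
  letp (bop OpMul (PConst (Posz L)) (var 2))
  (letp (excessp K 12 (fst_of (var 1)))
  (letp (bop OpDiv (bop OpMul (var 14) (var 0)) (bop OpMul (var 4) (var 13)))
    (forp level_body (PConst (Posz L))
      (bop OpAdd (var 0) (bop OpMul (bop OpLe (var 13) (var 0)) (bop OpSub (var 13) (var 0))))))).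

(** Accumulating by consing reverses the list of weights; this restores the order. *)
Definition revp (pl : prog) : prog := foldp (PFork (fst_of (var 0)) (var 1)) pl (PConst (Posz 0)).

(* Environment: sigma, best, globals. *)
Definition weights_prog : prog :=
  revp (foldp (PFork weight_prog (var 1)) (var 11) (PConst (Posz 0))).

Variables (R : realType) (n : nat) (X : 'I_n -> seq (rat * rat)) (bits : value).
Hypotheses (n0 : (0 < n)%N) (k0 : (0 < k)%N) (m1 : (1 < m)%N) (h0 : (0 < h)%N)
  (b1 : (1 < b)%N) (hX : forall i, nonneg_dist (X i)).
Let items := [seq X i | i <- enum 'I_n].
Let s := all_atoms X.
Let Z := common_den s.
Let V := coord_max n k m h b.
Let B := radix n k m h b.
Let M := (B ^ L.*2.+1)%N.
Let top : int := Posz k * Z ^+ n.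
Let Y : int := top + 1.
Let H0 := pack_init k Y k 0.
Let big : int := Posz K * (Z * Z * Z).

Definition globals : seq value :=
  [:: VInt big; VInt H0; VInt Y; VInt top; VInt (Posz M); VInt (Posz B);
      VInt (Posz V); VInt Z; VInt (Posz n);
      enc_seq [seq enc_dist l | l <- items]; bits].

(** A single integer U dominates the nonnegative integers that the program stores, so one bit bound
    [kap] serves everywhere; [int_bound] provides it. *)
Variables (U : int) (kap N : nat).
Hypothesis kapP : forall x : int, 0 <= x <= U -> (bitlen x <= kap)%N.
Hypothesis atomsP : {in s, forall am, small_atom kap am}.
Hypothesis sizeP : forall i, (size (X i) <= N)%N.
Hypotheses (nU : Posz n <= U) (LU : Posz (L * h) <= U) (L'U : Posz L <= U)
  (KU : Posz K <= U) (bU : Posz b <= U) (ZU : Z <= U)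
  (VU : Posz V <= U) (BU : Posz B <= U) (MU : Posz (n * M).+1 <= U)
  (LbU : Posz L * big <= U) (btU : big * top <= U) (nZU : Posz n * (Z * big) <= U)
  (YU : Y ^+ k <= U).

Let Z0 : 0 < Z.
Proof. exact: Z_gt0. Qed.

Let L0 : (0 < L)%N.
Proof. by rewrite /L expn_gt0 ltnW. Qed.

Let K0 : (0 < K)%N.
Proof. by rewrite /K muln_gt0 ltnW. Qed.

Let big0 : 0 < big.
Proof. by rewrite /big !mulr_gt0. Qed.

Lemma smass_nonneg i am : am \in X i -> 0 <= smass Z am.
Proof. by move=> h1; apply: (smass_ge0 (all_atoms_nonneg hX)); exact: (sub_all_atoms h1). Qed.

(** Partial sums are the accumulators of the loops and need bit bounds as well. *)
Lemma mass_prefix i c l1 l2 : X i = l1 ++ l2 -> 0 <= mass_from K Z c l1 <= Z.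
Proof.
move=> e; have /andP[_ h2] := mass_item_bounds K hX c i.
have t0 l : {subset l <= X i} -> 0 <= mass_from K Z c l.
  move=> sl; rewrite mass_fromE big_seq sumr_ge0 // => am /sl /smass_nonneg h1.
  by rewrite mulr_ge0.
rewrite t0; last by move=> am h1; rewrite e mem_cat h1.
apply: le_trans h2; rewrite e !mass_fromE big_cat lerDl -mass_fromE t0 //.
by move=> am h1; rewrite e mem_cat h1 orbT.
Qed.

Lemma excess_prefix i c l1 l2 : 0 <= c -> X i = l1 ++ l2 ->
  0 <= excess_from K Z c l1 <= Z * big.
Proof.
move=> c0 e; have sl : {subset l1 <= X i} by move=> am h1; rewrite e mem_cat h1.
have ge0 am : am \in X i ->
    0 <= smass Z am * (Posz (c <= sval K Z am)%R * (sval K Z am - c)).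
  move=> h1; rewrite mulr_ge0 //; first exact: smass_nonneg h1.
  by case: (leP c (sval K Z am)) => h2; rewrite ?mul0r // mul1r subr_ge0.
rewrite excess_fromE big_seq sumr_ge0 /=; last by move=> am /sl /ge0.
have -> : Z * big = (\sum_(am <- X i) smass Z am) * big.
  rewrite (smass_sum (all_atoms_nonneg hX)) //; first exact: sub_all_atoms.
  exact: (hX i).2.
rewrite e big_cat mulrDl -big_seq /= -[leLHS]addr0 lerD //; last first.
  rewrite mulr_ge0 ?(ltW big0) // big_seq sumr_ge0 // => am h1.
  by apply: (@smass_nonneg i); rewrite e mem_cat h1 orbT.
rewrite mulr_suml !big_seq; apply: ler_sum => am /sl h1.
rewrite ler_wpM2l ?(smass_nonneg h1) //.
have := sval_lt (all_atoms_nonneg hX) K0 (sub_all_atoms h1).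
have := sval_ge0 K (all_atoms_nonneg hX) (sub_all_atoms h1).
rewrite -/s -/Z -/big; move: (sval K Z am) => v v0 vb.
by case: (leP c v) => h2; rewrite ?mul0r ?mul1r; lia.
Qed.

Lemma cst_bits (x : nat) : Posz x <= U -> (bitlen (Posz x) <= kap)%N.
Proof. by move=> hx; apply: kapP. Qed.

Lemma small_item i : {in X i, forall am, small_atom kap am}.
Proof. by move=> am /sub_all_atoms; exact: atomsP. Qed.

Lemma le_MU (x : nat) : (x <= M)%N -> Posz x <= U.
Proof. by move=> hx; apply: le_trans MU; rewrite lez_nat; nia. Qed.

Lemma run_level_body i (sigma : int) j (w : int) x e c ctl acc best :
  (0 < j <= L)%N -> 0 < sigma <= big ->
  0 <= w <= Posz M ->
  run level_body [:: VInt (Posz j), VInt w, x, e, c, VPair (enc_dist (X i)) ctl, acc,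
                    VInt sigma, best & globals]
    (VInt ((w * Posz B + level_code n k m h Z sigma (X i) j) * Posz B
        + level_class n k m h b Z sigma (X i) j))
    (N * (500 + 100 * kap) + h * (3 * kap + 100) + 2000 + 200 * kap).
Proof.
move=> /andP[j0 jL] /andP[s0 sb] /andP[w0 wM].
have bK := cst_bits KU; have bZ : (bitlen Z <= kap)%N by apply: kapP; rewrite ZU ltW.
have jU : Posz j <= U by apply: le_trans L'U; rewrite lez_nat.
have jsU : 0 <= Posz j * sigma <= U.
  rewrite mulr_ge0 ?(ltW s0) //=; apply: le_trans LbU; apply: ler_pM => //.
  exact: ltW.
have wU : (bitlen w <= kap)%N.
  by apply: kapP; rewrite w0 (le_trans wM) // le_MU.
have sU : (bitlen sigma <= kap)%N.
  apply: kapP; rewrite ltW //=; apply: le_trans sb _; apply: le_trans LbU.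
  by rewrite ler_peMl ?(ltW big0).
set a := level_code n k m h Z sigma (X i) j.
have /andP[a0 aV] : 0 <= a <= Posz (n * L * h) := level_code_bounds k m h hX sigma i j.
pose q := (`|a| %/ (n * L))%N.
have qE : (a %/ (Posz n * Posz L))%Z = Posz q.
  by rewrite -{1}(gez0_abs a0) -PoszM divz_nat.
have qh : (q <= h)%N := level_quo_le n0 k0 m1 h0 b1 hX sigma i j.
have [cm1 [cm2 cm3]] := code_le_max n0 k0 m1 h0 b1 hX.
have aK : (bitlen a <= kap)%N.
  by apply: kapP; rewrite a0 (le_trans aV) // (le_trans _ VU) // lez_nat.
have hLh : (h <= L * h)%N by rewrite leq_pmull.
have qK : (bitlen (Posz q) <= kap)%N.
  by apply: cst_bits; apply: le_trans LU; rewrite lez_nat; apply: leq_trans qh hLh.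
have bK' := cst_bits bU.
have jK : (bitlen (Posz j) <= kap)%N := cst_bits jU.
have jsK : (bitlen (Posz j * sigma) <= kap)%N := kapP jsU.
have nK := cst_bits nU; have LhK := cst_bits LU; have LK := cst_bits L'U.
have BK := cst_bits BU.
pose mass := mass_from K Z (Posz j * sigma) (X i).
have massK : (bitlen mass <= kap)%N.
  apply: kapP; have /andP[-> h2] := @mass_prefix i (Posz j * sigma) (X i) [::] (esym (cats0 _)).
  exact: le_trans h2 ZU.
have powK e' : (e' <= q)%N -> (bitlen (Posz b ^+ e') <= kap)%N.
  move=> he; rewrite exprz_nat; apply: cst_bits; apply: le_trans VU; rewrite lez_nat.
  apply: leq_trans cm2; rewrite leq_pexp2l ?(ltnW b1) //; exact: leq_trans he qh.
apply: run_le.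
  eapply (run_let (u := VInt (Posz j * sigma))); first by run_arith.
  eapply (run_let (u := VInt mass)).
    apply: (@run_massp K 17 kap (X i) _ Z _ _ 15) => //.
    - exact: small_item.
    - move=> l1 l2 e1; apply: kapP; have /andP[-> h2] := mass_prefix (Posz j * sigma) e1.
      exact: le_trans h2 ZU.
    - by apply: run_le; [run_path|].
  eapply (run_let (u := VInt a)).
    by eapply run_eqi; [run_int | rewrite /= -PoszM mulnA].
  eapply (run_let (u := VInt (Posz q))).
    by eapply run_eqi; [run_int | exact: qE].
  eapply (run_let (u := VInt (Posz b))); first by run_arith.
  eapply (run_let (u := VInt (Posz b ^+ q))).
    apply: (@run_powp _ _ _ _ q 3 kap) => //.
    by apply: run_le; [run_path|].
  have powK' := powK q (leqnn q).
  eapply run_eqi; first by run_int.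
  by rewrite /= exprz_nat divz_nat.
have := leq_mul (sizeP i) (leqnn (500 + 100 * kap)).
have := leq_mul qh (leqnn (3 * kap + 100)).
move: (size (X i) * _)%N (N * _)%N (q * _)%N (h * _)%N => t1 t2 t3 t4 ? ?.
by rewrite -!addnA; lia.
Qed.

Definition level_time := (N * (500 + 100 * kap) + h * (3 * kap + 100) + 2000 + 200 * kap)%N.
Definition weight_time := (N * (1000 + 200 * kap) + L * (level_time + kap + 20) + 1000 + 200 * kap)%N.

Lemma run_weight_prog i (sigma : int) ctl acc best : 0 < sigma <= big ->
  run weight_prog [:: VPair (enc_dist (X i)) ctl, acc, VInt sigma, best & globals]
    (VInt (weight n k m h b Z sigma (X i))) weight_time.
Proof.
move=> hs; have /andP[s0 sb] := hs.
have bK := cst_bits KU; have bZ : (bitlen Z <= kap)%N by apply: kapP; rewrite ZU ltW.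
have LK := cst_bits L'U; have nK := cst_bits nU; have VK := cst_bits VU.
have cU : 0 <= Posz L * sigma <= U.
  by rewrite mulr_ge0 ?(ltW s0) //=; apply: le_trans LbU; rewrite ler_wpM2l.
have cK : (bitlen (Posz L * sigma) <= kap)%N by exact: kapP.
have sU : (bitlen sigma <= kap)%N.
  apply: kapP; rewrite ltW //=; apply: le_trans sb _; apply: le_trans LbU.
  by rewrite ler_peMl ?(ltW big0).
have c0 : 0 <= Posz L * sigma by case/andP: cU.
have exK l1 l2 : X i = l1 ++ l2 -> (bitlen (excess_from K Z (Posz L * sigma) l1) <= kap)%N.
  move=> e; apply: kapP; have /andP[-> h2] := excess_prefix c0 e.
  apply: le_trans h2 _; apply: le_trans nZU; rewrite ler_peMl ?lez_nat //.
  by rewrite mulr_ge0 ?ltW.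
pose e := excess_from K Z (Posz L * sigma) (X i).
have eK : (bitlen e <= kap)%N by apply: (exK _ [::]); rewrite cats0.
pose x := (Posz n * e %/ (sigma * Z))%Z.
have /andP[e0 eZ] : 0 <= e <= Z * big by apply: (@excess_prefix i _ _ [::] c0); rewrite cats0.
have x0 : 0 <= x by rewrite /x divz_ge0 ?mulr_gt0 // mulr_ge0.
have xK : (bitlen x <= kap)%N.
  have ne0 : 0 <= Posz n * e by rewrite mulr_ge0.
  have neU : Posz n * e <= U by apply: le_trans nZU; rewrite ler_wpM2l.
  apply: leq_trans (kapP (x := Posz n * e) _); last by rewrite ne0.
  by apply: bitlen_mono; exact: leq_absz_divz.
have tb := tail_code_bounds n0 k0 m1 h0 b1 hX i s0.
have BV := le_coord_max_radix k m h b n0.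
(* With j levels to go, appending their digits to w must give the final weight, and w has at most 1
   + 2 (L - j) digits so far. *)
pose I j (w : int) := [/\ (j <= L)%N,
   mix (Posz B) (level_code n k m h Z sigma (X i)) (level_class n k m h b Z sigma (X i)) j w =
      weight n k m h b Z sigma (X i) & 0 <= w < Posz B ^+ (1 + (L - j).*2)].
apply: run_le.
  eapply (run_let (u := VInt (Posz L * sigma))); first by run_arith.
  eapply (run_let (u := VInt e)).
    apply: (@run_excessp K 12 kap (X i) _ Z _ _ 10) => //; first exact: small_item.
    by apply: run_le; [run_path|].
  eapply (run_let (u := VInt x)); first by run_arith.
  have [|||j w jL [_ e1 hw]|| a hrun [_ <- _]] := @run_for int VInt I level_body
      (PConst (Posz L)) (bop OpAdd (var 0) (bop OpMul (bop OpLe (var 13) (var 0)) (bop OpSub (var 13) (var 0))))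
      [:: VInt x, VInt e, VInt (Posz L * sigma), VPair (enc_dist (X i)) ctl, acc, VInt sigma, best & globals]
      L (tail_code n k m h b Z sigma (X i)) (kap + 1) (500 + 20 * kap) level_time kap.
  - apply: run_le (runi_run (runi_const _ _)) _; lia.
  - apply: run_le; first by run_arith.
    lia.
  - exact: LK.
  - exists ((w * Posz B + level_code n k m h Z sigma (X i) j.+1) * Posz B
        + level_class n k m h b Z sigma (X i) j.+1).
      apply: run_level_body => //.
      have /andP[w0 wB] := hw; rewrite w0 (le_trans (ltW wB)) // exprz_nat lez_nat.
      by rewrite /M leq_pexp2l // -add1n leq_add2l leq_double leq_subr.
    split; first exact: ltnW.
      by rewrite -e1.
    have := @mix_bound (Posz B) (fun _ => level_code n k m h Z sigma (X i) j.+1)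
      (fun _ => level_class n k m h b Z sigma (X i) j.+1) 1 w _ _ _ hw.
    rewrite /= -addnA -doubleD addn1 subnSK //; apply=> _.
      have /andP[h1 h2] := level_code_bounds k m h hX sigma i j.+1.
      have := code_le_max n0 k0 m1 h0 b1 hX; rewrite -/L in h2 *.
      by rewrite h1 /=; move=> [h3 _]; apply: le_lt_trans h2 _; rewrite ltz_nat; apply: leq_ltn_trans h3 _.
    have /andP[h1 h2] := level_class_bounds n0 k0 m1 h0 b1 hX sigma i j.+1.
    by apply: le_lt_trans h2 _; rewrite ltz_nat.
  - split => //; rewrite subnn expr1; have /andP[h1 h2] := tb.
    by rewrite h1 /=; apply: le_lt_trans h2 _; rewrite ltz_nat.
  exact: hrun.
have := leq_mul (sizeP i) (leqnn (1000 + 200 * kap)).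
rewrite /weight_time.
move: (size (X i) * _)%N (N * (1000 + _))%N (L * _)%N => t1 t2 t3 ?.
lia.
Qed.

Lemma foldl_cons (T S : Type) (f : S -> T) (xs : seq S) (a : seq T) :
  foldl (fun a x => f x :: a) a xs = rev [seq f x | x <- xs] ++ a.
Proof.
elim: xs a => //= x xs ih a.
by rewrite ih rev_cons cat_rcons.
Qed.

Lemma run_revp pl vs (xs : seq value) t : run pl vs (enc_seq xs) t ->
  run (revp pl) vs (enc_seq (rev xs)) (size xs * 20 + t + 20).
Proof.
move=> hl; have := @run_foldl value (seq value) id enc_seq (fun a x => x :: a)
  (PFork (fst_of (var 0)) (var 1)) pl (PConst (Posz 0)) vs xs [::] t 2 8.
rewrite map_id (foldl_cons id) map_id cats0 => hf.
apply: run_le; first apply: hf => //.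
- apply: run_le (runi_run (runi_const (Posz 0) _)) _; have := bitlen_cst 0; lia.
- move=> s1 x s2 _; rewrite foldl_rcons.
  by apply: run_le; [apply: run_pair; run_path|].
by lia.
Qed.

Definition weights_time := (n * (weight_time + 50) + 100)%N.

Lemma run_weights_prog (sigma : int) best : 0 < sigma <= big ->
  run weights_prog [:: VInt sigma, best & globals]
    (enc_seq [seq VInt (weight n k m h b Z sigma (X i)) | i <- enum 'I_n]) weights_time.
Proof.
move=> hs; pose f i := VInt (weight n k m h b Z sigma (X i)).
have := @run_foldl 'I_n (seq value) (fun i => enc_dist (X i)) enc_seq (fun a i => f i :: a)
  (PFork weight_prog (var 1)) (var 11) (PConst (Posz 0)) [:: VInt sigma, best & globals]
  (enum 'I_n) [::] 23 2 (weight_time + 4).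
rewrite foldl_cons cats0 size_enum_ord => hf.
rewrite -[X in enc_seq X]revK; apply: run_le; first apply: run_revp.
  apply: hf => [||s1 i s2 _].
  - by apply: run_le; [apply: run_var; rewrite /= -map_comp|].
  - apply: run_le (runi_run (runi_const (Posz 0) _)) _; have := bitlen_cst 0; lia.
  - rewrite foldl_rcons; apply: run_le.
      by apply: run_pair; [apply: run_weight_prog|run_path].
    by lia.
rewrite size_rev size_map size_enum_ord /weights_time; lia.
Qed.

(* Environment: atoms, candidate, items, outer candidate, then the environment
   [:: atoms; (cur, val); items; outer value; 6 variables & globals] of
   [step_prog]. *)
Definition next_body : prog :=
  bop OpAdd (var 1) (bop OpMul
    (bop OpMul (bop OpLe (bop OpAdd (fst_of (var 5)) (PConst (Posz 1))) (svalp K 21))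
       (bop OpLe (svalp K 21) (var 1)))
    (bop OpSub (svalp K 21) (var 1))).

(** Environment: the items and membership bits to come, the packed integer, the level, then the
    environment of [step_prog]. The level is bound again on top because [massp] looks for its
    threshold there. *)
Definition item_body : prog :=
  letp (var 2)
  (letp (massp K 21 (fst_of (fst_of (var 1))))
  (letp (bop OpMul (var 0) (fst_of (snd_of (var 2))))
    (bop OpAdd (bop OpMul (bop OpSub (var 23) (var 0)) (var 4))
       (bop OpMul (var 0) (bop OpDiv (var 4) (var 18)))))).

(** Items and membership bits are two separate lists read in parallel, so the control value is a
    pair and [foldp] does not fit. *)
Definition items_prog : prog :=
  loop (PSeq (fst_of (var 0)) PIsPair)
    (PFork (snd_of (fst_of (var 0))) (snd_of (snd_of (var 0))))
    item_body (PFork (var 20) (snd_of (var 5))) (var 12).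

Definition step_prog : prog :=
  letp (fold_atoms next_body (var 19) (var 10))
  (letp items_prog
    (PFork (var 1) (bop OpAdd (snd_of (var 3))
       (bop OpMul (bop OpSub (var 1) (fst_of (var 3)))
          (bop OpSub (var 15) (bop OpSub (var 0) (bop OpMul (bop OpDiv (var 0) (var 14)) (var 14)))))))).

Definition value_prog : prog :=
  snd_of (fold_atoms step_prog (var 15) (PFork (PConst (Posz 0)) (PConst (Posz 0)))).

Let set_val (A : {set 'I_n}) : int :=
  set_value K Z big Y H0 top s (tagged_items X A).

Lemma top_gt0 : 0 < top.
Proof. by rewrite /top mulr_gt0 // exprn_gt0. Qed.

Lemma next_value_bounds cur t : {subset t <= s} -> 0 <= next_value K Z big cur t <= big.
Proof.
elim/last_ind: t => [|t am ih] sub; first by rewrite /next_value /= lexx ltW.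
have {}ih : 0 <= next_value K Z big cur t <= big.
  by apply: ih => am' h1; apply: sub; rewrite mem_rcons inE h1 orbT.
have ams : am \in s by apply: sub; rewrite mem_rcons mem_head.
have v0 := sval_ge0 K (all_atoms_nonneg hX) ams.
have vb := sval_lt (all_atoms_nonneg hX) K0 ams.
rewrite /next_value foldl_rcons -/(next_value K Z big cur t).
move: ih v0 vb; rewrite -/s -/Z -/big; move: (next_value _ _ _ _ _) (sval _ _ _) => a v.
move=> /andP[a0 ab] v0 vb.
by case: (cur + 1 <= v); case: (v <= a); rewrite /=; lia.
Qed.

Lemma fold_items_bounds c (A : {set 'I_n}) zs1 zs2 : tagged_items X A = zs1 ++ zs2 ->
  0 <= foldl (item_step K Z Y c) H0 zs1 < Y ^+ k.
Proof.
move=> e; have Y0 : 0 < Y by have := top_gt0; rewrite /Y; lia.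
have [|||g [e1 _ gb _]] := @fold_item_step R K k Z Y c k0 Z0 zs1 n.
- move=> lb h1; have : lb \in tagged_items X A by rewrite e mem_cat h1.
  by move=> /mapP[i _ ->]; exact: mass_item_bounds.
- by have := congr1 size e; rewrite size_tagged_items size_cat => ->; rewrite leq_addr.
- by rewrite /Y ltrDl.
have sz : (size zs1 <= n)%N.
  by have := congr1 size e; rewrite size_tagged_items size_cat => ->; rewrite leq_addr.
rewrite /H0 pack_initE e1 pack_ge0 ?(ltW Y0) //=; last by move=> x; case/andP: (gb x).
apply: pack_lt => x; have /andP[-> h1] := gb x; apply: le_lt_trans h1 _.
by rewrite /Y /top ltzD1 ler_wpM2l // ler_weXn2l //; lia.
Qed.

Lemma shortfall_bounds c (A : {set 'I_n}) :
  0 <= shortfall K Z Y H0 c (tagged_items X A) <= top.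
Proof.
have [|||g [e1 gk gb _]] := @fold_item_step R K k Z Y c k0 Z0 (tagged_items X A) n.
- by move=> lb /mapP[i _ ->]; exact: mass_item_bounds.
- by rewrite size_tagged_items.
- by rewrite /Y ltrDl.
have g0 := gb 0%N; rewrite size_tagged_items -/top in g0.
rewrite /shortfall /H0 pack_initE e1 pack_mod //.
by case/andP: g0 => -> h1 /=; rewrite /Y ltzD1.
Qed.

Lemma value_bounds (A : {set 'I_n}) (t : seq (rat * rat)) :
  let cv := foldl (fun cv _ => value_step K Z big Y H0 top s (tagged_items X A) cv)
    (0, 0) t in
  (0 <= cv.1 <= big) /\ (0 <= cv.2 <= big * top).
Proof.
(* The inductive bound is [cv.2 <= cv.1 * top]: each slab adds its width times at most [top]. *)
move=> cv; suff : 0 <= cv.1 <= big /\ 0 <= cv.2 <= cv.1 * top.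
  case=> h1 /andP[h2 h3]; split=> //; rewrite h2 (le_trans h3) //.
  by case/andP: h1 => _ h1; rewrite ler_wpM2r // ltW // top_gt0.
rewrite /cv; elim/last_ind: {cv} t => [|t am].
  by rewrite /= mul0r lexx ltW.
rewrite foldl_rcons; set cv := foldl _ _ _; case: cv => cur val /= [/andP[c0 cb] /andP[v0 vb]].
have [/andP[h1 h2] _ _] := next_valueP (X := X) k0 K0 cb.
have /andP[h3 h4] := shortfall_bounds (next_value K Z big cur s) A.
move: h1 h2 h3 h4; rewrite -/s -/Z -/big.
move: (next_value _ _ _ _ _) => nx h1 h2; move: (shortfall _ _ _ _ _ _) => f h3 h4.
split; first by lia.
by apply/andP; split; nia.
Qed.

Definition next_time := (n * (N * (2000 + 200 * kap) + 40) + 100)%N.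

Let bZ : (bitlen Z <= kap)%N.
Proof. by apply: kapP; rewrite ZU ltW. Qed.

Let one_U : 1 <= U.
Proof. by apply: le_trans ZU; rewrite -gtz0_ge1. Qed.

Let bigU : big <= U.
Proof. by apply: le_trans btU; rewrite ler_peMr ?(ltW big0) // -gtz0_ge1 top_gt0. Qed.

Let topU : top <= U.
Proof. by apply: le_trans btU; rewrite ler_peMl ?(ltW top_gt0) // -gtz0_ge1. Qed.

Let Y_gt0 : 0 < Y.
Proof. by have := top_gt0; rewrite /Y; lia. Qed.

Let Y_leU : Y <= U.
Proof.
by apply: le_trans YU; rewrite -{1}(expr1 Y) ler_weXn2l.
Qed.

Lemma mem_items l : l \in items -> exists i, l = X i.
Proof. by move=> /mapP[i _ ->]; exists i. Qed.

Lemma size_items_le l : l \in items -> (size l <= N)%N.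
Proof. by move=> /mem_items[i ->]; exact: sizeP. Qed.

Lemma run_next actl cur w2 ictl oacc l1 l2 l3 l4 l5 l6 : 0 <= cur <= big ->
  run (fold_atoms next_body (var 19) (var 10))
    [:: actl, VPair (VInt cur) w2, ictl, oacc, l1, l2, l3, l4, l5, l6 & globals]
    (VInt (next_value K Z big cur s)) next_time.
Proof.
move=> /andP[c0 cb].
have bK := cst_bits KU.
have cK : (bitlen cur <= kap)%N by apply: kapP; rewrite c0 (le_trans cb).
set vs := [:: actl, _, _, _, _, _, _, _, _, _ & _].
have hl : run (var 19) vs (enc_seq [seq enc_dist l | l <- items]) 39 by run_path.
have ha : run (var 10) vs (VInt big) 21 by run_path.
apply: run_le; first apply: (@run_fold_atoms int VInt (fun acc am => acc +
     Posz (cur + 1 <= sval K Z am)%R * Posz (sval K Z am <= acc)%R * (sval K Z am - acc))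
     next_body (var 19) (var 10) vs items big 39 21 (1900 + 200 * kap) N hl ha size_items_le).
  move=> s1 am s2 rest ctl out e; rewrite -/(next_value K Z big cur s1).
  have ams : am \in s by rewrite /s /all_atoms -/items e mem_cat mem_head orbT.
  have sub1 : {subset s1 <= s} by move=> a' h1; rewrite /s /all_atoms -/items e mem_cat h1.
  have /andP[n1 n2] := next_value_bounds cur sub1.
  have accK : (bitlen (next_value K Z big cur s1) <= kap)%N.
    by apply: kapP; rewrite n1 (le_trans n2).
  have hv := @run_svalp K 21 kap am rest [:: VInt (next_value K Z big cur s1), ctl, out & vs]
    Z (atomsP ams) erefl isT bZ bK.
  have b1c := bitlen_cst 1.
  apply: run_le; first (eapply run_eqi; [eapply runi_arith; [run_int|
    eapply runi_arith; [eapply runi_arith; [eapply runi_arith; [run_int|exact: hv]|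
      eapply runi_arith; [exact: hv|run_int]]|eapply runi_arith; [exact: hv|run_int]]]|reflexivity]).
  by rewrite -!addnA; lia.
rewrite size_map size_enum_ord /next_time.
have := leq_mul (leqnn N) (_ : 1900 + 200 * kap + 12 <= 2000 + 200 * kap)%N.
move=> /(_ ltac:(lia)) => h1.
have := leq_mul (leqnn n) (leq_add h1 (leqnn 40)).
move: (n * _)%N (n * _)%N => ? ? ?; lia.
Qed.

Definition item_time := (N * (500 + 100 * kap) + 2000 + 200 * kap)%N.

Lemma run_item_body (l : seq (rat * rat)) (bit : bool) rl rb (H nx : int)
    w1 w2 w3 w4 l1 l2 l3 l4 l5 l6 i :
  l = X i -> 0 <= H <= U -> 0 <= nx <= big ->
  run item_body [:: VPair (VPair (enc_dist l) rl) (VPair (VInt (Posz bit)) rb),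
      VInt H, VInt nx, w1, w2, w3, w4, l1, l2, l3, l4, l5, l6 & globals]
    (VInt (item_step K Z Y nx H (l, bit))) item_time.
Proof.
move=> -> hH /andP[nx0 nxb]; have bK := cst_bits KU; have HK := kapP hH.
have nxK : (bitlen nx <= kap)%N by apply: kapP; rewrite nx0 (le_trans nxb).
pose mass := mass_from K Z nx (X i).
have massK l' l'' : X i = l' ++ l'' -> (bitlen (mass_from K Z nx l') <= kap)%N.
  move=> e; apply: kapP; have /andP[-> h2] := mass_prefix nx e.
  exact: le_trans h2 ZU.
have mK : (bitlen mass <= kap)%N by apply: (massK _ [::]); rewrite cats0.
have bitK : (bitlen (Posz bit) <= kap)%N.
  by apply: kapP; apply: le_trans one_U; rewrite lez_nat leq_b1.
have PK : (bitlen (mass * Posz bit) <= kap)%N.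
  by apply: leq_trans mK; apply: bitlen_mono; case: bit {bitK}; rewrite ?mulr1 ?mulr0.
have YK : (bitlen Y <= kap)%N by apply: kapP; rewrite Y_leU ltW // Y_gt0.
apply: run_le.
  eapply (run_let (u := VInt nx)); first by run_path.
  eapply (run_let (u := VInt mass)).
    apply: (@run_massp K 21 kap (X i) _ Z _ _ 7) => //; first exact: small_item.
    by apply: run_le; [run_path|].
  eapply (run_let (u := VInt (mass * Posz bit))); first by run_arith.
  by run_arith.
have := leq_mul (sizeP i) (leqnn (500 + 100 * kap)).
rewrite /item_time; move: (size (X i) * _)%N (N * _)%N => t1 t2 ?.
by rewrite -!addnA; lia.
Qed.

Definition items_time := (n * (item_time + 50) + 200)%N.

Lemma run_items (nx : int) w1 w2 w3 w4 A l2 l3 l4 l5 l6 : 0 <= nx <= big ->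
  run items_prog
    [:: VInt nx, w1, w2, w3, w4, VPair (VInt 1) (enc_set A), l2, l3, l4, l5, l6 & globals]
    (VInt (foldl (item_step K Z Y nx) H0 (tagged_items X A))) items_time.
Proof.
move=> hnx.
set vs := [:: VInt nx, _, _, _, _, _, _, _, _, _, _ & _].
pose ctl (zs : seq (seq (rat * rat) * bool)) :=
  VPair (enc_seq [seq enc_dist lb.1 | lb <- zs]) (enc_seq [seq VInt (Posz (nat_of_bool lb.2)) | lb <- zs]).
pose I zs (H : int) := exists2 zs1, tagged_items X A = zs1 ++ zs &
  H = foldl (item_step K Z Y nx) H0 zs1.
have hctl : run (PFork (var 20) (snd_of (var 5))) vs (ctl (tagged_items X A)) 60.
  have -> : ctl (tagged_items X A) = VPair (enc_seq [seq enc_dist l | l <- items]) (enc_set A).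
    by congr VPair; rewrite /ctl /tagged_items /enc_set /items -!map_comp.
  by apply: run_le; [apply: run_pair; run_path|].
have hacc : run (var 12) vs (VInt H0) 30 by apply: run_le; [run_path|].
have [[l bit] zs H [zs1 e ->]||| H hrun [zs1 e eH]] := @run_loop _ int ctl VInt I
  (PSeq (fst_of (var 0)) PIsPair)
  (PFork (snd_of (fst_of (var 0))) (snd_of (snd_of (var 0))))
  item_body (PFork (var 20) (snd_of (var 5))) (var 12) vs (tagged_items X A) H0 60 30 5 11
  item_time hctl hacc.
- have /andP[h1 h2] := fold_items_bounds nx e.
  split.
  + by exists 1 => //; apply: run_ispair; run_path.
  + by apply: run_le; [apply: run_pair; run_path|].
  + exists (item_step K Z Y nx (foldl (item_step K Z Y nx) H0 zs1) (l, bit)).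
      have : (l, bit) \in tagged_items X A by rewrite e mem_cat mem_head orbT.
      case/mapP => i _ [el _]; apply: (@run_item_body l bit _ _ _ nx _ _ _ _ _ _ _ _ _ _ i) => //.
      by rewrite h1 /=; apply: le_trans YU; exact: ltW.
    exists (rcons zs1 (l, bit)); first by rewrite cat_rcons.
    by rewrite foldl_rcons.
- by move=> H _; apply: run_isint; run_path.
- by exists [::].
- move: hrun; rewrite eH -[zs1]cats0 -e => hrun; apply: (run_le hrun).
  by rewrite size_tagged_items /items_time; move: item_time => t; lia.
Qed.

Definition step_time := (next_time + items_time + 500 + 100 * kap)%N.

Definition enc_pair (cv : int * int) : value := VPair (VInt cv.1) (VInt cv.2).

Lemma run_step (cv : int * int) actl ictl oacc A l2 l3 l4 l5 l6 :
  0 <= cv.1 <= big -> 0 <= cv.2 <= big * top ->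
  run step_prog
    [:: actl, enc_pair cv, ictl, oacc, VPair (VInt 1) (enc_set A), l2, l3, l4, l5, l6 & globals]
    (enc_pair (value_step K Z big Y H0 top s (tagged_items X A) cv)) step_time.
Proof.
case: cv => cur val /= hc /andP[v0 vb].
have nxb : 0 <= next_value K Z big cur s <= big by apply: next_value_bounds.
have cK : (bitlen cur <= kap)%N.
  by case/andP: hc => c0 cb; apply: kapP; rewrite c0 (le_trans cb).
have vK : (bitlen val <= kap)%N by apply: kapP; rewrite v0 (le_trans vb).
have nxK : (bitlen (next_value K Z big cur s) <= kap)%N.
  by case/andP: nxb => c0' cb'; apply: kapP; rewrite c0' (le_trans cb').
have tK : (bitlen top <= kap)%N by apply: kapP; rewrite topU ltW // top_gt0.
have YK : (bitlen Y <= kap)%N by apply: kapP; rewrite Y_leU ltW // Y_gt0.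
pose H := foldl (item_step K Z Y (next_value K Z big cur s)) H0 (tagged_items X A).
have HK : (bitlen H <= kap)%N.
  have /andP[h1 h2] := @fold_items_bounds (next_value K Z big cur s) A _ [::] (esym (cats0 _)).
  by apply: kapP; rewrite h1 /=; apply: le_trans YU; exact: ltW.
apply: run_le.
  eapply (run_let (u := VInt (next_value K Z big cur s))); first exact: run_next.
  eapply (run_let (u := VInt H)); first exact: run_items.
  eapply run_pair; first by run_path.
  by run_arith.
rewrite /step_time; move: next_time items_time => t1 t2.
by rewrite -!addnA; lia.
Qed.

Definition value_time := (n * (N * (step_time + 12) + 40) + 100)%N.

Lemma run_value A l2 l3 l4 l5 l6 :
  run value_prog [:: VPair (VInt 1) (enc_set A), l2, l3, l4, l5, l6 & globals]
    (VInt (set_val A)) value_time.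
Proof.
set vs := [:: _, _, _, _, _, _ & _].
pose f cv (am : rat * rat) := value_step K Z big Y H0 top s (tagged_items X A) cv.
have hl : run (var 15) vs (enc_seq [seq enc_dist l | l <- items]) 31 by run_path.
have ha : run (PFork (PConst (Posz 0)) (PConst (Posz 0))) vs (enc_pair (0, 0)) 10.
  have b0 := bitlen_cst 0.
  apply: run_le; first (apply: run_pair; exact: (runi_run (runi_const (Posz 0) _))).
  lia.
have := @run_fold_atoms _ enc_pair f step_prog (var 15) _ vs items (0, 0) 31 10 step_time N
  hl ha size_items_le.
case=> [s1 am s2 rest ctl out e|t' ht hle].
  have [h1 h2] := value_bounds A s1.
  exact: (@run_step (foldl f (0, 0) s1)).
apply: run_le; first by apply: run_snd; exists t'; [exact: ht|exact: hle].
rewrite size_map size_enum_ord /value_time.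
by move: (n * _)%N => t; lia.
Qed.

Lemma set_val_bounds A : 0 <= set_val A <= big * top.
Proof. by have [_ h2] := value_bounds A s. Qed.

(** * Enumeration of targets and scales *)

Section Search.
Variables (Q : prog) (F : {set {set 'I_n}}) (C : nat).
Hypothesis queryP : forall (w : 'I_n -> int) (t : int),
  (forall i, `|w i| <= M)%N -> (`|t| <= n * M)%N ->
  exists (o : option {set 'I_n}) (time : nat),
    [/\ exec Q (VPair bits (VPair (enc_seq [seq VInt (w i) | i <- enum 'I_n]) (VInt t)))
          time (enc_answer o),
        exact_sum_answer F w t o & (time <= C)%N].

Let wt (sigma : int) i : int := weight n k m h b Z sigma (X i).

(* Environment: t + 1, best, weights, sigma, stale best, globals. *)
Definition query_body : prog :=
  letp (call Q (PFork (var 15) (PFork (var 2) (bop OpSub (var 0) (PConst (Posz 1))))))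
    (PIf (PSeq (var 0) PIsPair)
      (letp value_prog
        (PIf (bop OpLe (bop OpAdd (fst_of (var 3)) (PConst (Posz 1))) (var 0))
          (PFork (var 0) (snd_of (var 1))) (var 3)))
      (var 2)).

(** The counter takes the values t + 1 for the targets t from n M down to 0, since a loop stops as
    soon as its counter is 0. *)
Definition sigma_body : prog :=
  letp weights_prog
    (forp query_body (bop OpAdd (bop OpMul (var 11) (var 7)) (PConst (Posz 1))) (var 2)).

(** The initial value -1 lies below the value of every set, so the first set returned by a query is
    recorded. *)
Definition search_prog : prog :=
  snd_of (halvep sigma_body (var 0) (PFork (PConst (-1)) (PConst (Posz 0)))).

Definition enc_best (vo : int * option {set 'I_n}) : value :=
  VPair (VInt vo.1) (if vo.2 is Some A then enc_set A else VInt 0).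

Definition valid_best (vo : int * option {set 'I_n}) : Prop :=
  match vo.2 with
  | None => vo.1 = -1
  | Some A => A \in F /\ vo.1 = set_val A
  end.

(** A query may return any set of the right weight, so S itself may never be evaluated. What the
    search guarantees is that some feasible set of the same weight has value at most v. *)
Definition covers (sigma v : int) (S : {set 'I_n}) : Prop :=
  exists2 S', S' \in F &
    \sum_(i in S') wt sigma i = \sum_(i in S) wt sigma i /\ set_val S' <= v.

Lemma covers_le sigma v v' S : v <= v' -> covers sigma v S -> covers sigma v' S.
Proof. by move=> h1 [S' h2 [h3 h4]]; exists S' => //; split=> //; exact: le_trans h1. Qed.

Lemma wt_bounds sigma i : 0 < sigma -> 0 <= wt sigma i <= Posz M.
Proof.
move=> s0; have /andP[h1 h2] := weight_bounds n0 k0 m1 h0 b1 hX i s0.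
by rewrite h1 /=; apply: le_trans (ltW h2) _; rewrite exprz_nat.
Qed.

Lemma sum_wt_bounds sigma (S : {set 'I_n}) : 0 < sigma ->
  0 <= \sum_(i in S) wt sigma i <= Posz (n * M).
Proof.
move=> s0; rewrite sumr_ge0 /=; last by move=> i _; case/andP: (wt_bounds i s0).
apply: (@le_trans _ _ (\sum_(i in S) Posz M)).
  by apply: ler_sum => i _; case/andP: (wt_bounds i s0).
rewrite sumr_const -mulr_natr -[(_)%:R]/(#|S|%:R) natz -PoszM lez_nat mulnC leq_mul2r.
by rewrite -[X in (_ <= X)%N]card_ord max_card orbT.
Qed.

Lemma valid_bits vo : valid_best vo -> (bitlen vo.1 <= kap)%N.
Proof.
case: vo => v [A|] /=; rewrite /valid_best /=.
  by case=> _ ->; apply: kapP; have /andP[-> h2] := set_val_bounds A; exact: le_trans btU.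
by move=> ->; apply: leq_trans (kapP (x := 1) _) => //; exact: bitlen_mono.
Qed.

Definition query_time := (C + value_time + 500 + 100 * kap)%N.

Lemma run_query_body (sigma : int) j vo best0 : 0 < sigma -> (j <= n * M)%N ->
  valid_best vo ->
  exists2 vo', run query_body [:: VInt (Posz j.+1), enc_best vo,
      enc_seq [seq VInt (wt sigma i) | i <- enum 'I_n], VInt sigma, best0 & globals]
      (enc_best vo') query_time &
    [/\ valid_best vo', vo.1 <= vo'.1 &
        forall S, S \in F -> \sum_(i in S) wt sigma i = Posz j -> covers sigma vo'.1 S].
Proof.
move=> s0 jM hv.
have jK : (bitlen (Posz j.+1) <= kap)%N by apply: cst_bits; apply: le_trans MU; rewrite lez_nat ltnS.
have vK := valid_bits hv.
have [||o [time [hex hans htime]]] := @queryP (wt sigma) (Posz j).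
- by move=> i; have := wt_bounds i s0; lia.
- by [].
have b1c := bitlen_cst 1.
have hcall : runs Q (VPair bits (VPair (enc_seq [seq VInt (wt sigma i) | i <- enum 'I_n])
    (VInt (Posz j)))) (enc_answer o) C by exists time.
set vs := [:: VInt (Posz j.+1), _, _, _, _ & _].
have harg : run (PFork (var 15) (PFork (var 2) (bop OpSub (var 0) (PConst (Posz 1))))) vs
    (VPair bits (VPair (enc_seq [seq VInt (wt sigma i) | i <- enum 'I_n]) (VInt (Posz j))))
    (100 + 5 * kap).
  apply: run_le.
    apply: run_pair; first by run_path.
    apply: run_pair; first by run_path.
    eapply run_eqi; first by run_int.
    by rewrite /= intS addrAC subrr add0r.
  by rewrite -!addnA; lia.
have hask := run_call harg hcall.
case: o hans hask {hex hcall} => [A [AF Aw]|hno] hask.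
- have hval := @run_value A (VInt (Posz j.+1)) (enc_best vo)
    (enc_seq [seq VInt (wt sigma i) | i <- enum 'I_n]) (VInt sigma) best0.
  have sK : (bitlen (set_val A) <= kap)%N.
    by apply: kapP; have /andP[-> h2] := set_val_bounds A; exact: le_trans btU.
  pose better := vo.1 + 1 <= set_val A.
  exists (if better then (set_val A, Some A) else vo).
    have hbest : run (PIf (bop OpLe (bop OpAdd (fst_of (var 3)) (PConst (Posz 1))) (var 0))
          (PFork (var 0) (snd_of (var 1))) (var 3))
        [:: VInt (set_val A), enc_answer (Some A) & vs]
        (enc_best (if better then (set_val A, Some A) else vo)) (100 + 20 * kap).
      rewrite (_ : enc_best _ = if better then enc_best (set_val A, Some A) else enc_best vo); last first.
        by case: better.
      apply: run_le.
        apply: run_if; [by run_arith|by apply: run_pair; run_path|by run_path].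
      by lia.
    have hthen := run_let hval hbest.
    apply: run_le.
      eapply run_let; first exact: hask.
      by eapply (@run_ifT _ _ _ _ 1) => //; [by apply: run_ispair; run_path|exact: hthen].
    by rewrite /query_time; move: value_time => ?; lia.
  have hle : set_val A <= (if better then (set_val A, Some A) else vo).1.
    by rewrite /better; case: ifP => // /negbT; rewrite -ltNge ltzD1.
  split.
  + by case: ifP => //; rewrite /valid_best.
  + by rewrite /better; case: ifP => //=; rewrite lezD1; exact: ltW.
  + by move=> S SF eS; exists A => //; rewrite eS.
- exists vo; last by split=> // S SF eS; case: (hno S SF).
  apply: run_le.
    eapply run_let; first exact: hask.
    by eapply run_ifF; [apply: run_isint; run_path | run_path].
  by rewrite /query_time; move: value_time => ?; lia.
Qed.

Definition sigma_time := (weights_time + (n * M).+1 * (query_time + kap + 20) + 500 + 100 * kap)%N.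

Lemma run_sigma_body (sigma : nat) vo : 0 < Posz sigma <= big -> valid_best vo ->
  exists2 vo', run sigma_body [:: VInt (Posz sigma), enc_best vo & globals]
      (enc_best vo') sigma_time &
    [/\ valid_best vo', vo.1 <= vo'.1 &
        forall S, S \in F -> covers (Posz sigma) vo'.1 S].
Proof.
move=> hs hv; have /andP[s0 sb] := hs.
(* The targets from j upwards have been asked. *)
pose I j vo' := [/\ valid_best vo', vo.1 <= vo'.1 &
  forall S, S \in F -> Posz j <= \sum_(i in S) wt (Posz sigma) i -> covers (Posz sigma) vo'.1 S].
have MK : (bitlen (Posz M) <= kap)%N by apply: cst_bits; exact: le_MU.
have nK := cst_bits nU; have b1c := bitlen_cst 1.
have nMK : (bitlen (Posz (n * M).+1) <= kap)%N by exact: cst_bits.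
set vs := [:: enc_seq [seq VInt (wt (Posz sigma) i) | i <- enum 'I_n], VInt (Posz sigma), enc_best vo & globals].
have [||//|j vo1 jM [v1 v2 v3]||vo2 hrun [v1 v2 v3]] := @run_for _ enc_best I query_body
  (bop OpAdd (bop OpMul (var 11) (var 7)) (PConst (Posz 1))) (var 2) vs (n * M).+1 vo
  (100 + 10 * kap) 5 query_time kap.
- apply: run_le; first (eapply run_eqi; first by run_int).
    by rewrite /= -PoszM -PoszD addn1.
  by rewrite -!addnA; lia.
- by run_path.
- have [vo2 h1 [h2 h3 h4]] := run_query_body (enc_best vo) s0 jM v1.
  exists vo2; first exact: h1.
  split=> //; first exact: le_trans h3.
  move=> S SF hj; case: (eqVneq (\sum_(i in S) wt (Posz sigma) i) (Posz j)) => [e|ne].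
    exact: h4.
  apply: (covers_le h3); apply: v3 => //.
  by move: hj ne; move: (\sum_(i in S) _) => t; lia.
- split=> // S SF hj; have := sum_wt_bounds S s0; move: hj.
  by move: (\sum_(i in S) _) => t; lia.
- exists vo2.
    apply: run_le.
      by eapply run_let; [exact: run_weights_prog | exact: hrun].
    by rewrite /sigma_time; move: weights_time (_ * _)%N => t1 t2; rewrite -!addnA; lia.
  split=> // S SF; apply: v3 => //.
  by case/andP: (sum_wt_bounds S s0).
Qed.

(** The program cannot test a scale against the unknown T, so correctness is stated for abstract
    predicates: [pend] says that the scale has not dropped below the right one, [good] that it is
    right. They are instantiated by [fine_enough] and [good_scale]. *)
Variables (pend good : nat -> Prop).
Hypothesis halving : forall j, (0 < j)%N -> pend j -> good j \/ ((0 < j./2)%N /\ pend j./2).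

Definition search_time := (kap * (sigma_time + kap + 20) + 200 + kap)%N.

Lemma run_search : pend `|big| -> F != finset.set0 ->
  exists (A : {set 'I_n}) (sigma : nat),
  [/\ run search_prog globals (enc_set A) search_time, A \in F,
      (0 < sigma)%N /\ good sigma &
      forall S, S \in F -> covers (Posz sigma) (set_val A) S].
Proof.
move=> hpend /set0Pn[S0 S0F].
(* Either the right scale is still ahead or it has been treated; at counter 0 only the latter
   remains. *)
pose I (j : nat) (vo : int * option {set 'I_n}) := [/\ valid_best vo, Posz j <= big &
  ((0 < j)%N /\ pend j) \/ exists sigma : nat, [/\ (0 < sigma)%N, good sigma &
     forall S, S \in F -> covers (Posz sigma) vo.1 S]].
have bK : (bitlen big <= kap)%N by apply: kapP; rewrite bigU ltW.
have bigE : Posz `|big| = big by rewrite gez0_abs // ltW.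
have [|||||[v o] hrun [v1 _ [[]//|[sigma [sg gd cov]]]]] := @run_halve _ enc_best I sigma_body (var 0)
  (PFork (PConst (-1)) (PConst (Posz 0))) globals `|big|%N (-1, None) 1 20 sigma_time kap.
- by rewrite bigE; run_path.
- apply: run_le; first by apply: run_pair; exact: (runi_run (runi_const _ _)).
  have h1 : (bitlen (-1) <= 1)%N by apply: bitlen_le_exp.
  by have := bitlen_cst 0; lia.
- by rewrite bigE.
- move=> j vo /andP[j0 jb] [v1 v2 v3].
  have hs : 0 < Posz j <= big by rewrite v2 andbT.
  have [vo' hrun [w1 w2 w3]] := run_sigma_body hs v1.
  exists vo'; first exact: hrun.
  split=> //; first by apply: le_trans v2; rewrite lez_nat; lia.
  case: v3 => [[_ pj]|[sigma [sg gd cov]]]; last first.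
    by right; exists sigma; split=> // S SF; apply: (covers_le w2); exact: cov.
  case: (halving j0 pj) => [gj|]; last by left.
  by right; exists j.
- split=> //=; first by rewrite bigE.
  by left; split=> //; rewrite absz_gt0 gt_eqF.
have [S' S'F [_ hle]] := cov S0 S0F.
case: o hrun v1 cov hle => [A|] hrun /= v1 cov hle; last first.
  move: hle; rewrite (v1 : v = -1) => hle; have /andP[h1 _] := set_val_bounds S'.
  by have := le_trans h1 hle.
case: v1 => AF eA; exists A, sigma; split=> //.
- apply: run_le; first by apply: run_snd; exact: hrun.
  by rewrite /search_time; move: (kap * _)%N => ?; lia.
- by move=> S SF; rewrite -eA; exact: cov.
Qed.

Definition den_body : prog :=
  bop OpMul (var 1)
    (bop OpMul (bop OpMul (bop OpAdd (PConst (Posz 1)) num_v) den_v) den_p).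

Definition init_body : prog :=
  bop OpAdd (bop OpSub (PConst (Posz k.+1)) (var 0)) (bop OpMul (var 2) (var 1)).

(** The parameters k, m, h and b are written into the program as constants, as it may depend on k
    and eps; everything depending on the instance is computed. *)
Definition main_prog : prog :=
  PSeq (PFork PSnd (PFork PFst (PConst (Posz 0))))
  (letp (lengthp (var 0))
  (letp (fold_atoms den_body (var 1) (PConst (Posz 1)))
  (letp (bop OpMul (var 1) (PConst (Posz (k * L * h * b ^ h))))
  (letp (bop OpAdd (bop OpMul (var 2) (var 0)) (PConst (Posz 1)))
  (letp (powp 0 (PConst (Posz L.*2.+1)))
  (letp (bop OpMul (PConst (Posz k)) (powp 3 (var 4)))
  (letp (bop OpAdd (var 0) (PConst (Posz 1)))
  (letp (forp init_body (PConst (Posz k)) (PConst (Posz 0)))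
  (letp (bop OpMul (PConst (Posz K)) (bop OpMul (bop OpMul (var 6) (var 6)) (var 6)))
    search_prog))))))))).

(** The accumulator only grows, so its intermediate values are bounded by the final [H0]. *)
Lemma pack_init_ge r H : (r <= k.+1)%N -> 0 <= H -> 0 <= H <= pack_init k Y r H.
Proof.
elim: r H => [|r ih] H hr H1; first by rewrite H1 /=.
have h1 : H <= Posz k.+1 - Posz r.+1 + Y * H.
  apply: (@le_trans _ _ (Y * H)); last by rewrite lerDr subr_ge0 lez_nat.
  by rewrite ler_peMl // -gtz0_ge1.
have := ih _ (ltnW hr) (le_trans H1 h1); rewrite /= H1 => /andP[_ h2].
exact: le_trans h1 h2.
Qed.

Lemma common_den_prefix s1 s2 : s = s1 ++ s2 -> 0 <= common_den s1 <= Z.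
Proof.
move=> e.
have pos s' : {subset s' <= s} -> 0 < common_den s'.
  by move=> sub; apply: common_den_gt0 => am /sub /all_atoms_nonneg; apply.
have p1 : 0 < common_den s1 by apply: pos => am h1; rewrite e mem_cat h1.
have p2 : 0 < common_den s2 by apply: pos => am h1; rewrite e mem_cat h1 orbT.
rewrite ltW //= /Z e !common_denE big_cat -!common_denE /=.
by rewrite ler_peMr ?(ltW p1) // -gtz0_ge1.
Qed.

Definition setup_time :=
  (n * (N * (300 + 40 * kap) + 40) + n * (kap + 30) + L.*2.+1 * (3 * kap + 100) +
   n * (3 * kap + 100) + k * (500 + 100 * kap) + 2000 + 100 * kap)%N.

Hypotheses (LLU : Posz L.*2.+1 <= U) (kU : Posz k.+1 <= U).

Lemma run_main : pend `|big| -> F != finset.set0 ->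
  exists (A : {set 'I_n}) (sigma : nat),
  [/\ runs main_prog (VPair bits (enc_seq [seq enc_dist (X i) | i <- enum 'I_n]))
        (enc_set A) (setup_time + search_time), A \in F,
      (0 < sigma)%N /\ good sigma &
      forall S, S \in F -> covers (Posz sigma) (set_val A) S].
Proof.
move=> hp hF; have [A [sigma [hrun AF gd cov]]] := run_search hp hF.
exists A, sigma; split=> // {gd cov AF hp hF}.
have b0c := bitlen_cst 0; have b1c := bitlen_cst 1.
have nK := cst_bits nU; have VK := cst_bits VU; have BK := cst_bits BU.
have KK := cst_bits KU; have LLK := cst_bits LLU; have kK := cst_bits kU.
have MK : (bitlen (Posz M) <= kap)%N by apply: cst_bits; exact: le_MU.
have k'K : (bitlen (Posz k) <= kap)%N.
  by apply: cst_bits; apply: le_trans kU; rewrite lez_nat.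
have cV : (bitlen (Posz (k * L * h * b ^ h)) <= kap)%N.
  by apply: cst_bits; apply: le_trans VU; rewrite lez_nat /V /coord_max leq_pmull.
have tK : (bitlen top <= kap)%N by apply: kapP; rewrite topU ltW // top_gt0.
have YK : (bitlen Y <= kap)%N by apply: kapP; rewrite Y_leU ltW // Y_gt0.
have ZnK j : (j <= n)%N -> (bitlen (Z ^+ j) <= kap)%N.
  move=> jn; apply: kapP; rewrite exprn_ge0 ?(ltW Z0) //=; apply: le_trans topU.
  apply: (@le_trans _ _ (Z ^+ n)); first by rewrite ler_weXn2l // -gtz0_ge1.
  by rewrite /top ler_peMl ?exprn_ge0 ?(ltW Z0) // lez_nat.
have itE : enc_seq [seq enc_dist (X i) | i <- enum 'I_n] = enc_seq [seq enc_dist l | l <- items].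
  by rewrite /items -map_comp.
rewrite itE.
have r1 : runs (PFork PSnd (PFork PFst (PConst (Posz 0))))
   (VPair bits (enc_seq [seq enc_dist l | l <- items]))
   (enc_seq [:: enc_seq [seq enc_dist l | l <- items]; bits]) 20.
  apply: runs_le; first (apply: runs_fork; [exact: runs_snd|apply: runs_fork;
     [exact: runs_fst|exists (bitlen (Posz 0)).+1; [exact: EConst|exact: leqnn]]]).
  by lia.
apply: runs_le; first apply: runs_seq r1 _.
  set e0 := [:: _; _]; rewrite -/(run _ e0 _ _).
  have sz : size items = n by rewrite size_map size_enum_ord.
  have rn : run (lengthp (var 0)) e0 (VInt (Posz n)) (n * (kap + 30) + 25).
    have := @run_lengthp _ enc_dist (var 0) e0 items 1 kap; rewrite sz => h1.
    by apply: run_le; [apply: h1 => //; run_path|lia].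
  have rZ : run (fold_atoms den_body (var 1) (PConst (Posz 1))) (VInt (Posz n) :: e0)
      (VInt Z) (n * (N * (300 + 40 * kap) + 40) + 30).
    have hl : run (var 1) (VInt (Posz n) :: e0) (enc_seq [seq enc_dist l | l <- items]) 3 by run_path.
    have ha : run (PConst (Posz 1)) (VInt (Posz n) :: e0) (VInt (Posz 1)) 3.
      by apply: run_le; first exact: (runi_run (runi_const (Posz 1) _)); lia.
    have := @run_fold_atoms int VInt (fun z am => z * atom_weight am) den_body (var 1)
      (PConst (Posz 1)) _ items (Posz 1) 3 3 (280 + 40 * kap) N hl ha size_items_le.
    case=> [s1 am s2 rest ctl out e|t' ht hle].
      have ams : am \in s by rewrite /s /all_atoms -/items e mem_cat mem_head orbT.
      have zK : (bitlen (common_den s1) <= kap)%N.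
        by apply: kapP; have /andP[-> h1] := common_den_prefix e; exact: le_trans h1 ZU.
      have ha' := atomsP ams.
      apply: run_le; first (eapply run_eqi; [eapply runi_arith; [run_int|eapply runi_arith;
        [eapply runi_arith; [eapply runi_arith; [run_int|exact: (run_num_v _ _ ha')]|exact: (run_den_v _ _ ha')]|
         exact: (run_den_p _ _ ha')]]|reflexivity]).
      by lia.
    apply: run_le; first by exists t'; [exact: ht|exact: hle].
    rewrite sz (_ : N * (300 + 40 * kap) = N * (280 + 40 * kap + 12) + N * 8)%N; last by ring.
    by move: (N * (_ + 12))%N => t; rewrite -!addnA; nia.
  eapply run_let; first exact: rn.
  eapply run_let; first exact: rZ.
  eapply (run_let (u := VInt (Posz V))); first by run_arith.
  eapply (run_let (u := VInt (Posz B))).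
    by eapply run_eqi; [run_int|rewrite /= -PoszM -PoszD addn1].
  eapply (run_let (u := VInt (Posz M))).
    rewrite -[Posz M]exprz_nat; apply: (@run_powp 0 _ _ _ _ (kap + 1) kap) => //.
      by apply: run_le; first exact: (runi_run (runi_const _ _)); lia.
    move=> j jL; rewrite exprz_nat; apply: cst_bits; apply: le_MU.
    by rewrite /M leq_pexp2l.
  eapply (run_let (u := VInt top)).
    have rp : runi (powp 3 (var 4)) [:: VInt (Posz M), VInt (Posz B), VInt (Posz V), VInt Z, VInt (Posz n) & e0]
        (Z ^+ n) (n * (3 * kap + 100) + 9 + 30) kap.
      split; last exact: ZnK.
      by apply: (@run_powp 3 _ _ _ _ 9 kap) => //; run_path.
    by eapply run_eqi; [eapply runi_arith; [run_int|exact: rp]|reflexivity].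
  eapply (run_let (u := VInt Y)); first by run_arith.
  eapply (run_let (u := VInt H0)).
    pose I j (H : int) := [/\ (j <= k)%N, 0 <= H & pack_init k Y j H = H0].
    have H0U : H0 < Y ^+ k by have /andP[] := @fold_items_bounds 0 finset.set0 [::] _ erefl.
    have [|||j H jk [_ H1 H2]||H hrun' [_ _ H2]] := @run_for _ VInt I init_body (PConst (Posz k))
      (PConst (Posz 0)) [:: VInt Y, VInt top, VInt (Posz M), VInt (Posz B), VInt (Posz V), VInt Z, VInt (Posz n) & e0]
      k 0 (kap + 1) 2 (100 + 20 * kap) kap.
    - by apply: run_le; first exact: (runi_run (runi_const _ _)); lia.
    - by apply: run_le; first exact: (runi_run (runi_const _ _)); lia.
    - exact: k'K.
    - have jK : (bitlen (Posz j.+1) <= kap)%N.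
        by apply: leq_trans k'K; apply: bitlen_mono.
      have jk1 : (j.+1 <= k.+1)%N by exact: ltnW.
      have /andP[_ H3] := pack_init_ge jk1 H1.
      have HK : (bitlen H <= kap)%N.
        apply: kapP; rewrite H1 (le_trans H3) // H2.
        by apply: le_trans YU; exact: ltW.
      exists (Posz k.+1 - Posz j.+1 + Y * H).
        by rewrite /init_body; apply: run_le; [by run_arith|lia].
      split; [exact: ltnW| |exact: H2].
      by rewrite addr_ge0 ?mulr_ge0 ?(ltW Y_gt0) // subr_ge0 lez_nat.
    - by split.
    have -> : H0 = H by rewrite -H2.
    exact: hrun'.
  eapply (run_let (u := VInt big)); first by run_arith.
  exact: hrun.
rewrite /setup_time; move: search_time (n * (N * _ + _))%N (L.*2.+1 * _)%N => t1 t2 t3.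
rewrite mulnDr; lia.
Qed.

End Search.
End Programs.

(** * Running time *)

Section TimeBound.
Variables (k m h b n kap N C : nat).
Hypotheses (hb : (h <= b)%N) (kb : (k <= b)%N) (Lb : ((m ^ 2).*2.+1 <= b)%N)
  (b80 : (80 <= b)%N) (nN : (n <= N)%N) (N0 : (0 < N)%N) (kap100 : (100 <= kap)%N)
  (C0 : (0 < C)%N).
Let y := (N * kap)%N.

Let kap0 : (0 < kap)%N.
Proof. by apply: leq_trans kap100. Qed.

Let y_ge : (100 * N <= y)%N /\ (kap <= y)%N.
Proof. by rewrite /y leq_pmull // mulnC leq_mul. Qed.

Let y0 : (0 < y)%N.
Proof. by rewrite /y muln_gt0 N0. Qed.

Let b0 : (0 < b)%N.
Proof. by apply: leq_trans b80. Qed.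

Lemma level_time_le : (level_time h kap N <= 400 * (b * y))%N.
Proof.
have [h1 h2] := y_ge; have h3 : (y <= b * y)%N by rewrite leq_pmull.
have h4 : (h * kap <= b * y)%N by rewrite leq_mul.
have h5 : (100 * h <= b * y)%N by rewrite mulnC leq_mul // (leq_trans kap100).
have e1 : (N * (500 + 100 * kap) = 500 * N + 100 * y)%N by rewrite /y; ring.
have e2 : (h * (3 * kap + 100) = 3 * (h * kap) + 100 * h)%N by ring.
rewrite /level_time e1 e2; move: (b * y)%N (h * kap)%N h3 h4 h5 => u v h3 h4 h5.
by clear -h1 h2 h3 h4 h5 y0 kap100; lia.
Qed.

Lemma weight_time_le : (weight_time m h kap N <= 500 * (b * (b * y)))%N.
Proof.
have [h1 h2] := y_ge; have h3 : (80 * y <= b * y)%N by rewrite leq_mul.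
have h4 : (b * y <= b * (b * y))%N by rewrite leq_pmull.
have h5 := level_time_le.
have h6 : (m ^ 2 * (level_time h kap N + kap + 20) <= b * (400 * (b * y) + 2 * (b * y)))%N.
  rewrite leq_mul //; first by apply: leq_trans Lb; rewrite -addnn; lia.
  by move: h5; move: (level_time _ _ _) (b * y)%N h3 {h4} => t u h3 h5; clear -h1 h2 h3 h5 y0 kap100; lia.
have e1 : (N * (1000 + 200 * kap) = 1000 * N + 200 * y)%N by rewrite /y; ring.
have e2 : (b * (400 * (b * y) + 2 * (b * y)) = 402 * (b * (b * y)))%N by ring.
rewrite /weight_time e1; move: h6; rewrite e2.
move: (m ^ 2 * _)%N (b * (b * y))%N (b * y)%N h3 h4 => u v w h3 h4 h6.
by clear -h1 h2 h3 h4 h6 y0 kap100; lia.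
Qed.

Lemma weights_time_le : (weights_time m h n kap N <= 600 * (N * (b * (b * y))))%N.
Proof.
have h3 : (80 * 1 <= b * (b * y))%N by rewrite leq_mul // !muln_gt0 ?b0 ?N0 ?kap0.
have h4 : (80 * 1 <= N * (b * (b * y)))%N by apply: leq_trans h3 _; rewrite leq_pmull.
rewrite /weights_time; have := weight_time_le.
move: (b * (b * y))%N (weight_time _ _ _ _) h3 h4 => u t h3 h4 h5.
have h6 : (n * (t + 50) <= N * (500 * u + u))%N.
  by apply: leq_mul nN _; clear -h3 h5; lia.
have e : (N * (500 * u + u) = 501 * (N * u))%N by ring.
by move: h6 h4; rewrite e; move: (n * _)%N (N * u)%N => v w; clear; lia.
Qed.

Lemma value_time_le : (value_time n kap N <= 5 * (b * b * (N * (N * (N * y)))))%N.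
Proof.
have [h1 h2] := y_ge.
have hy : (y <= N * y)%N by rewrite leq_pmull.
have next_le : (next_time n kap N <= 230 * (N * y))%N.
  have e1 : (N * (2000 + 200 * kap) + 40 = 2000 * N + 200 * y + 40)%N by rewrite /y; ring.
  have h4 : (n * (N * (2000 + 200 * kap) + 40) <= N * (20 * y + 200 * y + y))%N.
    by apply: leq_mul nN _; rewrite e1; clear -h1 h2 y0 kap100; lia.
  have e : (N * (20 * y + 200 * y + y) = 221 * (N * y))%N by ring.
  rewrite /next_time; move: h4; rewrite e; move: (n * _)%N (N * y)%N hy => u v hy.
  by clear -hy h2 y0 kap100; lia.
have item_le : (item_time kap N <= 330 * y)%N.
  have e1 : (N * (500 + 100 * kap) = 500 * N + 100 * y)%N by rewrite /y; ring.
  by rewrite /item_time e1; clear -h1 h2 y0 kap100; lia.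
have items_le : (items_time n kap N <= 350 * (N * y))%N.
  have h4 : (n * (item_time kap N + 50) <= N * (330 * y + y))%N.
    by apply: leq_mul nN _; move: item_le; move: (item_time _ _) => t; clear -h2 y0 kap100; lia.
  have e : (N * (330 * y + y) = 331 * (N * y))%N by ring.
  rewrite /items_time; move: h4; rewrite e; move: (n * _)%N (N * y)%N hy => u v hy.
  by clear -hy h2 y0 kap100; lia.
have step_le : (step_time n kap N + 12 <= b * b * (N * y))%N.
  apply: (@leq_trans (80 * 80 * (N * y))%N); last by rewrite leq_mul // leq_mul.
  rewrite /step_time; move: next_le items_le; move: (next_time _ _ _) (items_time _ _ _) (N * y)%N hy.
  by move=> t1 t2 u hy; clear -hy h2 y0 kap100; lia.
have h5 : (N * (step_time n kap N + 12) + 40 <= 2 * (b * b * (N * (N * y))))%N.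
  have h6 := leq_mul (leqnn N) step_le.
  have e : (N * (b * b * (N * y)) = b * b * (N * (N * y)))%N by ring.
  have h7 : (40 <= b * b * (N * (N * y)))%N.
    apply: (@leq_trans (80 * 80 * 1)%N) => //; rewrite leq_mul // ?leq_mul //.
    by rewrite !muln_gt0 ?b0 ?N0 ?kap0 ?C0.
  by move: h6; rewrite e => h6; rewrite mul2n -addnn leq_add.
have h6 := leq_mul nN h5.
have e : (N * (2 * (b * b * (N * (N * y)))) = 2 * (b * b * (N * (N * (N * y)))))%N by ring.
have h7 : (80 * 80 * 1 <= b * b * (N * (N * (N * y))))%N.
  by rewrite leq_mul // ?leq_mul // !muln_gt0 ?b0 ?N0 ?kap0 ?C0.
rewrite /value_time; move: h6 h7; rewrite e; move: (n * _)%N (b * b * _)%N => u v.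
by clear; lia.
Qed.

Lemma query_time_le : (query_time n kap N C <= 7 * (b * b * (N * (N * (N * y)))) * C)%N.
Proof.
have [h1 h2] := y_ge; have h3 := value_time_le.
have h4 : (y <= N * (N * (N * y)))%N.
  by rewrite mulnA mulnA leq_pmull // !muln_gt0 ?b0 ?N0 ?kap0 ?C0.
have h5 : (600 * y <= b * b * (N * (N * (N * y))))%N.
  by apply: leq_mul => //; apply: leq_trans (leq_mul b80 b80).
have h6 : (0 < b * b * (N * (N * (N * y))))%N by rewrite !muln_gt0 ?b0 ?N0 ?kap0 ?C0.
rewrite /query_time; move: (b * b * _)%N h3 h5 h6 => u h3 h5 h6.
have h7 : (C <= u * C)%N by rewrite leq_pmull.
have h8 : (u <= u * C)%N by rewrite leq_pmulr.
rewrite -mulnA; move: (value_time _ _ _) (u * C)%N h3 h7 h8 => t v h3 h7 h8.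
by clear -h2 h3 h5 h7 h8 y0 kap100; lia.
Qed.

Variable P : nat.
Hypothesis P0 : (0 < P)%N.

(** [P] stands for the number of targets. The numerical constants add up to at most 80 * 80 and are
    absorbed by two of the factors b, as b >= 80. *)
Lemma search_time_le :
  (kap * ((weights_time m h n kap N + P * (query_time n kap N C + kap + 20) + 500 + 100 * kap) + kap + 20)
     + 200 + kap <= b ^ 4 * (N ^ 4 * (kap ^ 2 * (C * P))))%N.
Proof.
have [h1 h2] := y_ge.
pose u := (b * b * (N * (N * (N * y))))%N.
have u0 : (0 < u)%N by rewrite !muln_gt0 ?b0 ?N0 ?kap0 ?C0.
have yu : (600 * y <= u)%N.
  apply: leq_mul => //; first by apply: leq_trans (leq_mul b80 b80).
  by rewrite mulnA mulnA leq_pmull // !muln_gt0 ?b0 ?N0 ?kap0 ?C0.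
have wu : (weights_time m h n kap N <= 600 * u)%N.
  apply: leq_trans weights_time_le _; rewrite leq_mul2l; apply/orP; right.
  rewrite (_ : N * (b * (b * y)) = b * b * (N * y))%N; last by ring.
  by rewrite leq_mul // leq_mul // mulnA leq_pmull // muln_gt0 N0.
have qu := query_time_le; rewrite -/u in qu.
pose v := (u * (C * P))%N.
have uv : (u <= v)%N by rewrite leq_pmulr // muln_gt0 C0.
have q1 : (P * (query_time n kap N C + kap + 20) <= 9 * v)%N.
  rewrite (_ : 9 * v = P * (9 * (u * C)))%N; last by rewrite /v; ring.
  rewrite leq_mul2l; apply/orP; right.
  have uC : (u <= u * C)%N by rewrite leq_pmulr.
  move: qu; rewrite -mulnA; move: (query_time _ _ _ _) (u * C)%N uC => t w uC qu.
  by clear -yu uC h2 qu y0; lia.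
have tot : ((weights_time m h n kap N + P * (query_time n kap N C + kap + 20) + 500 + 100 * kap) + kap + 20
   + 201 <= 80 * 80 * v)%N.
  move: q1 wu.
  move: (P * _)%N (weights_time _ _ _ _ _) => t1 t2 q1 wu.
  by clear -q1 wu yu uv h2 y0 kap100; lia.
have e : (b ^ 4 * (N ^ 4 * (kap ^ 2 * (C * P))) = kap * (b * b * v))%N by rewrite /v /u /y; ring.
rewrite e; apply: (@leq_trans (kap * (80 * 80 * v))%N).
  apply: (leq_trans _ (leq_mul (leqnn kap) tot)); move: (_ + _ + 20)%N => t.
  have := kap0; clear; nia.
by rewrite leq_mul2l leq_mul ?orbT // leq_mul.
Qed.

Lemma setup_time_le : (setup_time k m n kap N <= b ^ 4 * (N ^ 4 * (kap ^ 2 * (C * P))))%N.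
Proof.
have [h1 h2] := y_ge.
have e1 : (N * (300 + 40 * kap) + 40 = 300 * N + 40 * y + 40)%N by rewrite /y; ring.
have s1 : (n * (N * (300 + 40 * kap) + 40) <= N * (380 * y))%N.
  by apply: leq_mul nN _; rewrite e1; clear -h1 h2 y0 kap100; lia.
have s2 : (n * (kap + 30) <= N * (31 * y))%N.
  by apply: leq_mul nN _; clear -h2 y0 kap100; lia.
have s3 : ((m ^ 2).*2.+1 * (3 * kap + 100) <= b * (103 * y))%N.
  by apply: leq_mul Lb _; clear -h2 y0 kap100; lia.
have s4 : (n * (3 * kap + 100) <= N * (103 * y))%N.
  by apply: leq_mul nN _; clear -h2 y0 kap100; lia.
have s5 : (k * (500 + 100 * kap) <= b * (600 * y))%N.
  by apply: leq_mul kb _; clear -h2 y0 kap100; lia.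
have b1 : (N * y <= b * (N * y))%N by rewrite leq_pmull.
have b2 : (b * y <= b * (N * y))%N by rewrite leq_mul // leq_pmull.
have b3 : (y <= b * y)%N by rewrite leq_pmull.
have t1 : (setup_time k m n kap N <= 80 * 80 * (b * (N * y)))%N.
  rewrite /setup_time.
  have e2 : (N * (380 * y) = 380 * (N * y))%N by ring.
  have e3 : (N * (31 * y) = 31 * (N * y))%N by ring.
  have e4 : (N * (103 * y) = 103 * (N * y))%N by ring.
  have e5 : (b * (103 * y) = 103 * (b * y))%N by ring.
  have e6 : (b * (600 * y) = 600 * (b * y))%N by ring.
  move: s1 s2 s3 s4 s5; rewrite e2 e3 e4 e5 e6.
  move: (n * (N * _ + _))%N (n * (kap + _))%N ((m ^ 2).*2.+1 * _)%N (n * (3 * kap + _))%N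
     (k * _)%N (b * (N * y))%N (N * y)%N (b * y)%N b1 b2 b3.
  by move=> a1 a2 a3 a4 a5 a6 a7 a8; clear -h2 y0 kap100; lia.
apply: leq_trans t1 _.
rewrite (_ : b ^ 4 * (N ^ 4 * (kap ^ 2 * (C * P))) =
   (b * b) * (b * (N * y)) * (b * (N * (N * (kap * (C * P))))))%N; last by rewrite /y; ring.
apply: leq_trans (leq_pmulr _ _); last by rewrite !muln_gt0 ?b0 ?N0 ?kap0 ?C0.
by rewrite leq_mul // leq_mul.
Qed.

End TimeBound.

(** Setup and search obey the same bound; doubling it costs one more factor b. *)
Lemma total_time_le k m h b n kap N C :
  (h <= b)%N -> (k <= b)%N -> ((m ^ 2).*2.+1 <= b)%N -> (80 <= b)%N -> (n <= N)%N ->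
  (0 < N)%N -> (100 <= kap)%N -> (0 < C)%N ->
  (setup_time k m n kap N + search_time k m h b n kap N C <=
   b ^ 5 * (N ^ 4 * (kap ^ 2 * (C * (n * radix n k m h b ^ (m ^ 2).*2.+1).+1))))%N.
Proof.
move=> hb kb Lb b80 nN N0 kap100 C0.
set P := (_ * _).+1; have P0 : (0 < P)%N by [].
have h1 := setup_time_le kb Lb b80 nN N0 kap100 C0 P0.
have h2 : (search_time k m h b n kap N C <= _)%N :=
  search_time_le hb kb Lb b80 nN N0 kap100 C0 P0.
apply: leq_trans (leq_add h1 h2) _.
rewrite addnn -mul2n [in X in (_ <= X)%N]expnS -[X in (_ <= X)%N]mulnA leq_mul //.
exact: leq_trans b80.
Qed.

(** * Bit lengths against the size of the instance *)

Section Sizes.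

Lemma bitlenM (x y : int) : (bitlen (x * y) <= bitlen x + bitlen y)%N.
Proof. by apply: bitlen_le_exp; rewrite abszM expnD ltn_mul ?bitlenP. Qed.

Lemma bitlen_mul_le (x y : int) u v :
  (bitlen x <= u)%N -> (bitlen y <= v)%N -> (bitlen (x * y) <= u + v)%N.
Proof. by move=> h1 h2; apply: leq_trans (bitlenM _ _) (leq_add h1 h2). Qed.

Lemma bitlenX (x : int) e : (0 < e)%N -> (bitlen (x ^+ e) <= e * bitlen x)%N.
Proof.
case: e => // e _; elim: e => [|e ih]; first by rewrite expr1 mul1n.
by rewrite exprS mulSn; apply: leq_trans (bitlenM _ _) _; rewrite leq_add2l.
Qed.

Lemma bitlen_succ (x : nat) : (bitlen (Posz x.+1) <= bitlen (Posz x) + 1)%N.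
Proof.
apply: bitlen_le_exp; have := bitlenP (Posz x); rewrite expnD expn1.
by move: (2 ^ _)%N => p /=; lia.
Qed.

Lemma size_enc_seq (vs : seq value) :
  (\sum_(v <- vs) (value_size v).+1 < value_size (enc_seq vs))%N.
Proof.
elim: vs => [|v vs ih]; first by rewrite big_nil.
by rewrite big_cons /=; lia.
Qed.

Variables (n : nat) (X : 'I_n -> seq (rat * rat)) (code : seq bool).
Let S := value_size (enc_instance code X).

Lemma size_instance :
  (\sum_(i < n) (\sum_(am <- X i) (value_size (enc_atom am)).+1).+2 < S)%N.
Proof.
have h := size_enc_seq [seq enc_dist (X i) | i <- enum 'I_n].
apply: (@leq_ltn_trans (value_size (enc_seq [seq enc_dist (X i) | i <- enum 'I_n]))).
  apply: leq_trans (ltnW h); rewrite big_map big_enum /=; apply: leq_sum => i _.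
  by rewrite ltnS; apply: leq_ltn_trans (size_enc_seq _); rewrite big_map.
by rewrite /S /enc_instance /=; lia.
Qed.

Lemma n_le_size : (n < S)%N.
Proof.
apply: leq_ltn_trans size_instance; rewrite -{1}[n]card_ord -sum1_card.
by apply: leq_sum => i _.
Qed.

Lemma item_le_size i : (\sum_(am <- X i) (value_size (enc_atom am)).+1 <= S)%N.
Proof.
apply: leq_trans (ltnW size_instance); rewrite (bigD1 i) //=.
by apply: leq_trans (leq_addr _ _); rewrite -addn2 leq_addr.
Qed.

Lemma item_size_le i : (size (X i) <= S)%N.
Proof.
apply: leq_trans (item_le_size i); rewrite -sum1_size.
exact: leq_sum.
Qed.

Lemma atom_le_size am : am \in all_atoms X -> (value_size (enc_atom am) <= S)%N.
Proof.
move=> /mem_all_atoms[i h]; apply: leq_trans (item_le_size i).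
by rewrite (big_rem am) //=; apply: leq_trans (leqnSn _) (leq_addr _ _).
Qed.

Lemma small_atom_size kap am : (S <= kap)%N -> am \in all_atoms X -> small_atom kap am.
Proof.
move=> h /atom_le_size; rewrite /enc_atom /enc_rat /=.
by move=> h'; split; apply: leq_trans h; apply: leq_trans h'; lia.
Qed.

Hypothesis hX : forall i, nonneg_dist (X i).

Lemma atom_weight_lt am : nonneg_atom am ->
  (`|atom_weight am| <= 2 ^ value_size (enc_atom am))%N.
Proof.
case=> h1 h2; rewrite /atom_weight !abszM.
apply: (@leq_trans (2 ^ (bitlen (numq am.1) + bitlen (denq am.1) + bitlen (denq am.2)))).
  rewrite !expnD !leq_mul //; last 2 first.
  - exact: ltnW (bitlenP _).
  - exact: ltnW (bitlenP _).
  have := bitlenP (numq am.1); have : 0 <= numq am.1 by rewrite numq_ge0.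
  by move: (numq _) (2 ^ _)%N => q p; lia.
by rewrite leq_exp2l // /enc_atom /enc_rat /=; lia.
Qed.

(** Each atom weight is at most 2 to the size of the encoding of its atom, and these sizes add up
    along the instance: a plain product of weights therefore has linear length. *)
Lemma bitlen_common_den : (bitlen (common_den (all_atoms X)) <= S)%N.
Proof.
have h : (`|common_den (all_atoms X)| <= 2 ^ \sum_(am <- all_atoms X) value_size (enc_atom am))%N.
  rewrite common_denE; have := all_atoms_nonneg hX; elim: (all_atoms X) => [|am s ih] hs.
    by rewrite !big_nil.
  rewrite !big_cons abszM expnD leq_mul //.
    by apply: atom_weight_lt; apply: hs; rewrite mem_head.
  by apply: ih => am' h'; apply: hs; rewrite inE h' orbT.
apply: bitlen_le_exp; apply: leq_ltn_trans h _; rewrite ltn_exp2l //.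
apply: leq_ltn_trans size_instance.
rewrite /all_atoms big_flatten big_map big_enum /=; apply: leq_sum => i _.
by apply: leq_trans (leqW (leqW (leqnn _))); apply: leq_sum.
Qed.

End Sizes.

(** * A common bound for the integers of a run *)

Section Bounds.
Variables (n : nat) (X : 'I_n -> seq (rat * rat)).
Hypothesis hX : forall i, nonneg_dist (X i).
Variables (k m h b : nat).
Hypotheses (n0 : (0 < n)%N) (k0 : (0 < k)%N) (kb : (k.+1 <= b)%N)
  (Lb : ((m ^ 2).*2.+1 <= b)%N) (Kb : (m * k.+1 <= b)%N) (hb : (h <= b)%N)
  (h0 : (0 < h)%N) (m0 : (0 < m)%N) (b80 : (80 <= b)%N).
Let Z := common_den (all_atoms X).
Let B := radix n k m h b.
Let M := (B ^ (m ^ 2).*2.+1)%N.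
Let top : int := Posz k * Z ^+ n.
Let Y : int := top + 1.
Let big : int := Posz (m * k.+1) * (Z * Z * Z).
Let consts := ((m ^ 2).*2.+1 * h * b * k.+1 * (m * k.+1))%N.
Let PM := (n * M).+1.

(** Every quantity to be bounded is dominated by some of the factors, and all factors are at least
    1, so each estimate reduces to [factor_bound]. *)
Definition int_bound : int :=
  Posz consts * Posz PM * (Z * big * top) * Y ^+ k.

Let factor_bound (x r U : int) : 0 <= x -> 1 <= r -> U = x * r -> x <= U.
Proof. by move=> x0 r1 ->; rewrite ler_peMr. Qed.

Let Z0 : 1 <= Z.
Proof. by rewrite -gtz0_ge1; exact: Z_gt0. Qed.

Let mul1 (x y : int) : 1 <= x -> 1 <= y -> 1 <= x * y.
Proof. by move=> x1 y1; rewrite mulr_ege1. Qed.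

Ltac prod_ge1 := repeat first [assumption | apply: mul1].

Let big0 : 1 <= big.
Proof. by rewrite !mul1 // lez_nat muln_gt0 m0. Qed.

Let top0 : 1 <= top.
Proof. by apply: mul1; rewrite ?lez_nat // exprn_ege1. Qed.

Let Y0 : 1 <= Y ^+ k.
Proof. by rewrite exprn_ege1 // /Y; move: top0; clear; lia. Qed.

Let L0 : (0 < m ^ 2)%N.
Proof. by rewrite expn_gt0 m0. Qed.

Let b0 : (0 < b)%N.
Proof. exact: leq_trans b80. Qed.

Let consts0 : (0 < consts)%N.
Proof. by rewrite !muln_gt0 h0 b0 m0. Qed.

Let c1 : 1 <= Posz consts.
Proof. by rewrite lez_nat. Qed.

Let p1 : 1 <= Posz PM.
Proof. by []. Qed.

Lemma const_le_bound (x : nat) : (x <= consts)%N -> Posz x <= int_bound.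
Proof.
move=> h'; apply: le_trans (_ : Posz consts <= _); first by rewrite lez_nat.
apply: (@factor_bound _ (Posz PM * (Z * big * top) * Y ^+ k)) => //.
  by prod_ge1.
by rewrite /int_bound !mulrA.
Qed.

Lemma magnitude_le_bound (x : nat) : (x <= PM)%N -> Posz x <= int_bound.
Proof.
move=> h'; apply: le_trans (_ : Posz PM <= _); first by rewrite lez_nat.
apply: (@factor_bound _ (Posz consts * (Z * big * top) * Y ^+ k)) => //.
  by prod_ge1.
by rewrite /int_bound; ring.
Qed.

Lemma scaling_le_bound :
  [/\ Z <= int_bound, Posz (m ^ 2) * big <= int_bound, big * top <= int_bound,
      Posz n * (Z * big) <= int_bound & Y ^+ k <= int_bound].
Proof.
have pos (x : int) : 1 <= x -> 0 <= x by apply: le_trans.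
split.
- apply: (@factor_bound _ (Posz consts * Posz PM * (big * top) * Y ^+ k)).
  + exact: pos.
  + by prod_ge1.
  + by rewrite /int_bound; ring.
- apply: le_trans (_ : Posz consts * big <= _).
    rewrite ler_wpM2r ?pos // lez_nat; apply: (@leq_trans (m ^ 2).*2.+1).
      by rewrite -addnn; lia.
    by rewrite /consts -!mulnA leq_pmulr // !muln_gt0 h0 b0 m0.
  apply: (@factor_bound _ (Posz PM * (Z * top) * Y ^+ k)).
  + by apply: pos; prod_ge1.
  + by prod_ge1.
  + by rewrite /int_bound; ring.
- apply: (@factor_bound _ (Posz consts * Posz PM * Z * Y ^+ k)).
  + by apply: pos; prod_ge1.
  + by prod_ge1.
  + by rewrite /int_bound; ring.
- apply: le_trans (_ : Posz PM * (Z * big) <= _).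
    rewrite ler_wpM2r //; first by apply: pos; prod_ge1.
    by rewrite lez_nat /PM leqW // leq_pmulr // expn_gt0.
  apply: (@factor_bound _ (Posz consts * top * Y ^+ k)).
  + by apply: pos; prod_ge1.
  + by prod_ge1.
  + by rewrite /int_bound; ring.
- apply: (@factor_bound _ (Posz consts * Posz PM * (Z * big * top))).
  + by apply: pos.
  + by prod_ge1.
  + by rewrite /int_bound; ring.
Qed.

Lemma consts_bounds :
  [/\ (m ^ 2 * h <= consts)%N, (m ^ 2 <= consts)%N, (m * k.+1 <= consts)%N,
      (b <= consts)%N & ((m ^ 2).*2.+1 <= consts)%N /\ (k.+1 <= consts)%N].
Proof.
have L2 : (m ^ 2 <= (m ^ 2).*2.+1)%N by rewrite -addnn; lia.
have c : consts = ((m ^ 2).*2.+1 * h * b * k.+1 * (m * k.+1))%N by [].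
have c2 : ((m ^ 2).*2.+1 * h <= consts)%N.
  by rewrite c -!mulnA !leq_mul // leq_pmulr // !muln_gt0 b0 m0.
have c3 : ((m ^ 2).*2.+1 <= consts)%N by apply: leq_trans c2; rewrite leq_pmulr.
split.
- by apply: leq_trans c2; rewrite leq_mul.
- exact: leq_trans c3.
- by rewrite c leq_pmull // !muln_gt0 h0 b0.
- by rewrite c -!mulnA (mulnCA h) (mulnCA _ b) leq_pmulr // !muln_gt0 h0 m0.
split=> //; apply: (@leq_trans (m * k.+1)); first by rewrite leq_pmull.
by rewrite c leq_pmull // !muln_gt0 h0 b0.
Qed.

Lemma radix_bounds :
  [/\ (n <= PM)%N, (coord_max n k m h b <= PM)%N & (B <= PM)%N].
Proof.
have B0 : (0 < B)%N by [].
have M0 : (0 < M)%N by rewrite expn_gt0.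
have h1 : (B <= M)%N by rewrite /M expnS leq_pmulr // expn_gt0.
have h2 : (M <= PM)%N by rewrite /PM leqW // leq_pmull.
split.
- by rewrite /PM leqW // leq_pmulr.
- by apply: leq_trans (leq_trans h1 h2); rewrite /B /radix leqW // leq_pmull.
- exact: leq_trans h2.
Qed.

End Bounds.

Section BitBound.
Variables (n : nat) (X : 'I_n -> seq (rat * rat)) (code : seq bool).
Hypothesis hX : forall i, nonneg_dist (X i).
Variables (k m h b : nat).
Hypotheses (n0 : (0 < n)%N) (k0 : (0 < k)%N) (kb : (k.+1 <= b)%N)
  (Lb : ((m ^ 2).*2.+1 <= b)%N) (Kb : (m * k.+1 <= b)%N) (hb : (h <= b)%N)
  (h0 : (0 < h)%N) (m0 : (0 < m)%N) (b80 : (80 <= b)%N).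
Let Z := common_den (all_atoms X).
Let B := radix n k m h b.
Let M := (B ^ (m ^ 2).*2.+1)%N.
Let top : int := Posz k * Z ^+ n.
Let Y : int := top + 1.
Let big : int := Posz (m * k.+1) * (Z * Z * Z).
Let consts := ((m ^ 2).*2.+1 * h * b * k.+1 * (m * k.+1))%N.
Let PM := (n * M).+1.

Let S := value_size (enc_instance code X).

Definition bit_bound : nat := (bitlen (int_bound X k m h b) + S + 100)%N.

Let S0 : (0 < S)%N.
Proof. by exact: leq_ltn_trans (n_le_size X code). Qed.

Let bitle (x c : nat) : (x <= c)%N -> (bitlen (Posz x) <= c)%N.
Proof. by move=> h'; apply: leq_trans (bitlen_cst x) h'. Qed.

Let nS : (bitlen (Posz n) <= S)%N.
Proof. by apply: bitle; apply: ltnW; exact: (n_le_size X code). Qed.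

Lemma bitlen_radix : (bitlen (Posz B) <= 2 * S + b * b + 3 * b + 1)%N.
Proof.
have h1 : (bitlen (Posz (b ^ h)) <= b * b)%N.
  rewrite -exprz_nat; apply: leq_trans (bitlenX _ h0) _; rewrite leq_mul //.
  exact: bitle.
have h2 : (bitlen (Posz (coord_max n k m h b)) <= S + (b + b + b + b * b))%N.
  have e1 : (bitlen (Posz k) <= b)%N by apply: bitle; exact: ltnW.
  have e2 : (bitlen (Posz (m ^ 2)) <= b)%N.
    by apply: bitle; apply: leq_trans Lb; rewrite -addnn; lia.
  have e3 : (bitlen (Posz h) <= b)%N by exact: bitle.
  by rewrite /coord_max !PoszM; do !apply: bitlen_mul_le.
rewrite /B /radix; apply: leq_trans (bitlen_succ _) _; rewrite PoszM.
have := bitlenM (Posz n) (Posz (coord_max n k m h b)); move: nS h2.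
by move: (bitlen _) (bitlen _) (bitlen _) (b * b)%N => t1 t2 t3 t4; lia.
Qed.

(** The quadratic term in S comes from Z ^ n, through [top] and Y ^ k; the highest power of b comes
    from the radix, whose length is of order b ^ 2 + S and whose exponent is at most b. Constants
    and lower terms are absorbed using b >= 80. *)
Lemma bitlen_int_bound : (bit_bound <= b ^ 4 * S ^ 2)%N.
Proof.
have Z0 : 0 < Z by exact: Z_gt0.
have ZS : (bitlen Z <= S)%N := bitlen_common_den code hX.
have c1 : (bitlen (Posz consts) <= b + b + b + b + b)%N.
  rewrite /consts 4!PoszM.
  by do 4![apply: bitlen_mul_le; last exact: bitle]; exact: bitle.
have c2 : (bitlen (Posz PM) <= S + b * (2 * S + b * b + 3 * b + 1) + 1)%N.
  rewrite /PM; apply: leq_trans (bitlen_succ _) _; rewrite leq_add2r PoszM.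
  apply: leq_trans (bitlenM _ _) _; rewrite leq_add // /M -exprz_nat.
  by apply: leq_trans (bitlenX _ _) _ => //; rewrite leq_mul // bitlen_radix.
have c3 : (bitlen big <= b + (S + S + S))%N.
  by apply: bitlen_mul_le; [exact: bitle | do 2![apply: bitlen_mul_le; last by []]].
have c4 : (bitlen top <= b + S * S)%N.
  rewrite /top; apply: leq_trans (bitlenM _ _) _; rewrite leq_add //.
    by apply: bitle; exact: ltnW.
  by apply: leq_trans (bitlenX _ n0) _; rewrite leq_mul // ltnW // (n_le_size X code).
have c5 : (bitlen (Y ^+ k) <= b * (b + S * S + 2))%N.
  apply: leq_trans (bitlenX _ k0) _; rewrite leq_mul ?(ltnW kb) //.
  apply: leq_trans (bitlen_arith OpAdd top 1) _.
  have := bitlen_cst 1; move: c4; rewrite -[Posz 1]/(1 : int); lia.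
have c6 : (bitlen (int_bound X k m h b) <= bitlen (Posz consts) + bitlen (Posz PM) +
    (bitlen Z + bitlen big + bitlen top) + bitlen (Y ^+ k))%N.
  rewrite /int_bound; apply: leq_trans (bitlenM _ _) _; rewrite leq_add2r.
  apply: leq_trans (bitlenM _ _) _; apply: leq_add; first exact: bitlenM.
  by apply: leq_trans (bitlenM _ _) _; rewrite leq_add2r bitlenM.
rewrite /bit_bound; move: c6 c1 c2 c3 c4 c5 ZS.
move: (bitlen (int_bound X k m h b)) (bitlen (Posz consts)) (bitlen (Posz PM)) (bitlen Z)
  (bitlen big) (bitlen top) (bitlen (Y ^+ k)).
clearbody S; clear -S0 b80 => t1 t2 t3 t4 t5 t6 t7 c6 c1 c2 c3 c4 c5 ZS.
have p1 : (b * b * b <= b * b * b * (S * S))%N by rewrite leq_pmulr // muln_gt0 S0.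
have p2 : (80 * (b * b) <= b * b * b * (S * S))%N.
  by rewrite (_ : b * b * b * (S * S) = b * (b * b) * (S * S))%N ?leq_pmulr; [apply: leq_trans (leq_pmulr _ _); rewrite ?leq_mul ?muln_gt0 ?S0|ring].
have p3 : (80 * (b * (S * S)) <= b * b * b * (S * S))%N.
  rewrite (_ : b * b * b * (S * S) = b * (b * (b * (S * S))))%N; last by ring.
  by rewrite leq_mul // leq_pmull //; apply: leq_trans b80.
have p4 : (S <= S * S)%N by rewrite leq_pmulr.
have p5 : (80 * (S * S) <= b * (S * S))%N by rewrite leq_mul.
have p6 : (b * S <= b * (S * S))%N by rewrite leq_mul.
have p7 : (80 * b <= b * b)%N by rewrite leq_mul.
have p8 : (80 * (b * b * b * (S * S)) <= b ^ 4 * S ^ 2)%N.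
  rewrite (_ : b ^ 4 * S ^ 2 = b * (b * b * b * (S * S)))%N; last by ring.
  by rewrite leq_mul.
have e2 : (b * (2 * S + b * b + 3 * b + 1) = 2 * (b * S) + b * b * b + 3 * (b * b) + b)%N by ring.
have e5 : (b * (b + S * S + 2) = b * b + b * (S * S) + 2 * b)%N by ring.
move: c2 c5; rewrite e2 e5 => c2 c5.
apply: leq_trans p8.
move: (b * b * b * (S * S))%N p1 p2 p3 => w p1 p2 p3.
by rewrite -!addnA; lia.
Qed.

End BitBound.

(** * Choice of the parameters *)

Section Tuning.
Variables (R : realType) (k : nat) (eps : R).

(** An integer above Lambda. With it, m > 1 / eps, h >= Lambda m ^ 2 and b > Lambda h, as
    [weight_transfer] and [covers_near_opt] require. *)
Definition saturation_mean : nat := (Num.trunc (Lambda 4 k eps)).+1.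
Definition mesh : nat := (Num.trunc eps^-1).+1.
Definition mass_grid : nat := (saturation_mean * mesh ^ 2)%N.
Definition code_base : nat := (saturation_mean * mass_grid).+1.

Hypotheses (k0 : (0 < k)%N) (eps0 : 0 < eps) (eps2 : eps < 1 / 2).
Local Notation lam := (Lambda 4 k eps).
Local Notation e := (eps^-1).

Let e2 : 2 < e.
Proof. have h := eps2; rewrite -(ltr_pM2r eps0) mulVf ?gt_eqF //; lra. Qed.

Let k1 : (1 : R) <= k%:R.
Proof. by rewrite ler1n. Qed.

Lemma ln2_ge : 1 / 2 <= ln (2 : R).
Proof.
have := @le_ln1Dx R (- (1 / 2)); have -> : (1 + - (1 / 2) : R) = 2^-1 by field.
rewrite lnV ?posrE // => h; have {h} : - ln 2 <= - (1 / 2) :> R by apply: h; lra.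
by lra.
Qed.

(** Since k / eps >= 2 and ln 2 >= 1 / 2, the logarithmic term is at least 2. *)
Lemma lambda_ge : 2 * k%:R + 2 <= lam.
Proof.
rewrite /Lambda lerD2l; have h := ln2_ge.
have h1 : 2 <= k%:R * e by rewrite -[2]mul1r ler_pM // ltW.
have : ln 2 <= ln (k%:R * e) by rewrite ler_ln ?posrE // (lt_le_trans _ h1).
by lra.
Qed.

Let lam4 : 4 <= lam.
Proof. by have := lambda_ge; have := k1; lra. Qed.

(** Adding 1 to 1 / eps > 2 costs a factor of at most 3 / 2; the factor 5 / 4 for [saturation_mean]
    arises likewise from Lambda >= 4. *)
Lemma mesh_itv : e < mesh%:R <= 3 / 2 * e.
Proof.
have /andP[h1 h2] := truncn_itv (ltW (lt_trans (ltr0n R 2) e2)).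
by have h3 := e2; rewrite h2 /mesh -natr1; lra.
Qed.

Lemma saturation_mean_itv : lam < saturation_mean%:R <= 5 / 4 * lam.
Proof.
have /andP[h1 h2] := truncn_itv (le_trans (ler0n R 4) lam4).
by have h3 := lam4; rewrite h2 /saturation_mean -natr1; lra.
Qed.

Lemma mesh_gt2 : (2 < mesh)%N.
Proof. by have /andP[h _] := mesh_itv; have := e2; rewrite -(ltr_nat R); lra. Qed.

Lemma saturation_mean_gt : (k.*2.+2 < saturation_mean)%N.
Proof.
have /andP[h _] := saturation_mean_itv; have := lambda_ge.
by rewrite -(ltr_nat R) -addnn -addn2 !natrD; lra.
Qed.

Lemma mass_grid_ge : lam * (mesh ^ 2)%:R <= mass_grid%:R.
Proof.
rewrite /mass_grid natrM ler_wpM2r //.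
by have /andP[/ltW] := saturation_mean_itv.
Qed.

Lemma code_base_gt : lam * mass_grid%:R < code_base%:R.
Proof.
rewrite /code_base -[ltRHS]natr1 natrM; apply: ltr_pwDr => //; rewrite ler_wpM2r //.
by have /andP[/ltW] := saturation_mean_itv.
Qed.

Lemma eps_sqr_le : eps ^+ 2 <= 6 / (mesh ^ 2)%:R.
Proof.
have /andP[h1 h2] := mesh_itv.
have m0 : (0 : R) < mesh%:R by rewrite ltr0n.
rewrite natrX ler_pdivlMr ?exprn_gt0 // -exprMn.
have h3 : eps * mesh%:R <= 3 / 2.
  have : eps * mesh%:R <= eps * (3 / 2 * e) by rewrite ler_wpM2l // ltW.
  by rewrite mulrCA divff ?gt_eqF // mulr1.
have h4 : 0 < eps * mesh%:R by rewrite mulr_gt0.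
by rewrite expr2; nra.
Qed.

Lemma code_base_bounds :
  [/\ (80 <= code_base)%N, (k.+1 <= code_base)%N, ((mesh ^ 2).*2.+1 <= code_base)%N,
      (mesh * k.+1 <= code_base)%N & (mass_grid <= code_base)%N].
Proof.
have h1 := mesh_gt2; have h2 := saturation_mean_gt.
have m1 : (3 * mesh <= mesh ^ 2)%N by rewrite expnS expn1 leq_mul.
have h5 : (3 * mesh ^ 2 <= mass_grid)%N by rewrite /mass_grid leq_mul //; lia.
have h6 : (3 * mass_grid <= saturation_mean * mass_grid)%N by rewrite leq_mul //; lia.
have h7 : (k.+1 * mesh <= mass_grid)%N.
  by rewrite /mass_grid leq_mul //; lia.
have h8 : (k.+1 * 1 <= k.+1 * mesh)%N by rewrite leq_mul.
have h9 : (5 * mesh ^ 2 <= mass_grid)%N by rewrite /mass_grid leq_mul //; lia.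
have h10 : (5 * mass_grid <= saturation_mean * mass_grid)%N by rewrite leq_mul //; lia.
rewrite /code_base [(mesh * k.+1)%N]mulnC -addnn; split; lia.
Qed.

Variable n : nat.
Hypothesis n0 : (0 < n)%N.
Local Notation base := (k%:R * lam / eps : R).
Local Notation L2 := (mesh ^ 2).*2.+1.

Let base_ge : lam * e <= base /\ 8 <= base.
Proof.
have h : 8 <= lam * e by rewrite (_ : 8 = 4 * 2) ?ler_pM //; [exact: ltW|ring].
have h' : lam * e <= base.
  by rewrite -mulrA ler_peMl //; apply: le_trans h.
by split=> //; apply: le_trans h'.
Qed.

Let mesh_sqr_le : ((mesh ^ 2)%:R : R) <= 9 / 4 * e ^+ 2.
Proof.
have /andP[_ h] := mesh_itv; rewrite natrX.
have -> : 9 / 4 * e ^+ 2 = (3 / 2 * e) ^+ 2 by field; rewrite gt_eqF.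
by rewrite lerXn2r ?nnegrE //; have := e2; lra.
Qed.

Let x0 : 16 <= lam * e ^+ 2.
Proof. by have := e2; have := lam4; rewrite expr2; nra. Qed.

Let mass_grid_le : (mass_grid%:R : R) <= 45 / 16 * (lam * e ^+ 2).
Proof.
have /andP[_ h] := saturation_mean_itv; have h' := mesh_sqr_le.
rewrite /mass_grid natrM.
have -> : 45 / 16 * (lam * e ^+ 2) = (5 / 4 * lam) * (9 / 4 * e ^+ 2) by field; rewrite gt_eqF.
by rewrite ler_pM.
Qed.

(** b - 1 is at most 225 / 64 times (Lambda / eps) ^ 2. This constant and the added 1 are absorbed
    by a third factor of the base, which is at least 8. *)
Lemma code_base_le : (code_base%:R : R) <= base ^+ 3.
Proof.
have [h1 h2] := base_ge.
have /andP[_ h] := saturation_mean_itv; have h' := mass_grid_le; have lm := lam4.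
have h3 : (code_base%:R : R) <= 225 / 64 * (lam * e) ^+ 2 + 1.
  rewrite /code_base -natr1 lerD2r natrM.
  have -> : 225 / 64 * (lam * e) ^+ 2 = (5 / 4 * lam) * (45 / 16 * (lam * e ^+ 2)) by field; rewrite gt_eqF.
  by rewrite ler_pM.
have h4 : (lam * e) ^+ 2 <= base ^+ 2.
  by rewrite lerXn2r ?nnegrE //; [rewrite mulr_ge0 //; have := e2|]; lra.
have h5 : 8 * base ^+ 2 <= base ^+ 3 by rewrite [leRHS]exprS ler_wpM2r ?exprn_ge0 //; lra.
have h6 : 1 <= base ^+ 2 by rewrite exprn_ege1 //; lra.
by lra.
Qed.

(** The factors k, L and h of [coord_max] are each at most b; a fourth extra power of b absorbs the
    increment. *)
Lemma radix_le : (radix n k mesh mass_grid code_base <= n ^ 2 * code_base ^ (mass_grid + 4))%N.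
Proof.
have [b80 kb Lb _ hb] := code_base_bounds.
have b0 : (0 < code_base)%N by [].
have h1 : (coord_max n k mesh mass_grid code_base <= n * code_base ^ (mass_grid + 3))%N.
  have e3 : (code_base ^ 3 = code_base * code_base * code_base)%N.
    by rewrite !expnS expn0 muln1 mulnA.
  have Lb' : (mesh ^ 2 <= code_base)%N by rewrite (leq_trans _ Lb) // -addnn -addnS leq_addr.
  rewrite /coord_max leq_mul // addnC expnD leq_mul // e3.
  by apply: leq_mul hb; apply: leq_mul Lb'; exact: ltnW.
have h2 : (n * coord_max n k mesh mass_grid code_base <= n ^ 2 * code_base ^ (mass_grid + 3))%N.
  by rewrite expnS expn1 -mulnA leq_mul.
have h3 : (0 < n ^ 2 * code_base ^ (mass_grid + 3))%N by rewrite muln_gt0 !expn_gt0 n0.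
apply: (@leq_trans (2 * (n ^ 2 * code_base ^ (mass_grid + 3)))).
  by rewrite /radix mul2n -addnn -addn1 leq_add.
by rewrite [(_ + 4)%N]addnS (expnS _ (_ + 3))  [leqRHS]mulnCA leq_mul //; apply: leq_trans b80.
Qed.

Lemma magnitude_le :
  (code_base ^ 14 * radix n k mesh mass_grid code_base ^ L2
    <= n ^ (2 * L2) * code_base ^ ((mass_grid + 4) * L2 + 14))%N.
Proof.
rewrite mulnC; apply: (@leq_trans ((n ^ 2 * code_base ^ (mass_grid + 4)) ^ L2 * code_base ^ 14)).
  by rewrite leq_mul // leq_exp2r // radix_le.
by rewrite expnMn -!expnM expnD mulnA.
Qed.

(** The exponent of n is 2 (2 L + 1) <= (19 / 2) / eps ^ 2. The exponent of b is of order h L, that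
    is Lambda / eps ^ 4, tripled by [code_base_le]; since Lambda / eps ^ 2 >= 16 it fits, together
    with the power b ^ 14 spent on the running time, into 10 k Lambda ^ 2 / eps ^ 6. *)
Lemma overhead_ge :
  ((code_base ^ 14 * radix n k mesh mass_grid code_base ^ L2)%:R : R)
    <= overhead 10 n k lam eps.
Proof.
have [h1 h2] := base_ge; have xx := x0; have ee := e2; have mg := mass_grid_le.
have h4 : 1 <= e ^+ 2 by rewrite exprn_ege1 //; lra.
have L2le : (L2%:R : R) <= 19 / 4 * e ^+ 2.
  have h3 : 1 <= e ^+ 2 / 4 by rewrite expr2; nra.
  have h5 : (L2%:R : R) = (mesh ^ 2)%:R + (mesh ^ 2)%:R + 1.
    by rewrite -addnn -[LHS]natr1 natrD.
  by have := mesh_sqr_le; rewrite h5; lra.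
have n1 : (1 : R) <= n%:R by rewrite ler1n.
apply: (@le_trans _ _ ((n ^ (2 * L2) * code_base ^ ((mass_grid + 4) * L2 + 14))%:R)).
  by rewrite ler_nat magnitude_le.
rewrite natrM !natrX /overhead; apply: ler_pM => //.
- rewrite -[leLHS]powR_mulrn //; apply: ler_powR => //.
  by rewrite natrM -exprVn; lra.
apply: (@le_trans _ _ ((base ^+ 3) ^+ ((mass_grid + 4) * L2 + 14))).
  by rewrite lerXn2r ?nnegrE ?exprn_ge0 ?code_base_le //; lra.
rewrite -exprM -[leLHS]powR_mulrn; last by lra.
apply: ler_powR; first by lra.
rewrite !natrM natrD natrM natrD.
have -> : 10 * (k%:R * lam ^+ 2 / eps ^+ 6) = 10 * (k%:R * ((lam * e ^+ 2) * (lam * e ^+ 2) * e ^+ 2)).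
  by field; rewrite gt_eqF.
have h3 : (mass_grid%:R + 4) * L2%:R <= 49 / 16 * (lam * e ^+ 2) * (19 / 4 * e ^+ 2).
  by apply: ler_pM => //; lra.
clear L2le mg; move: xx h3; move: (lam * e ^+ 2) => x.
move: (e ^+ 2) h4 ((_ + 4) * _) => y y1 u xx hu.
have h5 : 0 <= (x - 16) * (x * y) by rewrite !mulr_ge0 //; lra.
have h6 : 0 <= (x - 16) * (y - 1) by rewrite mulr_ge0 //; lra.
have h7 : x * x * y <= k%:R * (x * x * y) by rewrite ler_peMl // !mulr_ge0 //; lra.
by lra.
Qed.

End Tuning.

(** * Quality of the result *)

Section Threshold.
Variables (R : realType) (n k : nat) (X : 'I_n -> seq (rat * rat)).
Hypotheses (k0 : (0 < k)%N) (hX : forall i, nonneg_dist (X i)).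
Variables (F : {set {set 'I_n}}) (T : R).
Let D i := real_dist R (X i).
Hypotheses (hF : F != finset.set0) (hT : is_surplus_threshold k D F T).
Let Z := common_den (all_atoms X).

Let hD i : is_dist (D i).
Proof. exact: D_dist. Qed.

Let T0 : 0 <= T.
Proof. by case: hT. Qed.

Lemma excess_ge0 (c : R) i : 0 <= excess (D i) c.
Proof. by apply: mean_ge0 => // x _; rewrite le_max lexx orbT. Qed.

Lemma surplus_attained : exists2 S, S \in F & \sum_(i in S) excess (D i) T = k%:R * T.
Proof.
have [_ <-] := hT; have /set0Pn[S0 h0] := hF.
pose f (S : {set 'I_n}) : R := \sum_(i in S) expect D (fun x => Num.max (x i - T) 0).
have fE S : f S = \sum_(i in S) excess (D i) T.
  by apply: eq_bigr => i _; exact: (expect1 i (fun v => Num.max (v - T) 0) hD).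
have f0 S : S \in F -> 0 <= f S.
  by move=> _; rewrite fE sumr_ge0 // => i _; exact: excess_ge0.
rewrite -/f (@bigmax_eq_arg _ _ _ 0 S0 (mem F) f) //.
case: arg_maxP => [|S hS _]; first exact: h0.
by exists S => //; rewrite fE.
Qed.

Lemma exp_top_ge0 S : 0 <= exp_top k D S.
Proof.
rewrite -(expect_cst 0 hD); apply: le_expect => // x x0.
by rewrite top_sumE /top_map big_seq sumr_ge0 // => v /mem_top[j _ ->].
Qed.

Lemma opt_le (B : R) : 0 <= B -> (forall S, S \in F -> exp_top k D S <= B) -> opt k D F <= B.
Proof. by move=> B0 h; apply: bigmax_le. Qed.

Lemma surplus_le_opt : k%:R * T <= opt k D F.
Proof.
have [S SF hS] := surplus_attained.
apply: le_trans (surplus_le_exp_top hD T0 hS) _.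
exact: (le_bigmax_cond (I := {set 'I_n}) (P := mem F) _ (exp_top k D) SF).
Qed.

Lemma mass_product_ge am : am \in all_atoms X -> 0 < am.1 -> 0 < am.2 ->
  1 <= am.1 * am.2 * Z%:~R.
Proof.
move=> h v0 p0; have [q q0 e] := common_den_factor (all_atoms_nonneg hX) h.
have -> : am.1 * am.2 * Z%:~R =
    (numq am.1 * numq am.2 * (q * (1 + numq am.1)))%:~R.
  by rewrite /Z e /atom_weight !intrM !numqE; ring.
have n1 : 0 < numq am.1 by rewrite numq_gt0.
have n2 : 0 < numq am.2 by rewrite numq_gt0.
by rewrite -[1]/(1%:~R) ler_int -gtz0_ge1 !mulr_gt0 // addr_gt0.
Qed.

(** A positive surplus k T must come from an atom above T of positive mass, and this atom alone
    contributes at most the whole surplus. *)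
Lemma atom_over_threshold : 0 < T -> exists i am,
  [/\ am \in X i, T < ratr am.1, 0 < am.2 & ratr am.2 * (ratr am.1 - T) <= k%:R * T].
Proof.
move=> Tpos; have [S _ hS] := surplus_attained.
have mx (v : R) : 0 <= Num.max (v - T) 0 by rewrite le_max lexx orbT.
have [[i [am [iS ami hv hp]]]|no] := pselect (exists i am,
    [/\ i \in S, am \in X i, T < ratr am.1 & 0 < am.2]).
  exists i, am; split=> //; rewrite -hS (bigD1 i) //=.
  apply: ler_wpDr; first by rewrite sumr_ge0 // => j _; exact: excess_ge0.
  rewrite /excess /mean /D /real_dist big_map (big_rem am) //=.
  apply: ler_wpDr; last by rewrite ler_wpM2l ?ler0q ?(ltW hp) // le_max lexx.
  rewrite big_seq sumr_ge0 // => bm /mem_rem h.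
  by rewrite mulr_ge0 // ler0q; have [] := (hX i).1 bm h.
have : \sum_(i in S) excess (D i) T = 0.
  apply: big1 => i iS; rewrite /excess /mean /D /real_dist big_map big_seq big1 // => am ami /=.
  have [h1|h1] := ltP T (ratr am.1); last by rewrite (max_idPr _) ?mulr0 // subr_le0.
  have [|h2] := ltP 0 am.2; first by move=> h2; case: no; exists i, am.
  have [_ h3] := (hX i).1 am ami.
  by rewrite (_ : am.2 = 0) ?rmorph0 ?mul0r //; apply/eqP; rewrite eq_le h2.
rewrite hS => h; have : 0 < k%:R * T by rewrite mulr_gt0 // ltr0n.
by rewrite h ltxx.
Qed.

(* An atom v > T of mass p has p (v - T) <= k T, and p v is at least 1 / Z. *)
Lemma threshold_itv : 0 < T -> T <= Z%:~R /\ 1 <= T * (k.+1%:R * Z%:~R).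
Proof.
move=> Tpos; have [i [am [ami hv hp hle]]] := atom_over_threshold Tpos.
have ams := sub_all_atoms ami; have hs := all_atoms_nonneg hX.
have v0 : 0 < am.1 by rewrite -(ltr0q R); exact: lt_trans hv.
have Z1 : (1 : R) <= Z%:~R by rewrite -[1]/(1%:~R) ler_int -gtz0_ge1; exact: Z_gt0.
have p1 : (ratr am.2 : R) <= 1.
  rewrite -(rmorph1 (ratr : rat -> R)) ler_rat -(hX i).2 (big_rem am) //= lerDl.
  by rewrite big_seq sumr_ge0 // => bm /mem_rem h; have [] := (hX i).1 bm h.
split.
  apply: le_trans (ltW hv) _.
  (* With K = 1 the bound on scaled values says that the atom is below Z. *)
  have := sval_lt (K := 1) hs isT ams; rewrite -(ltr_int R) (sval_real 1 hs R ams).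
  rewrite !intrM mul1r !mul1r expr2 -!mulrA !(ltr_pM2l (lt_le_trans ltr01 Z1)).
  exact: ltW.
have : (1 : R) <= ratr (am.1 * am.2 * Z%:~R).
  by rewrite -(rmorph1 (ratr : rat -> R)) ler_rat mass_product_ge.
rewrite !rmorphM /= [ratr Z%:~R]ratr_int => h1.
apply: le_trans h1 _; rewrite [leRHS]mulrA ler_wpM2r //; first by apply: le_trans Z1.
have p0 : (0 : R) < ratr am.2 by rewrite ltr0q.
(* For an atom v of mass p, p v = p (v - T) + p T <= (k + 1) T. *)
have : ratr am.2 * T <= T by rewrite ler_piMl.
by rewrite -natr1; move: hle; move: (ratr am.1) (ratr am.2) => v p; nra.
Qed.

End Threshold.

Lemma set_value_le (R : realType) n k K (X : 'I_n -> seq (rat * rat)) (S A : {set 'I_n}) :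
  (0 < k)%N -> (0 < K)%N -> (forall i, nonneg_dist (X i)) ->
  let Z := common_den (all_atoms X) in
  let top := Posz k * Z ^+ n in
  let val := fun S => set_value K Z (Posz K * (Z * Z * Z)) (top + 1)
    (pack_init k (top + 1) k 0) top (all_atoms X) (tagged_items X S) in
  val S <= val A ->
  exp_top k (fun i => real_dist R (X i)) S <= exp_top k (fun i => real_dist R (X i)) A.
Proof.
move=> k0 K0 hX Z top val.
have Z0 : (0 : R) < Z%:~R by rewrite ltr0z; exact: Z_gt0.
have h0 : 0 < Z%:~R ^+ n * (K%:R * Z%:~R ^+ 2) :> R.
  by rewrite !mulr_gt0 ?exprn_gt0 // ltr0n.
rewrite -(ler_int R) /val /top.
have -> := set_value_real R k0 K0 hX S; have -> := set_value_real R k0 K0 hX A.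
by rewrite ler_pM2l.
Qed.

(** * Suitable scales and the final error *)

Section Quality.
Variables (R : realType) (n k m h b : nat) (X : 'I_n -> seq (rat * rat)).
Hypotheses (n0 : (0 < n)%N) (k0 : (0 < k)%N) (m1 : (1 < m)%N) (h0 : (0 < h)%N)
  (b1 : (1 < b)%N) (hX : forall i, nonneg_dist (X i)).
Variables (F : {set {set 'I_n}}) (T eps : R).
Let D i := real_dist R (X i).
Hypotheses (hF : F != finset.set0) (hT : is_surplus_threshold k D F T)
  (eps0 : 0 < eps) (hh : Lambda 4 k eps * (m ^ 2)%:R <= h%:R)
  (hb : Lambda 4 k eps * h%:R < b%:R) (em : eps ^+ 2 <= 6 / (m ^ 2)%:R)
  (meps : eps^-1 <= m%:R).
Let Z := common_den (all_atoms X).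
Let scale : R := (m * k.+1)%:R * Z%:~R ^+ 2.
Let big : int := Posz (m * k.+1) * (Z * Z * Z).

(** Both predicates are conditional on T > 0: for T = 0 every scale is acceptable because OPT is
    then 0. *)
Definition fine_enough (j : nat) : Prop := 0 < T -> T <= m%:R * (j%:~R / scale).
Definition good_scale (j : nat) : Prop :=
  0 < T -> T <= m%:R * (j%:~R / scale) <= 3 * T.

Let m0 : (0 : R) < m%:R.
Proof. by rewrite ltr0n ltnW. Qed.

Let Z0 : (0 : R) < Z%:~R.
Proof. by rewrite ltr0z; exact: Z_gt0. Qed.

Let scale0 : 0 < scale.
Proof. by rewrite mulr_gt0 ?exprn_gt0 // ltr0n muln_gt0 ltnW. Qed.

(** The starting scale is theta = Z, which already bounds T by [threshold_itv]. *)
Lemma fine_enough_big : fine_enough `|big|.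
Proof.
move=> Tpos; have [h1 _] := threshold_itv k0 hX hF hT Tpos.
have Zp : 0 < Z by exact: Z_gt0.
rewrite gez0_abs ?mulr_ge0 ?(ltW Zp) // (_ : big%:~R / scale = Z%:~R); last first.
  rewrite /big /scale !intrM pmulrn; field.
  by rewrite !gt_eqF // ltr0n muln_gt0 ltnW.
by apply: le_trans h1 _; rewrite ler_peMl ?(ltW Z0) // ler1n ltnW.
Qed.

(** If m theta > 3 T, halving the integer j loses at most half a unit besides the factor 2. As m
    units make at most T, the new m theta exceeds (3 T - T) / 2 = T. *)
Lemma fine_enough_half j : (0 < j)%N -> fine_enough j ->
  good_scale j \/ (0 < j./2)%N /\ fine_enough j./2.
Proof.
move=> j0 hj; have [Tpos|T0] := ltP 0 T; last by left=> h'; move: T0; rewrite leNgt h'.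
have [h1|h1] := leP (m%:R * (j%:~R / scale)) (3 * T).
  by left=> _; rewrite h1 hj.
right; have [_ h2] := threshold_itv k0 hX hF hT Tpos.
have Z1 : (1 : R) <= Z%:~R by rewrite -[1]/(1%:~R) ler_int -gtz0_ge1; exact: Z_gt0.
have h3 : m%:R / scale <= T.
  rewrite ler_pdivrMr // /scale natrM; apply: le_trans (_ : m%:R * (T * (k.+1%:R * Z%:~R)) <= _).
    by rewrite ler_peMr // ltW.
  have -> : m%:R * (T * (k.+1%:R * Z%:~R)) = T * (m%:R * k.+1%:R * Z%:~R) by ring.
  rewrite ler_wpM2l ?(ltW Tpos) // expr2 ler_wpM2l ?mulr_ge0 ?(ltW m0) //.
  by rewrite ler_peMl // ltW.
have h4 : (j%:R : R) <= 2 * (j./2)%:R + 1.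
  have : (j <= 2 * j./2 + 1)%N.
    by rewrite -{1}(odd_double_half j) mul2n addnC leq_add2l leq_b1.
  by rewrite -(ler_nat R) natrD natrM.
have h5 : T < m%:R * ((j./2)%:~R / scale).
  have h6 : m%:R / scale * j%:R <= m%:R / scale * (2 * (j./2)%:R + 1).
    by rewrite ler_wpM2l // divr_ge0 ?ltW.
  move: h1 h3 h6; rewrite -!pmulrn.
  have -> : m%:R * (j%:R / scale) = m%:R / scale * j%:R by ring.
  have -> : m%:R * (j./2%:R / scale) = m%:R / scale * j./2%:R by ring.
  by rewrite mulrDr mulr1 mulrCA; lra.
split; last by move=> _; exact: ltW.
rewrite lt0n; apply/eqP => j2; move: h5; rewrite j2 mul0r mulr0 => h5.
by have := lt_trans h5 Tpos; rewrite ltxx.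
Qed.

(** At a good scale theta <= 3 T / m <= 3 eps T, and 2 k ^ 2 + k + 7 <= 10 (k + 1) k, whence the
    constant 30. *)
Lemma covers_near_opt A sigma : A \in F -> (0 < sigma)%N -> good_scale sigma ->
  (forall S, S \in F -> covers k m h b X F (Posz sigma)
     (set_value (m * k.+1) Z big (Posz k * Z ^+ n + 1)
        (pack_init k (Posz k * Z ^+ n + 1) k 0) (Posz k * Z ^+ n)
        (all_atoms X) (tagged_items X A)) S) ->
  opt k D F <= exp_top k D A + 30 * (k.+1%:R * eps) * (k%:R * T).
Proof.
move=> AF s0 hs cov; have T0 := hT.1.
have hD i : is_dist (D i) by exact: D_dist.
have err0 : 0 <= 30 * (k.+1%:R * eps) * (k%:R * T) by rewrite !mulr_ge0 // ltW.
have A0 : 0 <= exp_top k D A by exact: exp_top_ge0.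
apply: opt_le => [|S SF]; first by rewrite addr_ge0.
have [Tpos|T'] := ltP 0 T; last first.
  have T'0 : T = 0 by apply/eqP; rewrite eq_le T'.
  apply: le_trans (exp_top_le_surplus k S hD T0) _.
  have := surplus_le hX hT (lexx T) SF.
  by rewrite T'0 !mulr0 add0r addr0 => h1; exact: le_trans h1 _.
have /andP[h1 h2] := hs Tpos.
have [S' S'F [e hle]] := cov S SF.
have h3 := weight_transfer n0 k0 m1 h0 b1 hX eps0 hh hb em (s0 : 0 < Posz sigma) hT h1 SF S'F (esym e).
have h4 : exp_top k D S' <= exp_top k D A.
  have K0 : (0 < m * k.+1)%N by rewrite muln_gt0 ltnW.
  exact: (@set_value_le R n k _ X S' A k0 K0 hX hle).
apply: le_trans h3 _; rewrite lerD //.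
have h5 : (sigma%:~R / scale : R) <= 3 * (eps * T).
  rewrite -(ler_pM2l m0); apply: le_trans h2 _.
  have h6 : 1 <= m%:R * eps by rewrite -(ler_pM2r (x := eps^-1)) ?invr_gt0 // mul1r mulfK ?gt_eqF.
  rewrite (_ : m%:R * _ = 3 * (m%:R * eps * T)); last by ring.
  by rewrite ler_wpM2l // ler_peMl.
have kR : (1 : R) <= k%:R by rewrite ler1n.
have h6 : (2 * k%:R ^+ 2 + k%:R + 7 : R) <= 10 * (k.+1%:R * k%:R).
  by rewrite -natr1 expr2; nra.
apply: le_trans (ler_pM _ _ h5 h6) _.
- by rewrite divr_ge0 // ltW.
- by rewrite !addr_ge0 // mulr_ge0 // exprn_ge0.
- by rewrite le_eqVlt; apply/orP; left; apply/eqP; ring.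
Qed.

End Quality.

Lemma exec_gt0 p v t w : exec p v t w -> (0 < t)%N.
Proof. by case. Qed.

(** b ^ 5, the square of b ^ 4 and one factor absorbing the increment give b ^ 14; S ^ 4, the square
    of S ^ 2 and n <= S give S ^ 9, the exponent [d] of the theorem. *)
Lemma time_budget b S C M n kap t : (0 < n)%N -> (0 < M)%N -> (n <= S)%N -> (2 <= b)%N ->
  (kap <= b ^ 4 * S ^ 2)%N ->
  (t <= b ^ 5 * (S ^ 4 * (kap ^ 2 * (C * (n * M).+1))))%N ->
  (t <= b ^ 14 * M * S ^ 9 * C)%N.
Proof.
move=> n1 M1 nS b2 hk ht; apply: leq_trans ht _.
have h1 : ((n * M).+1 <= b * (S * M))%N.
  apply: (@leq_trans (2 * (n * M))); first by rewrite mul2n -addnn -addn1 leq_add // muln_gt0 n1.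
  by rewrite leq_mul // leq_mul.
have h2 : (kap ^ 2 <= (b ^ 4 * S ^ 2) ^ 2)%N by rewrite leq_sqr.
apply: (@leq_trans (b ^ 5 * (S ^ 4 * ((b ^ 4 * S ^ 2) ^ 2 * (C * (b * (S * M))))))).
  by rewrite !leq_mul.
by apply: eq_leq; ring.
Qed.

Theorem theorem4p12 (R : realType) :
  exists (C0 C c : R) (d : nat),
    [/\ 0 < C0, 0 < C, 0 < c & bernoulli_saturation C0] /\
    forall (K : set_system_class) (Q : prog) (cost : seq bool -> nat -> nat),
      admits_exact_sum K Q cost ->
    forall (k : nat) (eps : R), (1 <= k)%N -> 0 < eps -> eps < 1 / 2 ->
    exists P : prog,
    forall (code : seq bool)
           (X : 'I_(ground_size K code) -> seq (rat * rat)) (T : R),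
      let n := ground_size K code in
      let F := set_family K code in
      let D := fun i => real_dist R (X i) in
      let W := k%:R * T in
      let OPT := opt k D F in
      let B := overhead c n k (Lambda C0 k eps) eps in
      valid_code K code -> (1 <= n)%N -> F != finset.set0 ->
      (forall i, nonneg_dist (X i)) ->
      is_surplus_threshold k D F T ->
      exists (S : {set 'I_n}) (time M : nat),
        [/\ S \in F,
            exec P (enc_instance code X) time (enc_set S),
            OPT - C * ((k.+1)%:R * eps) * W <= exp_top k D S,
            (1 - C * ((k.+1)%:R * eps)) * OPT
              <= OPT - C * ((k.+1)%:R * eps) * W &
            M%:R <= B /\
            time%:R <= B * ((value_size (enc_instance code X)) ^ d)%:R
                         * (cost code M)%:R].
Proof.
(* The constants come from [bern_saturated], [covers_near_opt], [overhead_ge] and [time_budget], in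
   this order. *)
exists 4, 30, 10, 9%N; split; first by split=> //; exact: bernoulli_saturation_4.
move=> K Q cost [solves _] k eps k0 eps0 eps2.
pose m := mesh eps; pose h := mass_grid k eps; pose b := code_base k eps.
have m2 : (2 < m)%N := mesh_gt2 eps0 eps2.
have sm : (k.*2.+2 < saturation_mean k eps)%N := saturation_mean_gt k0 eps0 eps2.
have [b80 kb Lb Kb hb] := code_base_bounds k0 eps0 eps2.
rewrite -/m -/h -/b in b80 kb Lb Kb hb.
have m1 : (1 < m)%N by exact: ltnW.
have m0 : (0 < m)%N by exact: ltnW.
have h0 : (0 < h)%N.
  by rewrite /h /mass_grid muln_gt0 expn_gt0 m0 (leq_ltn_trans _ sm).
have b1 : (1 < b)%N by exact: leq_trans b80.
exists (main_prog k m h b Q) => code X T /= codeP n0 hF hX hT.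
set n := ground_size K code in X n0 hF hX hT *.
set F := set_family K code in hF hT *.
pose M := (radix n k m h b ^ (m ^ 2).*2.+1)%N.
pose S := value_size (enc_instance code X).
pose U := int_bound X k m h b.
pose kap := bit_bound X code k m h b.
have M0 : (0 < M)%N by rewrite expn_gt0.
have nS : (n <= S)%N := ltnW (n_le_size X code).
have kapP x : 0 <= x <= U -> (bitlen x <= kap)%N.
  move=> /andP[x0 xU]; apply: (@leq_trans (bitlen U)).
    by apply: bitlen_mono; rewrite -lez_nat !gez0_abs // (le_trans x0).
  by rewrite /kap /bit_bound -addnA leq_addr.
have Skap : (S <= kap)%N by rewrite /kap /bit_bound -addnA addnCA leq_addr.
have kap100 : (100 <= kap)%N by rewrite /kap /bit_bound leq_addl.
have const := const_le_bound hX k0 m0 (b := b) (h := h).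
have [c1 c2 c3 c4 [c5 c6]] := consts_bounds hX n0 k0 kb Lb Kb hb h0 m0 b80.
have magn := magnitude_le_bound hX k0 h0 m0 b80.
have [g1 g2 g3] := radix_bounds k m h b n0.
have [s1 s2 s3 s4 s5] := scaling_le_bound hX n0 k0 kb Lb Kb hb h0 m0 b80.
have queryP (w : 'I_n -> int) (t : int) :
    (forall i, `|w i| <= M)%N -> (`|t| <= n * M)%N ->
    exists (o : option {set 'I_n}) (time : nat),
    [/\ exec Q (VPair (enc_bits code) (VPair (enc_seq [seq VInt (w i) | i <- enum 'I_n]) (VInt t)))
          time (enc_answer o),
        exact_sum_answer F w t o & (time <= cost code M)%N].
  by move=> hw ht; exact: solves.
have [A [sigma [[t hrun ht] AF [s0 hgood] cov]]] := run_main R n0 k0 m1 h0 b1 hX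
  kapP (fun am => small_atom_size (am := am) Skap) (item_size_le X code) (magn _ g1) (const _ c1) (const _ c2)
  (const _ c3) (const _ c4) s1 (magn _ g2) (magn _ g3) (magn _ (leqnn _)) s2 s3 s4 s5
  queryP (fine_enough_half k0 m1 hX hF hT) (const _ c5) (const _ c6)
  (fine_enough_big k0 m1 hX hF hT) hF.
have /andP[em _] := mesh_itv eps0 eps2.
have hopt := covers_near_opt n0 k0 m1 h0 b1 hX hT eps0
  (mass_grid_ge k0 eps0 eps2) (code_base_gt k0 eps0 eps2) (eps_sqr_le eps0 eps2) (ltW em)
  AF s0 hgood cov.
(* A query takes positive time, so its cost can multiply the work done between queries. *)
have C0 : (0 < cost code M)%N.
  have [ans [time [/exec_gt0 e _]]] := queryP (fun=> 0) 0 (fun=> leq0n _) (leq0n _).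
  exact: leq_trans.
have hB := overhead_ge k0 eps0 eps2 n0; rewrite -/m -/h -/b -/M in hB.
exists A, t, M; split=> //.
- by rewrite lerBlDr.
(* The second inequality amounts to W = k T <= OPT. *)
- rewrite mulrBl mul1r lerD2l lerN2; apply: ler_wpM2l; first by rewrite !mulr_ge0 // ltW.
  exact: surplus_le_opt.
split; first by apply: le_trans hB; rewrite ler_nat leq_pmull // expn_gt0 ltnW.
apply: (@le_trans _ _ ((b ^ 14 * M) * S ^ 9 * cost code M)%:R).
  rewrite ler_nat; apply: (@time_budget b S (cost code M) M n kap) => //.
    exact: bitlen_int_bound.
  apply: leq_trans ht _; by apply: total_time_le => //; exact: ltnW.
by rewrite 2!natrM; do 2!apply: ler_wpM2r => //.
Qed.
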